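(* Assume the Riemann hypothesis. Let $m\ge 1$ be an integer and $\boldsymbol{\beta}=(\beta_1,\ldots,\beta_m)$ with $\beta_k\ge 0$ for all $k$. For $T$ large let $\boldsymbol{\alpha}=\boldsymbol{\alpha}(T)=(\alpha_1,\ldots,\alpha_m)\in\mathbb{R}^m$ satisfy $|\alpha_k|\le T/2$ for $k=1,\ldots,m$, and define \[ M_{\boldsymbol{\alpha},\boldsymbol{\beta}}(T)=\int_T^{2T}\prod_{k=1}^m\bigl|\zeta(\tfrac12+i(t+\alpha_k))\bigr|^{2\beta_k}\,dt . \] Then there is a constant $c>0$ depending only on $\boldsymbol{\beta}$ (and $m$) such that, for all $T$ sufficiently large in terms of $\boldsymbol{\beta}$, \[ M_{\boldsymbol{\alpha},\boldsymbol{\beta}}(T)\ \ge\ c\, T(\log T)^{\beta_1^2+\cdots+\beta_m^2}\prod_{1\le j<k\le m}\bigl|\zeta\bigl(1+i(\alpha_j-\alpha_k)+1/\log T\bigr)\bigr|^{2\beta_j\beta_k}. \]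
   Context: $\zeta$ is the Riemann zeta function. The shifts $\alpha_k$ may depend on $T$; the constant $c$ is uniform in them. *)

(* Defs.v *)
From HB Require Import structures.
From mathcomp Require Import all_boot all_order all_algebra.
From mathcomp Require Import all_classical all_reals all_analysis.
From mathcomp Require Import complex.

Set Implicit Arguments.
Unset Strict Implicit.
Unset Printing Implicit Defensive.

Import Order.TTheory GRing.Theory Num.Theory.
Import numFieldNormedType.Exports.

Local Open Scope classical_set_scope.
Local Open Scope ring_scope.
Local Open Scope complex_scope.

Definition cabs (R : realType) (z : R[i]) : R := ComplexField.Normc.normc z.

Definition cexp (R : realType) (z : R[i]) : R[i] :=
  (expR (complex.Re z) * cos (complex.Im z))
    +i* (expR (complex.Re z) * sin (complex.Im z)).

Definition natpow (R : realType) (n : nat) (s : R[i]) : R[i] :=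
  cexp (s * (ln (n%:R : R))%:C).

(* The topology on the complex numbers is the one carried by the regular
   module [R[i]^o] over the numFieldType [R[i]]; in particular [derivable]
   below is complex differentiability, the increment ranging over [R[i]]. *)
Definition is_riemann_zeta (R : realType) (f : R[i] -> R[i]) : Prop :=
  (forall s : R[i], 1 < complex.Re s ->
     series (fun n : nat => natpow n.+1 (- s) : R[i]^o) @ \oo
       --> (f s : R[i]^o)) /\
  (forall s : R[i], s != 1 -> derivable (f : R[i]^o -> R[i]^o) s 1).

(* The analytic continuation of the Dirichlet series to the complex plane minus
   the pole at 1. It is unique there; the value at 1 itself is unspecified. *)
Definition zeta (R : realType) : R[i] -> R[i] :=
  xget (fun=> 0) [set f | @is_riemann_zeta R f].

Definition riemann_hypothesis (R : realType) : Prop :=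
  forall s : R[i], 0 < complex.Re s -> complex.Re s < 1 ->
    zeta s = 0 -> complex.Re s = 2^-1.

Definition shifted_moment (R : realType) (m : nat) (alpha beta : 'I_m -> R)
    (T : R) : R :=
  \int[lebesgue_measure]_(t in `[T, 2 * T])
    \prod_(k < m) cabs (zeta (2^-1 +i* (t + alpha k))) `^ (2 * beta k).

(* Main.v *)
(* The mean square of F = prod_k zeta(s + i alpha_k)^beta_k is bounded below by duality. Under
   RH, F is holomorphic on rectangles to the right of the critical line and away from
   the pole. For a Dirichlet polynomial D, nonnegativity of |F - D|^2 on a vertical line gives
   int |F|^2 >= 2 Re int F conj(D) - int |D|^2 for any weight in [0, 1]. The weight is the
   polynomial (1 - z^2)^K, which vanishes to high order at both ends of [T, 2T]: so the line of
   the first integral can be moved to Re s = 2, where F is given by its Dirichlet series, at the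
   price of negligible horizontal segments, and off-diagonal terms are negligible by repeated
   integration by parts. D runs over squarefree n <= sqrt T whose prime factors are at most
   T^kappa and carries the coefficients b(n) of F, where b(p) = sum_k beta_k p^(-i alpha_k); the
   diagonal is T sum |b(n)|^2 / n. Rankin's trick reduces this sum to the exponential of
   sum_p |b(p)|^2 / p, and expanding |b(p)|^2 into the terms beta_j beta_k p^(i (alpha_k - alpha_j))
   turns it into the logarithms of zeta(1 + 1 / log T + i (alpha_j - alpha_k)). The estimates are
   made on Re s = s0 > 1/2, and s0 tends to 1/2 at the end. *)
Require Import Defs.
From mathcomp Require Import all_boot all_order all_algebra.
From mathcomp Require Import all_classical all_reals all_analysis.
From mathcomp Require Import complex.
From mathcomp Require Import ring lra zify.

Set Implicit Arguments.
Unset Strict Implicit.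
Unset Printing Implicit Defensive.

Import Order.TTheory GRing.Theory Num.Theory.
Import numFieldNormedType.Exports.

Local Open Scope classical_set_scope.
Local Open Scope ring_scope.
Local Open Scope complex_scope.

Local Notation Re := complex.Re.
Local Notation Im := complex.Im.

(** * Complex exponential and complex derivatives *)

(** The definition of [zeta] does not assert that the continuation exists: without one, [zeta] would
    be the zero function. The Riemann hypothesis rules this default out, and the growth of zeta in
    the strip is then recovered from Euler-Maclaurin sums whose convergence on the right spreads to
    the left.

    The exponents [beta k] are real, so F has to be the exponential of a combination of holomorphic
    logarithms. These are fixed only up to multiples of 2 pi i; on Re s = 2, F therefore agrees with
    its Dirichlet series only up to a constant of modulus 1, to which |F| is blind. Since conj(D) is
    not holomorphic, what moves to the right with F is the entire Dirichlet polynomial that equals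
    conj(D) on Re s = s0.

    All knowledge about primes comes from the pole of zeta at 1, by comparing the sums of p^(-1-a)
    at a and at 2a. Uniformity in the shifts is free: for j and k distinct, zeta(1 + 1/log T + i
    (alpha_j - alpha_k)) is only bounded from above by primes, and it enters with nonnegative
    exponents.

    K = b + 5, with an integer b >= sum of the [beta k], lets the powers of T gained from the weight
    outweigh |F| <= (63 T)^b and the sums over n. The exponent kappa depends on beta alone and is
    dictated by Rankin's trick. *)

Section ComplexBasics.
Context {R : realType}.
Implicit Types (z w h : R[i]) (x y : R).

Lemma ReD z w : Re (z + w) = Re z + Re w. Proof. by case: z; case: w. Qed.
Lemma ImD z w : Im (z + w) = Im z + Im w. Proof. by case: z; case: w. Qed.
Lemma ReN z : Re (- z) = - Re z. Proof. by case: z. Qed.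
Lemma ImN z : Im (- z) = - Im z. Proof. by case: z. Qed.
Lemma ReM z w : Re (z * w) = Re z * Re w - Im z * Im w.
Proof. by case: z; case: w. Qed.
Lemma ImM z w : Im (z * w) = Re z * Im w + Im z * Re w.
Proof. by case: z; case: w. Qed.
Lemma ReMr z x : Re (z * x%:C) = Re z * x.
Proof. by rewrite ReM /= mulr0 subr0. Qed.
Lemma ImMr z x : Im (z * x%:C) = Im z * x.
Proof. by rewrite ImM /= mulr0 add0r. Qed.

Lemma complex_eq z w : Re z = Re w -> Im z = Im w -> z = w.
Proof. by case: z => a b; case: w => c d /= -> ->. Qed.

Lemma cabsE z : cabs z = Num.sqrt (Re z ^+ 2 + Im z ^+ 2).
Proof. by case: z. Qed.
Lemma cabs_ge0 z : 0 <= cabs z. Proof. by rewrite cabsE sqrtr_ge0. Qed.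
Lemma cabs_sqr z : cabs z ^+ 2 = Re z ^+ 2 + Im z ^+ 2.
Proof. by rewrite cabsE sqr_sqrtr// addr_ge0// sqr_ge0. Qed.
Lemma cabs0 : cabs (0 : R[i]) = 0. Proof. exact: ComplexField.Normc.normc0. Qed.
Lemma cabs1 : cabs (1 : R[i]) = 1. Proof. exact: ComplexField.Normc.normc1. Qed.
Lemma cabs0_eq z : cabs z = 0 -> z = 0.
Proof. exact: ComplexField.Normc.eq0_normc. Qed.
Lemma cabs_gt0 z : (0 < cabs z) = (z != 0).
Proof.
rewrite lt_neqAle cabs_ge0 andbT eq_sym; congr negb.
by apply/eqP/eqP => [/cabs0_eq//|->]; exact: cabs0.
Qed.
Lemma cabsM z w : cabs (z * w) = cabs z * cabs w.
Proof. exact: ComplexField.Normc.normcM. Qed.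
Lemma cabsV z : cabs z^-1 = (cabs z)^-1.
Proof. exact: ComplexField.Normc.normcV. Qed.
Lemma cabsN z : cabs (- z) = cabs z.
Proof. by rewrite !cabsE ReN ImN !sqrrN. Qed.
Lemma cabsX z n : cabs (z ^+ n) = cabs z ^+ n.
Proof. by elim: n => [|n IH]; rewrite ?expr0 ?cabs1// !exprS cabsM IH. Qed.
Lemma cabsD z w : cabs (z + w) <= cabs z + cabs w.
Proof. exact: le_normcD. Qed.
Lemma cabsB z w : cabs (z - w) <= cabs z + cabs w.
Proof. by rewrite (le_trans (cabsD _ _))// cabsN. Qed.
Lemma cabsBC z w : cabs (z - w) = cabs (w - z).
Proof. by rewrite -cabsN opprB. Qed.
Lemma cabsB_ge z w : cabs z - cabs w <= cabs (z - w).
Proof. by rewrite lerBlDr (le_trans _ (cabsD _ _))// subrK. Qed.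
Lemma cabs_real x : cabs x%:C = `|x|.
Proof. by rewrite cabsE /= expr0n addr0 sqrtr_sqr. Qed.
Lemma cabs_conj z : cabs z^* = cabs z.
Proof. by rewrite !cabsE; case: z => a b /=; rewrite sqrrN. Qed.
Lemma cabs_i x : cabs (0 +i* x) = `|x|.
Proof. by rewrite cabsE /= expr0n add0r sqrtr_sqr. Qed.
Lemma Re_le_cabs z : `|Re z| <= cabs z.
Proof.
by rewrite -(sqrtr_sqr (Re z)) cabsE ler_wsqrtr// lerDl sqr_ge0.
Qed.
Lemma Im_le_cabs z : `|Im z| <= cabs z.
Proof.
by rewrite -(sqrtr_sqr (Im z)) cabsE ler_wsqrtr// lerDr sqr_ge0.
Qed.
Lemma cabs_le_ReIm z : cabs z <= `|Re z| + `|Im z|.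
Proof.
rewrite {1}(complexE z) (le_trans (cabsD _ _))// cabsM !cabs_real.
by rewrite cabs_i normr1 mul1r.
Qed.
Lemma cabs_sum (I : Type) (r : seq I) (P : pred I) (F : I -> R[i]) :
  cabs (\sum_(i <- r | P i) F i) <= \sum_(i <- r | P i) cabs (F i).
Proof.
elim/big_ind2 : _ => [|z1 x1 z2 x2 h1 h2|//]; first by rewrite cabs0.
by rewrite (le_trans (cabsD _ _))// lerD.
Qed.
Lemma cabs_prod (I : Type) (r : seq I) (P : pred I) (F : I -> R[i]) :
  cabs (\prod_(i <- r | P i) F i) = \prod_(i <- r | P i) cabs (F i).
Proof.
elim/big_rec2 : _ => [|i y1 y2 _ <-]; [exact: cabs1|exact: cabsM].
Qed.
Lemma Re_sum (I : Type) (r : seq I) (P : pred I) (F : I -> R[i]) :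
  Re (\sum_(i <- r | P i) F i) = \sum_(i <- r | P i) Re (F i).
Proof. by elim/big_rec2 : _ => [//|i y1 y2 _ <-]; rewrite ReD. Qed.
Lemma mulJ z : z * z^* = (cabs z ^+ 2)%:C.
Proof.
by rewrite cabs_sqr; case: z => a b; apply: complex_eq => /=; ring.
Qed.
Lemma real_complexM x y : (x * y)%:C = x%:C * y%:C. Proof. exact: rmorphM. Qed.
Lemma real_complexD x y : (x + y)%:C = x%:C + y%:C. Proof. exact: rmorphD. Qed.
Lemma real_complexV x : (x^-1)%:C = (x%:C)^-1. Proof. exact: fmorphV. Qed.

Lemma cexp0 : cexp (0 : R[i]) = 1.
Proof. by rewrite /cexp /= expR0 cos0 sin0 mulr0 mulr1. Qed.
Lemma cexpD z w : cexp (z + w) = cexp z * cexp w.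
Proof.
by apply: complex_eq => /=; rewrite ReD ImD expRD ?cosD ?sinD; ring.
Qed.
Lemma cabs_cexp z : cabs (cexp z) = expR (Re z).
Proof.
rewrite cabsE /= !exprMn -mulrDr cos2Dsin2 mulr1 sqrtr_sqr.
by rewrite ger0_norm// expR_ge0.
Qed.
Lemma cexp_neq0 z : cexp z != 0.
Proof. by rewrite -cabs_gt0 cabs_cexp expR_gt0. Qed.
Lemma cexpN z : cexp (- z) = (cexp z)^-1.
Proof.
apply: (mulIf (cexp_neq0 z)); rewrite -cexpD addNr cexp0 mulVf//.
exact: cexp_neq0.
Qed.
Lemma cexpB z w : cexp (z - w) = cexp z / cexp w.
Proof. by rewrite cexpD cexpN. Qed.
Lemma cexp_sum (I : Type) (r : seq I) (P : pred I) (F : I -> R[i]) :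
  cexp (\sum_(i <- r | P i) F i) = \prod_(i <- r | P i) cexp (F i).
Proof. by apply: (big_morph _ cexpD cexp0). Qed.
Lemma cexp_real x : cexp x%:C = (expR x)%:C.
Proof. by rewrite /cexp /= cos0 sin0 mulr1 mulr0. Qed.
Lemma cexp_conj z : cexp z^* = (cexp z)^*.
Proof. by case: z => a b; rewrite /cexp /= cosN sinN mulrN. Qed.

End ComplexBasics.

Section ComplexDerivative.
Context {R : realType}.
Implicit Types (z w h l : R[i]) (f g : R[i] -> R[i]).

(** Division-free and with real tolerances measured by [cabs]: h = 0 needs no exception, and the
    calculus rules become plain estimates. *)
Definition cdiff f z l := forall e : R, 0 < e -> exists2 d : R, 0 < d &
  forall h, cabs h < d -> cabs (f (z + h) - f z - l * h) <= e * cabs h.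

Definition ccont f z := forall e : R, 0 < e -> exists2 d : R, 0 < d &
  forall h, cabs h < d -> cabs (f (z + h) - f z) <= e.

Definition cdiffable f z := exists l, cdiff f z l.

Lemma cdiff_cont f z l : cdiff f z l -> ccont f z.
Proof.
move=> df e e0; have [d d0 H] := df 1 ltr01.
have l1 : 0 < cabs l + 1 by rewrite ltr_wpDl// cabs_ge0.
exists (Num.min d (e / (cabs l + 1))); first by rewrite lt_min d0 divr_gt0.
move=> h; rewrite lt_min => /andP[/H hd he].
have -> : f (z + h) - f z = (f (z + h) - f z - l * h) + l * h by ring.
rewrite (le_trans (cabsD _ _))// cabsM.
rewrite ltr_pdivlMr// in he; have := cabs_ge0 h; have := cabs_ge0 l; nra.
Qed.

Lemma cdiff_cst a z : cdiff (fun=> a) z 0.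
Proof.
move=> e e0; exists 1 => // h _.
by rewrite subrr mul0r subr0 cabs0 mulr_ge0 ?cabs_ge0 ?ltW.
Qed.

Lemma cdiff_id z : cdiff id z 1.
Proof.
move=> e e0; exists 1 => // h _.
have -> : z + h - z - 1 * h = 0 by ring.
by rewrite cabs0 mulr_ge0 ?cabs_ge0 ?ltW.
Qed.

Lemma cdiff_eq f z l l' : cdiff f z l -> l = l' -> cdiff f z l'.
Proof. by move=> ? <-. Qed.

Lemma cdiff_near f g z l (r : R) : 0 < r ->
  (forall w, cabs (w - z) < r -> f w = g w) -> cdiff f z l -> cdiff g z l.
Proof.
move=> r0 fg df e e0; have [d d0 H] := df e e0.
exists (Num.min d r); first by rewrite lt_min d0.
move=> h; rewrite lt_min => /andP[hd hr].
rewrite -!fg ?subrr ?cabs0// ?H//.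
by have -> : z + h - z = h by ring.
Qed.

Lemma cdiff_ext f g z l : (forall w, f w = g w) -> cdiff f z l -> cdiff g z l.
Proof. by move=> fg; apply: (@cdiff_near _ _ _ _ 1). Qed.

Lemma cdiff_exteq f g z l k : cdiff f z l -> (forall w, f w = g w) -> l = k ->
  cdiff g z k.
Proof. by move=> df fg <-; exact: cdiff_ext df. Qed.

Lemma cdiffD f g z l k : cdiff f z l -> cdiff g z k ->
  cdiff (fun w => f w + g w) z (l + k).
Proof.
move=> df dg e e0; have e2 : 0 < e / 2 by rewrite divr_gt0.
have [d d0 H] := df _ e2; have [d' d'0 H'] := dg _ e2.
exists (Num.min d d'); first by rewrite lt_min d0.
move=> h; rewrite lt_min => /andP[/H hd /H' hr].
have -> : f (z + h) + g (z + h) - (f z + g z) - (l + k) * h =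
  (f (z + h) - f z - l * h) + (g (z + h) - g z - k * h) by ring.
by rewrite (le_trans (cabsD _ _))// (splitr e) mulrDl lerD.
Qed.

Lemma cdiff_comp f g z l k : cdiff f z l -> cdiff g (f z) k ->
  cdiff (fun w => g (f w)) z (k * l).
Proof.
move=> df dg e e0.
pose A := cabs l + 1; pose B := cabs k + 1.
have A0 : 0 < A by rewrite ltr_wpDl// cabs_ge0.
have B0 : 0 < B by rewrite ltr_wpDl// cabs_ge0.
have eA : 0 < e / 2 / A by rewrite !divr_gt0.
have eB : 0 < e / 2 / B by rewrite !divr_gt0.
have [d d0 Hg] := dg _ eA.
have [d1 d10 Hf1] := df _ eB.
have [d2 d20 Hf2] := df _ (@ltr01 R).
exists (Num.min (Num.min d1 d2) (d / A)).
  by rewrite !lt_min d10 d20 divr_gt0.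
move=> h; rewrite !lt_min => /andP[/andP[/Hf1 h1 /Hf2 h2] hd].
rewrite ltr_pdivlMr// in hd.
set u := f (z + h) - f z.
have uE : f (z + h) = f z + u by rewrite /u; ring.
have hu : cabs u <= A * cabs h.
  have -> : u = (f (z + h) - f z - l * h) + l * h by rewrite /u; ring.
  by rewrite (le_trans (cabsD _ _))// cabsM /A; lra.
have ud : cabs u < d by rewrite (le_lt_trans hu)// mulrC.
rewrite uE.
have -> : g (f z + u) - g (f z) - k * l * h =
  (g (f z + u) - g (f z) - k * u) + k * (f (z + h) - f z - l * h).
  by rewrite /u; ring.
rewrite (le_trans (cabsD _ _))// cabsM.
have h3 : cabs (g (f z + u) - g (f z) - k * u) <= e / 2 * cabs h.
  rewrite (le_trans (Hg _ ud))// (le_trans (ler_wpM2l (ltW eA) hu))//.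
  by rewrite mulrA divfK// gt_eqF.
have h4 : cabs k * cabs (f (z + h) - f z - l * h) <= e / 2 * cabs h.
  rewrite (le_trans (ler_wpM2l (cabs_ge0 _) h1))//.
  rewrite mulrA ler_wpM2r ?cabs_ge0//.
  rewrite mulrCA ler_piMr ?ltW ?divr_gt0//.
  by rewrite ltr_pdivrMr// mul1r /B ltrDl.
by lra.
Qed.

Lemma cdiffM f g z l k : cdiff f z l -> cdiff g z k ->
  cdiff (fun w => f w * g w) z (l * g z + f z * k).
Proof.
move=> df dg e e0.
pose A := cabs (f z) + 1; pose B := cabs (g z) + 1 + cabs k.
have A0 : 0 < A by rewrite ltr_wpDl// cabs_ge0.
have B0 : 0 < B by rewrite ltr_wpDr ?cabs_ge0// ltr_wpDl ?cabs_ge0.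
pose D := cabs l + 1.
have D0 : 0 < D by rewrite ltr_wpDl// cabs_ge0.
have eA : 0 < e / 3 / A by rewrite !divr_gt0.
have eB : 0 < e / 3 / B by rewrite !divr_gt0.
have eD : 0 < e / 3 / D by rewrite !divr_gt0.
have [d d0 Hg] := dg _ eA.
have [d1 d10 Hf] := df _ eB.
have [d2 d20 Hg1] := cdiff_cont dg ltr01.
have [d3 d30 Hg2] := cdiff_cont dg eD.
exists (Num.min (Num.min d d1) (Num.min d2 d3)).
  by rewrite !lt_min d0 d10 d20.
move=> h; rewrite !lt_min.
move=> /andP[/andP[/Hg hg /Hf hf] /andP[/Hg1 hg1 /Hg2 hg2]].
have -> : f (z + h) * g (z + h) - f z * g z - (l * g z + f z * k) * h =
  (f (z + h) - f z - l * h) * g (z + h) +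
  (f z * (g (z + h) - g z - k * h) + l * h * (g (z + h) - g z)) by ring.
rewrite (le_trans (cabsD _ _))//.
have h1 : cabs ((f (z + h) - f z - l * h) * g (z + h)) <= e / 3 * cabs h.
  rewrite cabsM; apply: (@le_trans _ _ (e / 3 / B * cabs h * B)).
    apply: ler_pM => //; rewrite ?cabs_ge0//.
    have -> : g (z + h) = (g (z + h) - g z) + g z by ring.
    by rewrite (le_trans (cabsD _ _))// /B; have := cabs_ge0 k; lra.
  by rewrite mulrAC divfK// gt_eqF.
have h2 : cabs (f z * (g (z + h) - g z - k * h)) <= e / 3 * cabs h.
  rewrite cabsM; apply: (@le_trans _ _ (A * (e / 3 / A * cabs h))).
    apply: ler_pM => //; rewrite ?cabs_ge0//.
    by rewrite /A lerDl.
  by rewrite mulrA (mulrC A) divfK// gt_eqF.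
have h3 : cabs (l * h * (g (z + h) - g z)) <= e / 3 * cabs h.
  rewrite !cabsM mulrAC ler_wpM2r ?cabs_ge0//.
  apply: (@le_trans _ _ (D * (e / 3 / D))).
    by apply: ler_pM => //; rewrite ?cabs_ge0// /D lerDl.
  by rewrite (mulrC D) divfK// gt_eqF.
by rewrite (le_trans (lerD h1 (le_trans (cabsD _ _) (lerD h2 h3))))//; lra.
Qed.

Lemma cdiffZ a f z l : cdiff f z l -> cdiff (fun w => a * f w) z (a * l).
Proof.
move=> df; apply: (cdiff_eq (cdiffM (cdiff_cst a z) df)).
by rewrite mul0r add0r.
Qed.

Lemma cdiffN f z l : cdiff f z l -> cdiff (fun w => - f w) z (- l).
Proof.
move=> /(cdiffZ (-1)); rewrite mulN1r; apply: cdiff_ext => w.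
by rewrite mulN1r.
Qed.

Lemma cdiffB f g z l k : cdiff f z l -> cdiff g z k ->
  cdiff (fun w => f w - g w) z (l - k).
Proof. by move=> df /cdiffN dg; exact: cdiffD. Qed.

Lemma cdiff_sum (I : Type) (r : seq I) (F : I -> R[i] -> R[i])
    (L : I -> R[i]) z : (forall i, cdiff (F i) z (L i)) ->
  cdiff (fun w => \sum_(i <- r) F i w) z (\sum_(i <- r) L i).
Proof.
move=> dF; elim: r => [|i r IH].
  rewrite big_nil; apply: (cdiff_ext _ (cdiff_cst 0 z)) => w.
  by rewrite big_nil.
rewrite big_cons; apply: (cdiff_ext _ (cdiffD (dF i) IH)) => w.
by rewrite big_cons.
Qed.

Lemma cdiffX n z : cdiff (fun w => w ^+ n) z (n%:R * z ^+ n.-1).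
Proof.
elim: n => [|n IH].
  by rewrite mul0r; apply: (cdiff_ext _ (cdiff_cst 1 z)) => w; rewrite expr0.
have H := cdiffM (cdiff_id z) IH.
apply: (cdiff_exteq H) => [w|]; first by rewrite exprS.
case: n {IH H} => [|n] /=; first by rewrite ?expr0; ring.
by rewrite -natr1 exprS; ring.
Qed.

Lemma cdiff_horner (p : {poly R[i]}) z : cdiff (horner p) z p^`().[z].
Proof.
elim/poly_ind: p => [|p a IH].
  by rewrite deriv0 horner0; apply: cdiff_ext (cdiff_cst 0 z) => w;
    rewrite horner0.
have H := cdiffD (cdiffM IH (cdiff_id z)) (cdiff_cst a z).
apply: (cdiff_exteq H) => [w|]; first by rewrite hornerMXaddC.
by rewrite derivD derivM derivX derivC !hornerE; ring.
Qed.

Lemma cdiffV z : z != 0 -> cdiff (fun w => w^-1) z (- z ^- 2).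
Proof.
move=> z0 e e0.
have a0 : 0 < cabs z by rewrite cabs_gt0.
set a := cabs z in a0.
exists (Num.min (a / 2) (e * a ^+ 3 / 2)).
  by rewrite lt_min !divr_gt0// mulr_gt0// exprn_gt0.
move=> h; rewrite lt_min => /andP[h1 h2].
have zh : a / 2 <= cabs (z + h).
  have := cabsB_ge z (- h); rewrite opprK cabsN -/a; lra.
have zh0 : z + h != 0 by rewrite -cabs_gt0 (lt_le_trans _ zh)// divr_gt0.
have -> : (z + h)^-1 - z^-1 - - z ^- 2 * h = h * h * (z ^- 2 * (z + h)^-1).
  by field; rewrite z0 zh0.
rewrite !cabsM !cabsV cabsX -/a mulrAC ler_wpM2r ?cabs_ge0//.
rewrite mulrA ler_pdivrMr ?(lt_le_trans _ zh) ?divr_gt0//.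
rewrite ler_pdivrMr ?exprn_gt0//.
apply: (le_trans (ltW h2)).
have -> : e * a ^+ 3 / 2 = e * (a / 2) * a ^+ 2 by rewrite !exprS expr0; field.
by apply: ler_wpM2r; [rewrite exprn_ge0// ltW|apply: ler_wpM2l => //; rewrite ltW].
Qed.

End ComplexDerivative.

Section Bridges.

(** Kept over an arbitrary [numFieldType] because it serves twice: over R for real derivatives, and
    over [R[i]] for the derivability required in [is_riemann_zeta]. *)
Lemma is_derive_epsdelta {K : numFieldType} (f : K^o -> K^o) (x l : K) :
  is_derive (x : K^o) (1 : K^o) f l <->
  forall e : K, 0 < e -> exists2 d : K, 0 < d &
    forall h : K, `|h| < d -> `|f (x + h) - f x - l * h| <= e * `|h|.
Proof.
pose q (h : K) : K^o := h^-1 *: ((f \o shift x) (h *: (1 : K^o)) - f x).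
have qE h : h != 0 -> q h = (f (x + h) - f x) / h.
  move=> h0; rewrite /q /= /shift /=.
  have -> : h *: (1 : K^o) + x = x + h by rewrite addrC; congr (_ + _); exact: mulr1.
  exact: mulrC.
have key : (q h @[h --> (0:K)^'] --> (l : K^o)) <->
  forall e : K, 0 < e -> exists2 d : K, 0 < d &
    forall h : K, `|h| < d -> `|f (x + h) - f x - l * h| <= e * `|h|.
  split=> H.
    move=> e e0; have /cvgrPdist_le/(_ e e0) := H.
    case/nbhs_ballP => d /= d0 Hd; exists d => // h hd.
    have [->|h0] := eqVneq h 0.
      by rewrite addr0 subrr mulr0 subr0 normr0 mulr0.
    have := Hd h; rewrite /ball /= sub0r normrN => /(_ hd h0).
    rewrite qE// -(ler_pM2r (_ : 0 < `|h|)) ?normr_gt0// -normrM.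
    by rewrite mulrBl divfK// -normrN opprB.
  apply/cvgrPdist_le => e e0; have [d d0 Hd] := H e e0.
  apply/nbhs_ballP; exists d => //= h; rewrite /ball /= sub0r normrN => hd h0.
  rewrite qE// -(ler_pM2r (_ : 0 < `|h|)) ?normr_gt0// -normrM.
  by rewrite mulrBl divfK// -normrN opprB Hd.
rewrite -key; split=> [[df <-]|ql]; first exact: df.
split; first by apply/cvg_ex; exists l.
exact: (cvg_lim _ ql).
Qed.

Lemma derivable_cdiffable {R : realType} (f : R[i] -> R[i]) z :
  derivable (f : R[i]^o -> R[i]^o) z 1 -> cdiffable f z.
Proof.
move=> df; exists ('D_1 (f : R[i]^o -> R[i]^o) z).
have /is_derive_epsdelta H : is_derive (z : R[i]^o) (1 : R[i]^o)
  (f : R[i]^o -> R[i]^o) ('D_1 (f : R[i]^o -> R[i]^o) z) by split.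
move=> e e0; have /H[d] : 0 < e%:C by rewrite ltcR.
(* A positive element of [R[i]] has imaginary part 0, so the complex radius is a real one. *)
case: d => d d'; rewrite ltcE /= => /andP[/eqP -> d0] Hd.
exists d => // h hd; have := Hd h.
rewrite !normc_def -!cabsE -real_complexM lecR; apply.
by rewrite [X in _ < X]complexr0 ltcR.
Qed.

End Bridges.

Section CexpDerivative.
Context {R : realType}.
Implicit Types z w h l : R[i].

(** The first-order expansions of [expR], [cos] and [sin] at 0 combine to this one; the addition law
    then carries it to every point. *)
Lemma cdiff_cexp0 : cdiff (@cexp R) (0 : R[i]) 1.
Proof.
move=> e e0; have e4 : 0 < e / 8 by rewrite divr_gt0.
have /is_derive_epsdelta/(_ _ e4)[d1 d10 H1] := is_derive_expR (0 : R).
have /is_derive_epsdelta/(_ _ e4)[d2 d20 H2] := is_derive_cos (0 : R).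
have /is_derive_epsdelta/(_ _ e4)[d3 d30 H3] := is_derive_sin (0 : R).
rewrite expR0 in H1; rewrite cos0 sin0 in H2; rewrite sin0 cos0 in H3.
pose r := Num.min (Num.min d1 (Num.min d2 d3)) (Num.min 1 (e / 16)).
exists r; first by rewrite !lt_min d10 d20 d30 ltr01 divr_gt0.
move=> [a b]; set h := a +i* b => hr.
have ha : `|a| <= cabs h := Re_le_cabs h.
have hb : `|b| <= cabs h := Im_le_cabs h.
have := hr; rewrite /r !lt_min => /andP[/andP[r1 /andP[r2 r3]] /andP[r4 r5]].
have {H1}H1 := H1 _ (le_lt_trans ha r1).
have {H2}H2 := H2 _ (le_lt_trans hb r2).
have {H3}H3 := H3 _ (le_lt_trans hb r3).
rewrite add0r mul1r in H1; rewrite add0r oppr0 mul0r subr0 in H2.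
rewrite add0r mul1r subr0 in H3.
rewrite add0r cexp0 mul1r.
set c0 := cabs h in ha hb hr r4 r5 *; have c00 : 0 <= c0 by exact: cabs_ge0.
have E1 : `|expR a - 1 - a| <= e / 8 * c0.
  by rewrite (le_trans H1)// ler_wpM2l// ltW.
have E2 : `|cos b - 1| <= e / 8 * c0.
  by rewrite (le_trans H2)// ler_wpM2l// ltW.
have E3 : `|sin b - b| <= e / 8 * c0.
  by rewrite (le_trans H3)// ler_wpM2l// ltW.
have cb : `|cos b| <= 1 by exact: cos_max.
have sb : `|sin b| <= 1 by exact: sin_max.
have ec : e * c0 >= 0 by rewrite mulr_ge0// ltW.
have a2 : `|a| <= e / 16 by rewrite (le_trans ha)// ltW.
rewrite (le_trans (cabs_le_ReIm _))//.
have a1 : `|1 + a| <= 2.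
  by rewrite (le_trans (ler_normD _ _))// normr1; lra.
have -> : Re (cexp h - 1 - h) = (expR a - 1 - a) * cos b + (1 + a) * (cos b - 1).
  by rewrite !ReD !ReN /=; ring.
have -> : Im (cexp h - 1 - h) =
    (expR a - 1 - a) * sin b + (1 + a) * (sin b - b) + a * b.
  by rewrite !ImD !ImN /=; ring.
have F1 : `|(expR a - 1 - a) * cos b| <= e / 8 * c0.
  by rewrite normrM -[leRHS]mulr1 ler_pM.
have F2 : `|(1 + a) * (cos b - 1)| <= 2 * (e / 8 * c0) by rewrite normrM ler_pM.
have F3 : `|(expR a - 1 - a) * sin b| <= e / 8 * c0.
  by rewrite normrM -[leRHS]mulr1 ler_pM.
have F4 : `|(1 + a) * (sin b - b)| <= 2 * (e / 8 * c0) by rewrite normrM ler_pM.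
have F5 : `|a * b| <= e / 16 * c0 by rewrite normrM ler_pM.
rewrite (le_trans (lerD (ler_normD _ _)
  (le_trans (ler_normD _ _) (lerD (ler_normD _ _) (lexx _)))))//.
lra.
Qed.

Lemma cdiff_cexp z : cdiff (@cexp R) z (cexp z).
Proof.
have h0 : cdiff (fun w => w - z) z 1.
  by apply: cdiff_eq (cdiffB (cdiff_id z) (cdiff_cst z z)) _; rewrite subr0.
have h1 : cdiff (@cexp R) (z - z) 1 by rewrite subrr; exact: cdiff_cexp0.
apply: (cdiff_exteq (cdiffZ (cexp z) (cdiff_comp h0 h1))) => [w|].
  by rewrite -cexpD addrC subrK.
by rewrite !mulr1.
Qed.

Lemma cdiff_cexp_comp f z l : cdiff f z l ->
  cdiff (fun w => cexp (f w)) z (cexp (f z) * l).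
Proof. by move=> df; exact: cdiff_comp df (cdiff_cexp _). Qed.

(** Quantitative injectivity of exp near 0. It converts information on exp(g) into information on g
    when logarithms are built or compared. *)
Lemma cexp_sub1_ge : exists2 d : R, 0 < d & forall w : R[i], cabs w < d ->
  cabs w / 2 <= cabs (cexp w - 1).
Proof.
have h2 : (0 : R) < 2^-1 by rewrite invr_gt0.
have [d d0 H] := cdiff_cexp0 h2.
exists d => // w /H; rewrite add0r cexp0 mul1r => hw.
have := cabsB_ge w (- (cexp w - 1 - w)).
have -> : w - - (cexp w - 1 - w) = cexp w - 1 by ring.
rewrite cabsN; lra.
Qed.

End CexpDerivative.

(** * Real and contour integrals *)

Section Paths.
Context {R : realType}.
Implicit Types (f g : R[i] -> R[i]) (p q : R -> R[i]) (u v : R -> R) (a b t : R).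

Definition pcont p t := forall e : R, 0 < e -> exists2 d : R, 0 < d &
  forall h, `|h| < d -> cabs (p (t + h) - p t) <= e.

Definition pdiff p t (l : R[i]) := forall e : R, 0 < e -> exists2 d : R, 0 < d &
  forall h, `|h| < d -> cabs (p (t + h) - p t - l * h%:C) <= e * `|h|.

Lemma continuous_epsdelta u t : {for t, continuous u} <->
  forall e : R, 0 < e -> exists2 d : R, 0 < d &
    forall h, `|h| < d -> `|u (t + h) - u t| <= e.
Proof.
split=> H.
  move=> e e0; have /cvgrPdist_le/(_ e e0) := H.
  case/nbhs_ballP => d /= d0 Hd; exists d => // h hd.
  have := Hd (t + h); rewrite /ball /= opprD addNKr normrN => /(_ hd).
  by rewrite distrC.
apply/cvgrPdist_le => e e0; have [d d0 Hd] := H e e0.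
apply/nbhs_ballP; exists d => //= s; rewrite /ball /= distrC => sd.
by rewrite distrC; have := Hd _ sd; rewrite subrKC.
Qed.

Lemma pcont_Re p t : pcont p t -> {for t, continuous (fun s => Re (p s))}.
Proof.
move=> H; apply/continuous_epsdelta => e e0; have [d d0 Hd] := H e e0.
by exists d => // h /Hd; apply: le_trans; rewrite -ReN -ReD Re_le_cabs.
Qed.

Lemma pcont_Im p t : pcont p t -> {for t, continuous (fun s => Im (p s))}.
Proof.
move=> H; apply/continuous_epsdelta => e e0; have [d d0 Hd] := H e e0.
by exists d => // h /Hd; apply: le_trans; rewrite -ImN -ImD Im_le_cabs.
Qed.

Lemma pcont_cabs p t : pcont p t -> {for t, continuous (fun s => cabs (p s))}.
Proof.
move=> H; apply/continuous_epsdelta => e e0; have [d d0 Hd] := H e e0.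
exists d => // h /Hd; apply: le_trans; rewrite ler_norml cabsB_ge andbT.
by have := cabsB_ge (p t) (p (t + h)); rewrite cabsBC; lra.
Qed.

Lemma pdiff_Re p t l : pdiff p t l -> is_derive t 1 (fun s => Re (p s)) (Re l).
Proof.
move=> H; apply/is_derive_epsdelta => e e0; have [d d0 Hd] := H e e0.
exists d => // h /Hd; apply: le_trans.
by rewrite -ReMr -!ReN -!ReD Re_le_cabs.
Qed.

Lemma pdiff_Im p t l : pdiff p t l -> is_derive t 1 (fun s => Im (p s)) (Im l).
Proof.
move=> H; apply/is_derive_epsdelta => e e0; have [d d0 Hd] := H e e0.
exists d => // h /Hd; apply: le_trans.
by rewrite -ImMr -!ImN -!ImD Im_le_cabs.
Qed.

Lemma pcont_line f (z w : R[i]) t : ccont f (z + t%:C * w) ->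
  pcont (fun s => f (z + s%:C * w)) t.
Proof.
move=> H e e0; have [d d0 Hd] := H e e0.
have w1 : 0 < cabs w + 1 by rewrite ltr_wpDl// cabs_ge0.
exists (d / (cabs w + 1)); first by rewrite divr_gt0.
move=> h; rewrite ltr_pdivlMr// => hd.
have -> : z + (t + h)%:C * w = z + t%:C * w + h%:C * w.
  by rewrite real_complexD; ring.
apply: Hd; rewrite cabsM cabs_real; apply: le_lt_trans hd.
by rewrite ler_wpM2l// lerDl.
Qed.

Lemma pdiff_line f (z w : R[i]) t l : cdiff f (z + t%:C * w) l ->
  pdiff (fun s => f (z + s%:C * w)) t (l * w).
Proof.
move=> H e e0.
have w1 : 0 < cabs w + 1 by rewrite ltr_wpDl// cabs_ge0.
have ew : 0 < e / (cabs w + 1) by rewrite divr_gt0.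
have [d d0 Hd] := H _ ew.
exists (d / (cabs w + 1)); first by rewrite divr_gt0.
move=> h; rewrite ltr_pdivlMr// => hd.
have -> : z + (t + h)%:C * w = z + t%:C * w + h%:C * w.
  by rewrite real_complexD; ring.
have -> : l * w * h%:C = l * (h%:C * w) by ring.
apply: (le_trans (Hd _ _)); rewrite cabsM cabs_real.
  by apply: le_lt_trans hd; rewrite ler_wpM2l// lerDl.
rewrite -mulrA ler_wpM2l ?(ltW e0)// mulrCA ler_piMr//.
by rewrite mulrC ler_pdivrMr// mul1r lerDl.
Qed.

Lemma pcont_ext p q t : (forall s, p s = q s) -> pcont p t -> pcont q t.
Proof.
by move=> pq H e /H[d d0 Hd]; exists d => // h /Hd; rewrite !pq.
Qed.
Lemma pdiff_ext p q t l : (forall s, p s = q s) -> pdiff p t l -> pdiff q t l.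
Proof.
by move=> pq H e /H[d d0 Hd]; exists d => // h /Hd; rewrite !pq.
Qed.

Lemma pdiff_cont p t l : pdiff p t l -> pcont p t.
Proof.
move=> H e e0; have [d d0 Hd] := H _ ltr01.
have l1 : 0 < cabs l + 1 by rewrite ltr_wpDl// cabs_ge0.
exists (Num.min d (e / (cabs l + 1))); first by rewrite lt_min d0 divr_gt0.
move=> h; rewrite lt_min => /andP[/Hd hd]; rewrite ltr_pdivlMr// => he.
have -> : p (t + h) - p t = (p (t + h) - p t - l * h%:C) + l * h%:C by ring.
rewrite (le_trans (cabsD _ _))// cabsM cabs_real; lra.
Qed.

Lemma pcontD p q t : pcont p t -> pcont q t -> pcont (fun s => p s + q s) t.
Proof.
move=> H K e e0; have e2 : 0 < e / 2 by rewrite divr_gt0.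
have [d d0 Hd] := H _ e2; have [c c0 Kd] := K _ e2.
exists (Num.min d c); first by rewrite lt_min d0.
move=> h; rewrite lt_min => /andP[/Hd hd /Kd hc].
have -> : p (t + h) + q (t + h) - (p t + q t) =
  (p (t + h) - p t) + (q (t + h) - q t) by ring.
by rewrite (le_trans (cabsD _ _))// (splitr e) lerD.
Qed.

Lemma pcontM p q t : pcont p t -> pcont q t -> pcont (fun s => p s * q s) t.
Proof.
move=> H K e e0.
pose A := cabs (p t) + 1; pose B := cabs (q t) + 1.
have A0 : 0 < A by rewrite ltr_wpDl// cabs_ge0.
have B0 : 0 < B by rewrite ltr_wpDl// cabs_ge0.
have eA : 0 < e / 2 / A by rewrite !divr_gt0.
have eB : 0 < e / 2 / B by rewrite !divr_gt0.
have [d d0 Hd] := H _ eB; have [c c0 Kd] := K _ eA.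
have [c1 c10 Kd1] := K _ ltr01.
exists (Num.min d (Num.min c c1)); first by rewrite !lt_min d0 c0.
move=> h; rewrite !lt_min => /andP[/Hd hd /andP[/Kd hc /Kd1 hc1]].
have -> : p (t + h) * q (t + h) - p t * q t =
  (p (t + h) - p t) * q (t + h) + p t * (q (t + h) - q t) by ring.
rewrite (le_trans (cabsD _ _))// (splitr e) !cabsM.
apply: lerD.
  apply: (@le_trans _ _ (e / 2 / B * B)); last by rewrite divfK// gt_eqF.
  apply: ler_pM; rewrite ?cabs_ge0//.
  have -> : q (t + h) = (q (t + h) - q t) + q t by ring.
  by rewrite (le_trans (cabsD _ _))// /B; lra.
apply: (@le_trans _ _ (A * (e / 2 / A))); last by rewrite mulrC divfK// gt_eqF.
by apply: ler_pM; rewrite ?cabs_ge0// /A lerDl.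
Qed.

Lemma pcont_cst (z : R[i]) t : pcont (fun=> z) t.
Proof. by move=> e e0; exists 1 => // h _; rewrite subrr cabs0 ltW. Qed.

End Paths.

Section RealIntegral.
Context {R : realType}.
Implicit Types (u v : R -> R) (a b c : R).
Local Notation mu := (@lebesgue_measure R).

Definition rint a b u : R := \int[mu]_(t in `[a, b]) u t.

Definition cont_on a b u := forall t, a <= t <= b -> {for t, continuous u}.

Lemma cont_on_sub a b c d u : cont_on a b u -> a <= c -> d <= b -> cont_on c d u.
Proof. by move=> H ac db t /andP[h1 h2]; apply: H; lra. Qed.

Lemma cont_on_within a b u : cont_on a b u -> {within `[a, b], continuous u}.
Proof.
move=> H; apply: continuous_in_subspaceT => t; rewrite inE /= in_itv /=.
exact: H.
Qed.

Lemma cont_on_integrable a b u : cont_on a b u ->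
  mu.-integrable `[a, b] (EFin \o u).
Proof.
move=> H; apply: continuous_compact_integrable; first exact: segment_compact.
exact: cont_on_within.
Qed.

Lemma eq_rint a b u v : (forall t, a <= t <= b -> u t = v t) ->
  rint a b u = rint a b v.
Proof.
by move=> H; apply: eq_Rintegral => t; rewrite inE /= in_itv /= => /H.
Qed.

Lemma rintD a b u v : cont_on a b u -> cont_on a b v ->
  rint a b (fun t => u t + v t) = rint a b u + rint a b v.
Proof. by move=> *; apply: RintegralD => //; exact: cont_on_integrable. Qed.

Lemma rintZ a b r u : cont_on a b u -> rint a b (fun t => r * u t) = r * rint a b u.
Proof. by move=> *; apply: RintegralZl => //; exact: cont_on_integrable. Qed.

Lemma rint_le a b u v : cont_on a b u -> cont_on a b v ->
  (forall t, a <= t <= b -> u t <= v t) -> rint a b u <= rint a b v.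
Proof.
move=> cu cv H; apply: le_Rintegral => //; try exact: cont_on_integrable.
Qed.

Lemma rint_ge0 a b u : (forall t, a <= t <= b -> 0 <= u t) -> 0 <= rint a b u.
Proof.
by move=> H; apply: Rintegral_ge0 => t /=; rewrite in_itv /=; exact: H.
Qed.

Lemma rint_cst a b r : a <= b -> rint a b (fun=> r) = r * (b - a).
Proof.
move=> ab; rewrite /rint Rintegral_cst//= lebesgue_measure_itv /= lte_fin.
have [ltab|ba] := ltP a b; first by [].
have -> : b = a by apply/eqP; rewrite eq_le ab ba.
by rewrite subrr.
Qed.

Lemma rint_split a b c u : a <= c <= b -> cont_on a b u ->
  rint a b u = rint a c u + rint c b u.
Proof.
move=> /andP[ac cb] cu.
have cu1 : cont_on a c u by exact: cont_on_sub cu _ _.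
have cu2 : cont_on c b u by exact: cont_on_sub cu _ _.
have := @Rintegral_itvB R u (BLeft a) (BRight b) c (cont_on_integrable cu).
rewrite !bnd_simp => /(_ ac cb).
rewrite Rintegral_itv_obnd_cbnd; last first.
  apply: integrableS (cont_on_integrable cu2) => //.
  by apply: subset_itvr; rewrite bnd_simp.
by rewrite /rint => <-; rewrite addrC subrK.
Qed.

Lemma rint_FTC a b u v : a <= b -> cont_on a b u ->
  (forall t, a <= t <= b -> is_derive t 1 v (u t)) -> rint a b u = v b - v a.
Proof.
rewrite le_eqVlt => /predU1P[-> _ _|ab cu dv].
  by rewrite subrr /rint set_itv1 Rintegral_set1.
have cv t : a <= t <= b -> {for t, continuous v}.
  by move=> /dv[dvt _]; apply: differentiable_continuous; exact/derivable1_diffP.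
rewrite /rint /Rintegral (@continuous_FTC2 _ u v a b)//.
- exact: cont_on_within.
- split.
  + by move=> t; rewrite in_itv /= => /andP[h1 h2]; have [] := dv t; rewrite ?ltW.
  + apply: cvg_at_right_filter; apply: cv; lra.
  + apply: cvg_at_left_filter; apply: cv; lra.
- move=> t; rewrite in_itv /= => /andP[h1 h2].
  by rewrite derive1E; have [] := dv t; rewrite ?ltW.
Qed.

End RealIntegral.

Section ComplexIntegral.
Context {R : realType}.
Implicit Types (f g : R[i] -> R[i]) (p q : R -> R[i]) (a b c t : R).

Definition cint a b p : R[i] :=
  rint a b (fun t => Re (p t)) +i* rint a b (fun t => Im (p t)).

Definition pcont_on a b p := forall t, a <= t <= b -> pcont p t.

Lemma pcont_on_Re a b p : pcont_on a b p -> cont_on a b (fun t => Re (p t)).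
Proof. by move=> H t /H /pcont_Re. Qed.
Lemma pcont_on_Im a b p : pcont_on a b p -> cont_on a b (fun t => Im (p t)).
Proof. by move=> H t /H /pcont_Im. Qed.

Lemma cont_onZ a b r (u : R -> R) : cont_on a b u -> cont_on a b (fun t => r * u t).
Proof. by move=> H t /H ut; apply: cvgM => //; exact: cvg_cst. Qed.

Lemma eq_cint a b p q : (forall t, a <= t <= b -> p t = q t) ->
  cint a b p = cint a b q.
Proof. by move=> H; congr Complex; apply: eq_rint => t /H ->. Qed.

Lemma cintD a b p q : pcont_on a b p -> pcont_on a b q ->
  cint a b (fun t => p t + q t) = cint a b p + cint a b q.
Proof.
move=> cp cq; apply: complex_eq; rewrite ?ReD ?ImD /=.
  rewrite -rintD; [|exact: pcont_on_Re..].
  by apply: eq_rint => t _; rewrite ReD.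
rewrite -rintD; [|exact: pcont_on_Im..].
by apply: eq_rint => t _; rewrite ImD.
Qed.

Lemma cintZ a b (z : R[i]) p : pcont_on a b p ->
  cint a b (fun t => z * p t) = z * cint a b p.
Proof.
move=> cp; have cr := pcont_on_Re cp; have ci := pcont_on_Im cp.
apply: complex_eq; rewrite ?ReM ?ImM /=.
  rewrite -mulNr -!rintZ// -rintD; [|exact: cont_onZ..].
  by apply: eq_rint => t _; rewrite ReM mulNr.
rewrite -!rintZ// -rintD; [|exact: cont_onZ..].
by apply: eq_rint => t _; rewrite ImM.
Qed.

Lemma pcont_onD a b p q : pcont_on a b p -> pcont_on a b q ->
  pcont_on a b (fun t => p t + q t).
Proof. by move=> H K t ht; apply: pcontD; [exact: H|exact: K]. Qed.
Lemma pcont_onM a b p q : pcont_on a b p -> pcont_on a b q ->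
  pcont_on a b (fun t => p t * q t).
Proof. by move=> H K t ht; apply: pcontM; [exact: H|exact: K]. Qed.
Lemma pcont_on_cst a b (z : R[i]) : pcont_on a b (fun=> z).
Proof. by move=> t _; exact: pcont_cst. Qed.
Lemma pcont_onN a b p : pcont_on a b p -> pcont_on a b (fun t => - p t).
Proof.
move=> H t ht; apply: (@pcont_ext _ (fun s => -1 * p s)) => [s|].
  by rewrite mulN1r.
by apply: pcontM; [exact: pcont_cst|exact: H].
Qed.
Lemma pcont_on_sum (I : Type) (r : seq I) (F : I -> R -> R[i]) a b :
  (forall i, pcont_on a b (F i)) -> pcont_on a b (fun t => \sum_(i <- r) F i t).
Proof.
move=> H; elim: r => [|i r IH] t ht.
  by apply: (@pcont_ext _ (fun=> 0)) => [s|]; rewrite ?big_nil//; exact: pcont_cst.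
apply: (@pcont_ext _ (fun s => F i s + \sum_(j <- r) F j s)) => [s|].
  by rewrite big_cons.
by apply: pcontD; [exact: H|exact: IH].
Qed.

Lemma cint0 a b : cint a b (fun=> 0) = 0.
Proof.
rewrite -[RHS](mul0r (cint a b (fun=> 0))) -cintZ; last exact: pcont_on_cst.
by apply: eq_cint => t _; rewrite mul0r.
Qed.

Lemma cintN a b p : pcont_on a b p -> cint a b (fun t => - p t) = - cint a b p.
Proof.
move=> cp; rewrite -mulN1r -cintZ//; apply: eq_cint => t _; exact/esym/mulN1r.
Qed.

Lemma cintB a b p q : pcont_on a b p -> pcont_on a b q ->
  cint a b (fun t => p t - q t) = cint a b p - cint a b q.
Proof.
by move=> cp cq; rewrite cintD ?cintN//; exact: pcont_onN.
Qed.

Lemma cint_sum (I : Type) (r : seq I) (F : I -> R -> R[i]) a b :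
  (forall i, pcont_on a b (F i)) ->
  cint a b (fun t => \sum_(i <- r) F i t) = \sum_(i <- r) cint a b (F i).
Proof.
move=> H; elim: r => [|i r IH].
  by rewrite big_nil -[RHS](cint0 a b); apply: eq_cint => t _; rewrite big_nil.
rewrite big_cons -IH -cintD//; last exact: pcont_on_sum.
by apply: eq_cint => t _; rewrite big_cons.
Qed.

Lemma cint_split a b c p : a <= c <= b -> pcont_on a b p ->
  cint a b p = cint a c p + cint c b p.
Proof.
move=> acb cp; apply: complex_eq; rewrite ?ReD ?ImD /=; apply: rint_split => //.
  exact: pcont_on_Re.
exact: pcont_on_Im.
Qed.

Lemma rint_norm_le a b (u : R -> R) M : a <= b -> cont_on a b u ->
  (forall t, a <= t <= b -> `|u t| <= M) -> `|rint a b u| <= M * (b - a).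
Proof.
move=> ab cu H; rewrite ler_norml -mulNr -!rint_cst//.
have cc r : cont_on a b (fun=> r) by move=> t _; exact: cvg_cst.
by apply/andP; split; apply: rint_le => // t /H; rewrite ler_norml => /andP[].
Qed.

(** Real and imaginary parts are bounded separately; this costs the factor 2, which is harmless
    wherever the bound is used. *)
Lemma cint_bound a b p M : a <= b -> pcont_on a b p ->
  (forall t, a <= t <= b -> cabs (p t) <= M) ->
  cabs (cint a b p) <= 2 * M * (b - a).
Proof.
move=> ab cp H; rewrite (le_trans (cabs_le_ReIm _))//=.
have h1 : `|rint a b (fun t => Re (p t))| <= M * (b - a).
  apply: rint_norm_le => //; first exact: pcont_on_Re.
  by move=> t /H; apply: le_trans; exact: Re_le_cabs.
have h2 : `|rint a b (fun t => Im (p t))| <= M * (b - a).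
  apply: rint_norm_le => //; first exact: pcont_on_Im.
  by move=> t /H; apply: le_trans; exact: Im_le_cabs.
by rewrite (le_trans (lerD h1 h2))//; lra.
Qed.

Lemma cint_FTC a b p q : a <= b -> pcont_on a b p ->
  (forall t, a <= t <= b -> pdiff q t (p t)) -> cint a b p = q b - q a.
Proof.
move=> ab cp dq; apply: complex_eq; rewrite ?ReD ?ImD ?ReN ?ImN /=.
  by apply: (rint_FTC (v := fun t => Re (q t)) ab (pcont_on_Re cp)) => t /dq /pdiff_Re.
by apply: (rint_FTC (v := fun t => Im (q t)) ab (pcont_on_Im cp)) => t /dq /pdiff_Im.
Qed.

End ComplexIntegral.

(** * Rectangular contours and Goursat's theorem *)

Section Rectangles.
Context {R : realType}.
Implicit Types (f g : R[i] -> R[i]) (x y m : R).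
Local Notation ii := (0 +i* 1 : R[i]).

Lemma hor_line x y : x +i* y = (0 +i* y) + x%:C * 1 :> R[i].
Proof. by apply: complex_eq; rewrite mulr1 ?ReD ?ImD /=; ring. Qed.
Lemma ver_line x y : x +i* y = x%:C + y%:C * ii.
Proof. by apply: complex_eq => /=; ring. Qed.

Lemma pcont_hor f x y : ccont f (x +i* y) -> pcont (fun s => f (s +i* y)) x.
Proof.
rewrite hor_line => /pcont_line; apply: pcont_ext => s.
by rewrite -hor_line.
Qed.
Lemma pcont_ver f x y : ccont f (x +i* y) -> pcont (fun s => f (x +i* s)) y.
Proof.
rewrite ver_line => /pcont_line; apply: pcont_ext => s.
by rewrite -ver_line.
Qed.
Lemma pdiff_hor f x y l : cdiff f (x +i* y) l -> pdiff (fun s => f (s +i* y)) x l.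
Proof.
rewrite hor_line => /pdiff_line; rewrite mulr1; apply: pdiff_ext => s.
by rewrite -hor_line.
Qed.
Lemma pdiff_ver f x y l : cdiff f (x +i* y) l ->
  pdiff (fun s => f (x +i* s)) y (l * ii).
Proof.
rewrite ver_line => /pdiff_line; apply: pdiff_ext => s.
by rewrite -ver_line.
Qed.

Definition in_rect x0 x1 y0 y1 (z : R[i]) := x0 <= Re z <= x1 /\ y0 <= Im z <= y1.

Definition rect_int f x0 x1 y0 y1 : R[i] :=
  cint x0 x1 (fun x => f (x +i* y0)) + ii * cint y0 y1 (fun y => f (x1 +i* y))
  - cint x0 x1 (fun x => f (x +i* y1)) - ii * cint y0 y1 (fun y => f (x0 +i* y)).

Definition ccont_rect f x0 x1 y0 y1 :=
  forall z, in_rect x0 x1 y0 y1 z -> ccont f z.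

Definition chol_rect f x0 x1 y0 y1 :=
  forall z, in_rect x0 x1 y0 y1 z -> cdiffable f z.

Lemma chol_ccont f x0 x1 y0 y1 : chol_rect f x0 x1 y0 y1 -> ccont_rect f x0 x1 y0 y1.
Proof. by move=> H z /H[l /cdiff_cont]. Qed.

Lemma in_rect_sub x0 x1 y0 y1 x0' x1' y0' y1' z :
  in_rect x0 x1 y0 y1 z -> x0' <= x0 -> x1 <= x1' -> y0' <= y0 -> y1 <= y1' ->
  in_rect x0' x1' y0' y1' z.
Proof. by move=> [/andP[a b] /andP[c d]] ????; split; apply/andP; split; lra. Qed.

Lemma ccont_rect_sub f x0 x1 y0 y1 x0' x1' y0' y1' :
  ccont_rect f x0' x1' y0' y1' ->
  x0' <= x0 -> x1 <= x1' -> y0' <= y0 -> y1 <= y1' ->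
  ccont_rect f x0 x1 y0 y1.
Proof. by move=> H ???? z hz; apply: H; exact: in_rect_sub hz _ _ _ _. Qed.

Lemma ccont_rect_hor f x0 x1 y0 y1 y : ccont_rect f x0 x1 y0 y1 -> y0 <= y <= y1 ->
  pcont_on x0 x1 (fun x => f (x +i* y)).
Proof. by move=> H hy x hx; apply: pcont_hor; apply: H. Qed.
Lemma ccont_rect_ver f x0 x1 y0 y1 x : ccont_rect f x0 x1 y0 y1 -> x0 <= x <= x1 ->
  pcont_on y0 y1 (fun y => f (x +i* y)).
Proof. by move=> H hy y hx; apply: pcont_ver; apply: H. Qed.

Lemma rect_int_splitx f x0 x1 y0 y1 m : y0 <= y1 ->
  x0 <= m <= x1 -> ccont_rect f x0 x1 y0 y1 ->
  rect_int f x0 x1 y0 y1 = rect_int f x0 m y0 y1 + rect_int f m x1 y0 y1.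
Proof.
move=> y01 hm cf; rewrite /rect_int (@cint_split _ x0 x1 m)//; last first.
  by apply: ccont_rect_hor cf _; rewrite lexx y01.
rewrite [cint x0 x1 (fun x => f (x +i* y1))](@cint_split _ x0 x1 m)//; last first.
  by apply: ccont_rect_hor cf _; rewrite lexx y01.
by ring.
Qed.

Lemma rect_int_splity f x0 x1 y0 y1 m : x0 <= x1 ->
  y0 <= m <= y1 -> ccont_rect f x0 x1 y0 y1 ->
  rect_int f x0 x1 y0 y1 = rect_int f x0 x1 y0 m + rect_int f x0 x1 m y1.
Proof.
move=> x01 hm cf; rewrite /rect_int (@cint_split _ y0 y1 m)//; last first.
  by apply: ccont_rect_ver cf _; rewrite lexx x01.
rewrite [cint y0 y1 (fun x => f (x0 +i* _))](@cint_split _ y0 y1 m)//; last first.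
  by apply: ccont_rect_ver cf _; rewrite lexx x01.
by ring.
Qed.

Lemma rect_int_quarter f x0 x1 y0 y1 : x0 <= x1 -> y0 <= y1 ->
  ccont_rect f x0 x1 y0 y1 ->
  rect_int f x0 x1 y0 y1 =
    rect_int f x0 ((x0 + x1) / 2) y0 ((y0 + y1) / 2) +
    rect_int f ((x0 + x1) / 2) x1 y0 ((y0 + y1) / 2) +
    (rect_int f x0 ((x0 + x1) / 2) ((y0 + y1) / 2) y1 +
    rect_int f ((x0 + x1) / 2) x1 ((y0 + y1) / 2) y1).
Proof.
move=> x01 y01 cf; rewrite (@rect_int_splity _ _ _ _ _ ((y0 + y1) / 2))//; last lra.
by congr (_ + _); apply: rect_int_splitx; try lra; apply: ccont_rect_sub cf _ _ _ _; lra.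
Qed.

(** Isolating the boundary allows integrands such as 1 / (w - z) that are singular inside the
    rectangle. *)
Definition on_edges x0 x1 y0 y1 (z : R[i]) := in_rect x0 x1 y0 y1 z /\
  [\/ Re z = x0, Re z = x1, Im z = y0 | Im z = y1].

Definition ccont_edges f x0 x1 y0 y1 :=
  forall z, on_edges x0 x1 y0 y1 z -> ccont f z.

Lemma ccont_rect_edges f x0 x1 y0 y1 :
  ccont_rect f x0 x1 y0 y1 -> ccont_edges f x0 x1 y0 y1.
Proof. by move=> H z [/H]. Qed.

Lemma ccont_edges_hor f x0 x1 y0 y1 y : ccont_edges f x0 x1 y0 y1 -> y0 <= y1 ->
  y = y0 \/ y = y1 -> pcont_on x0 x1 (fun x => f (x +i* y)).
Proof.
move=> H y01 hy x hx; apply: pcont_hor; apply: H; split.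
  by split => //=; case: hy => ->; rewrite lexx ?andbT ?y01.
by case: hy => ->; [exact: Or43|exact: Or44].
Qed.
Lemma ccont_edges_ver f x0 x1 y0 y1 x : ccont_edges f x0 x1 y0 y1 -> x0 <= x1 ->
  x = x0 \/ x = x1 -> pcont_on y0 y1 (fun y => f (x +i* y)).
Proof.
move=> H x01 hx y hy; apply: pcont_ver; apply: H; split.
  by split => //=; case: hx => ->; rewrite lexx ?andbT ?x01.
by case: hx => ->; [exact: Or41|exact: Or42].
Qed.

Lemma eq_rect_int f g x0 x1 y0 y1 : x0 <= x1 -> y0 <= y1 ->
  (forall z, on_edges x0 x1 y0 y1 z -> f z = g z) ->
  rect_int f x0 x1 y0 y1 = rect_int g x0 x1 y0 y1.
Proof.
move=> x01 y01 fg; rewrite /rect_int.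
rewrite (@eq_cint _ x0 x1 (fun x => f (x +i* y0)) (fun x => g (x +i* y0))); last first.
  by move=> t ht; apply: fg; split; [split => //=; rewrite lexx|exact: Or43].
rewrite (@eq_cint _ x0 x1 (fun x => f (x +i* y1)) (fun x => g (x +i* y1))); last first.
  by move=> t ht; apply: fg; split; [split => //=; rewrite lexx y01|exact: Or44].
rewrite (@eq_cint _ y0 y1 (fun y => f (x0 +i* y)) (fun y => g (x0 +i* y))); last first.
  by move=> t ht; apply: fg; split; [split => //=; rewrite lexx|exact: Or41].
rewrite (@eq_cint _ y0 y1 (fun y => f (x1 +i* y)) (fun y => g (x1 +i* y)))//.
by move=> t ht; apply: fg; split; [split => //=; rewrite lexx x01|exact: Or42].
Qed.

Lemma rect_intD f g x0 x1 y0 y1 : x0 <= x1 -> y0 <= y1 ->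
  ccont_edges f x0 x1 y0 y1 -> ccont_edges g x0 x1 y0 y1 ->
  rect_int (fun z => f z + g z) x0 x1 y0 y1 =
  rect_int f x0 x1 y0 y1 + rect_int g x0 x1 y0 y1.
Proof.
move=> x01 y01 cf cg; rewrite /rect_int !cintD; first (by ring);
  by [apply: ccont_edges_hor cf _ _ => //; auto|
      apply: ccont_edges_hor cg _ _ => //; auto|
      apply: ccont_edges_ver cf _ _ => //; auto|
      apply: ccont_edges_ver cg _ _ => //; auto].
Qed.

Lemma rect_intZ z f x0 x1 y0 y1 : x0 <= x1 -> y0 <= y1 ->
  ccont_edges f x0 x1 y0 y1 ->
  rect_int (fun w => z * f w) x0 x1 y0 y1 = z * rect_int f x0 x1 y0 y1.
Proof.
move=> x01 y01 cf.
rewrite /rect_int !cintZ; first (by ring);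
  by [apply: ccont_edges_hor cf _ _ => //; auto|
      apply: ccont_edges_ver cf _ _ => //; auto].
Qed.

Lemma rect_int_bound f x0 x1 y0 y1 M : x0 <= x1 -> y0 <= y1 ->
  ccont_edges f x0 x1 y0 y1 -> (forall z, on_edges x0 x1 y0 y1 z -> cabs (f z) <= M) ->
  cabs (rect_int f x0 x1 y0 y1) <= 4 * M * ((x1 - x0) + (y1 - y0)).
Proof.
move=> x01 y01 cf HM.
have i1 : cabs ii = 1 by rewrite cabs_i normr1.
have B1 y : y = y0 \/ y = y1 -> cabs (cint x0 x1 (fun x => f (x +i* y))) <=
    2 * M * (x1 - x0).
  move=> hy; apply: cint_bound => //; first exact: ccont_edges_hor cf _ _.
  move=> t ht; apply: HM; split.
    by split => //=; case: hy => ->; rewrite lexx ?andbT ?y01.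
  by case: hy => ->; [exact: Or43|exact: Or44].
have B2 x : x = x0 \/ x = x1 -> cabs (ii * cint y0 y1 (fun y => f (x +i* y))) <=
    2 * M * (y1 - y0).
  move=> hx; rewrite cabsM i1 mul1r.
  apply: cint_bound => //; first exact: ccont_edges_ver cf _ _.
  move=> t ht; apply: HM; split.
    by split => //=; case: hx => ->; rewrite lexx ?andbT ?x01.
  by case: hx => ->; [exact: Or41|exact: Or42].
rewrite /rect_int (le_trans (cabsB _ _))// (le_trans (lerD (cabsB _ _) (lexx _)))//.
rewrite (le_trans (lerD (lerD (cabsD _ _) (lexx _)) (lexx _)))//.
have Bb := B1 _ (or_introl erefl); have Bt := B1 _ (or_intror erefl).
have Bl := B2 _ (or_introl erefl); have Br := B2 _ (or_intror erefl).
by rewrite (le_trans (lerD (lerD (lerD Bb Br) Bt) Bl))//; lra.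
Qed.

Lemma rect_int_primitive f g x0 x1 y0 y1 : x0 <= x1 -> y0 <= y1 ->
  ccont_rect f x0 x1 y0 y1 ->
  (forall z, in_rect x0 x1 y0 y1 z -> cdiff g z (f z)) ->
  rect_int f x0 x1 y0 y1 = 0.
Proof.
move=> x01 y01 cf dg.
have ly0 : y0 <= y0 <= y1 by rewrite lexx.
have ly1 : y0 <= y1 <= y1 by rewrite lexx y01.
have lx0 : x0 <= x0 <= x1 by rewrite lexx.
have lx1 : x0 <= x1 <= x1 by rewrite lexx x01.
have B1 y : y0 <= y <= y1 -> cint x0 x1 (fun x => f (x +i* y)) =
    g (x1 +i* y) - g (x0 +i* y).
  move=> hy; apply: (cint_FTC (q := fun s => g (s +i* y))) => //.
    exact: ccont_rect_hor cf _.
  by move=> t ht; apply: pdiff_hor; apply: dg.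
have B2 x : x0 <= x <= x1 -> ii * cint y0 y1 (fun y => f (x +i* y)) =
    g (x +i* y1) - g (x +i* y0).
  move=> hx; have cv : pcont_on y0 y1 (fun y => f (x +i* y)).
    exact: ccont_rect_ver cf _.
  rewrite -cintZ//; apply: (cint_FTC (q := fun s => g (x +i* s))) => //.
    by apply: pcont_onM => //; exact: pcont_on_cst.
  by move=> t ht; rewrite mulrC; apply: pdiff_ver; apply: dg.
rewrite /rect_int !B1// !B2//; ring.
Qed.

(** Compactness of closed rectangles in a form ready for use. If P failed, some quarter would be bad
    at every stage, and the nested bad rectangles would shrink to a point that contradicts the local
    assumption. It yields Goursat's theorem, boundedness, global logarithms and, on a rectangle of
    width 0, uniform continuity. *)
Lemma rect_bisection (P : R -> R -> R -> R -> Prop) X0 X1 Y0 Y1 :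
  X0 <= X1 -> Y0 <= Y1 ->
  (forall x0 x1 y0 y1, X0 <= x0 -> x0 <= x1 -> x1 <= X1 ->
    Y0 <= y0 -> y0 <= y1 -> y1 <= Y1 ->
    P x0 ((x0 + x1) / 2) y0 ((y0 + y1) / 2) ->
    P ((x0 + x1) / 2) x1 y0 ((y0 + y1) / 2) ->
    P x0 ((x0 + x1) / 2) ((y0 + y1) / 2) y1 ->
    P ((x0 + x1) / 2) x1 ((y0 + y1) / 2) y1 -> P x0 x1 y0 y1) ->
  (forall z, in_rect X0 X1 Y0 Y1 z -> exists2 d : R, 0 < d &
    forall x0 x1 y0 y1, X0 <= x0 -> x0 <= x1 -> x1 <= X1 ->
    Y0 <= y0 -> y0 <= y1 -> y1 <= Y1 -> in_rect x0 x1 y0 y1 z ->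
    x1 - x0 < d -> y1 - y0 < d -> P x0 x1 y0 y1) ->
  P X0 X1 Y0 Y1.
Proof.
move=> X01 Y01 Pq Ploc; apply: contrapT => NP.
pose bad (r : R * R * (R * R)) := [/\ X0 <= r.1.1, r.1.1 <= r.1.2, r.1.2 <= X1 &
  [/\ Y0 <= r.2.1, r.2.1 <= r.2.2, r.2.2 <= Y1 & ~ P r.1.1 r.1.2 r.2.1 r.2.2]].
pose qr (r r' : R * R * (R * R)) := [/\ r.1.1 <= r'.1.1, r'.1.2 <= r.1.2,
   r'.1.2 - r'.1.1 = (r.1.2 - r.1.1) / 2 & [/\ r.2.1 <= r'.2.1, r'.2.2 <= r.2.2 &
   r'.2.2 - r'.2.1 = (r.2.2 - r.2.1) / 2]].
have step (r : {r | bad r}) : {r' : {r | bad r} | qr (sval r) (sval r')}.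
  case: r => -[[x0 x1] [y0 y1]] /= b; apply: cid.
  have [/= b1 b2 b3 [b4 b5 b6 nP]] := b.
  apply: contrapT => H; apply: nP; apply: Pq => //; apply: contrapT => nP; apply: H.
  - suff b' : bad ((x0, (x0 + x1) / 2), (y0, (y0 + y1) / 2)).
      by exists (exist _ _ b'); rewrite /qr /=; do ?split; lra.
    by do ?split => //=; lra.
  - suff b' : bad (((x0 + x1) / 2, x1), (y0, (y0 + y1) / 2)).
      by exists (exist _ _ b'); rewrite /qr /=; do ?split; lra.
    by do ?split => //=; lra.
  - suff b' : bad ((x0, (x0 + x1) / 2), ((y0 + y1) / 2, y1)).
      by exists (exist _ _ b'); rewrite /qr /=; do ?split; lra.
    by do ?split => //=; lra.
  - suff b' : bad (((x0 + x1) / 2, x1), ((y0 + y1) / 2, y1)).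
      by exists (exist _ _ b'); rewrite /qr /=; do ?split; lra.
    by do ?split => //=; lra.
have b0 : bad ((X0, X1), (Y0, Y1)) by do ?split.
pose s := fix s n : {r | bad r} := if n is n'.+1 then sval (step (s n')) else exist _ _ b0.
have sS n : qr (sval (s n)) (sval (s n.+1)) by exact: (svalP (step (s n))).
pose a n := (sval (s n)).1.1; pose b n := (sval (s n)).1.2.
pose c n := (sval (s n)).2.1; pose d n := (sval (s n)).2.2.
have nest (u v : nat -> R) : (forall n, u n <= v n) ->
    (forall n, u n <= u n.+1) -> (forall n, v n.+1 <= v n) ->
    exists x, forall n, u n <= x <= v n.
  move=> uv uS vS.
  have um (i n : nat) : (i <= n)%N -> u i <= u n.
    by move/subnK <-; elim: (n - i)%N => [|k]; rewrite ?add0n ?addSn// => /le_trans; apply.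
  have vm (i n : nat) : (i <= n)%N -> v n <= v i.
    by move/subnK <-; elim: (n - i)%N => [|k IH]; rewrite ?add0n ?addSn// (le_trans (vS _)).
  have uvm (i n : nat) : u i <= v n.
    by rewrite (le_trans (um _ _ (leq_maxl i n)))// (le_trans (uv _))// vm// leq_maxr.
  exists (sup (range u)) => n; apply/andP; split.
    apply: sup_upper_bound; last by exists n.
    by split; [exists (u 0%N), 0%N|exists (v 0%N) => _ [m _ <-]].
  by apply: ge_sup; [exists (u 0%N), 0%N|move=> _ [m _ <-]].
have [x hx] : exists x, forall n, a n <= x <= b n.
  apply: nest => n; first by have [] := svalP (s n).
    by have [] := sS n.
  by have [] := sS n.
have [y hy] : exists y, forall n, c n <= y <= d n.
  apply: nest => n; first by have [_ _ _ []] := svalP (s n).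
    by have [_ _ _ []] := sS n.
  by have [_ _ _ []] := sS n.
have wn n : b n - a n = (X1 - X0) / 2 ^+ n.
  elim: n => [|n IH]; first by rewrite expr0 divr1.
  by have [_ _ -> _] := sS n; rewrite [X in X / 2]IH exprSr invfM mulrA.
have hn n : d n - c n = (Y1 - Y0) / 2 ^+ n.
  elim: n => [|n IH]; first by rewrite expr0 divr1.
  by have [_ _ _ [_ _ ->]] := sS n; rewrite [X in X / 2]IH exprSr invfM mulrA.
have [e e0 He] : exists2 d : R, 0 < d &
    forall x0 x1 y0 y1, X0 <= x0 -> x0 <= x1 -> x1 <= X1 ->
    Y0 <= y0 -> y0 <= y1 -> y1 <= Y1 -> in_rect x0 x1 y0 y1 (x +i* y) ->
    x1 - x0 < d -> y1 - y0 < d -> P x0 x1 y0 y1.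
  by apply: Ploc; split; [exact: (hx 0%N)|exact: (hy 0%N)].
have [N hN] : exists N : nat, (X1 - X0) + (Y1 - Y0) < e * 2 ^+ N.
  have q0 : 0 <= ((X1 - X0) + (Y1 - Y0)) / e by apply: divr_ge0; lra.
  have := archi_boundP q0.
  set N := Num.bound _ => H; exists N; rewrite mulrC -ltr_pdivrMr//.
  apply: (lt_le_trans H); rewrite -natrX ler_nat.
  by apply: ltnW; exact: ltn_expl.
have p2 : 0 < 2 ^+ N :> R by rewrite exprn_gt0.
have [b1 b2 b3 [b4 b5 b6 nP]] := svalP (s N).
apply: nP; apply: He => //.
- by split; [exact: hx|exact: hy].
- by rewrite -/(a N) -/(b N) wn ltr_pdivrMr//; lra.
- by rewrite -/(c N) -/(d N) hn ltr_pdivrMr//; lra.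
Qed.

Theorem goursat f x0 x1 y0 y1 : x0 <= x1 -> y0 <= y1 ->
  chol_rect f x0 x1 y0 y1 -> rect_int f x0 x1 y0 y1 = 0.
Proof.
move=> x01 y01 hf.
have cf := chol_ccont hf.
pose S := (x1 - x0) ^+ 2 + (y1 - y0) ^+ 2 + 1.
have S0 : 0 < S by rewrite ltr_wpDl// addr_ge0// sqr_ge0.
suff H e : 0 < e -> cabs (rect_int f x0 x1 y0 y1) <=
    e * ((x1 - x0) ^+ 2 + (y1 - y0) ^+ 2).
  apply: cabs0_eq; apply/eqP; rewrite eq_le cabs_ge0 andbT.
  apply/ler_addgt0Pr => e e0; rewrite add0r.
  apply: le_trans (H _ (divr_gt0 e0 S0)) _.
  by rewrite mulrAC ler_pdivrMr// ler_wpM2l ?(ltW e0)// /S; lra.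
(* The sum of the squared sides is additive under quartering: each quarter carries exactly a fourth
   of it, so the four bounds add up to the bound for the whole. *)
move=> e0; pose P a b c d :=
  cabs (rect_int f a b c d) <= e * ((b - a) ^+ 2 + (d - c) ^+ 2).
apply: (rect_bisection (P := P)) => // [a b c d a0 ab b1 c0 cd d1|z hz].
  rewrite /P => h1 h2 h3 h4; rewrite rect_int_quarter//; last first.
    exact: ccont_rect_sub cf _ _ _ _.
  rewrite (le_trans (cabsD _ _))// (le_trans (lerD (cabsD _ _) (cabsD _ _)))//.
  by rewrite (le_trans (lerD (lerD h1 h2) (lerD h3 h4)))// le_eqVlt; apply/orP; left;
    apply/eqP; field.
have [l df] := hf z hz; have e8 : 0 < e / 8 by rewrite divr_gt0.
have [d d0 Hd] := df _ e8.
exists (d / 2); first by rewrite divr_gt0.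
move=> a b c k a0 ab b1 c0 cd k1 [/andP[za zb] /andP[zc zk]] hab hck.
(* Only the deviation of f from its affine approximation at z contributes, since the affine part has
   the primitive [G]. The value e / 8 suffices because (u + v)^2 <= 2 (u^2 + v^2). *)
pose g w := f z + l * (w - z).
have dg w : cdiff g w l.
  apply: (cdiff_exteq (cdiffD (cdiff_cst (f z) w) (cdiffZ l
    (cdiffB (cdiff_id w) (cdiff_cst z w))))) => //.
  by rewrite subr0 mulr1 add0r.
have cg : ccont_rect g a b c k by move=> w _; apply: cdiff_cont (dg w).
have cfs : ccont_rect f a b c k by exact: ccont_rect_sub cf _ _ _ _.
have cfg : ccont_rect (fun w => f w - g w) a b c k.
  move=> w hw; have [l' df'] : cdiffable f w.
    by apply: hf; exact: in_rect_sub hw _ _ _ _.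
  exact: cdiff_cont (cdiffB df' (dg w)).
have g0 : rect_int g a b c k = 0.
  pose G w := f z * w + l * (2^-1 * ((w - z) * (w - z))).
  apply: (rect_int_primitive (g := G)) => // w _.
  have dwz := cdiffB (cdiff_id w) (cdiff_cst z w).
  apply: (cdiff_exteq (cdiffD (cdiffZ (f z) (cdiff_id w))
     (cdiffZ l (cdiffZ 2^-1 (cdiffM dwz dwz))))) => //.
  by rewrite /g /=; field.
rewrite /P; have -> : rect_int f a b c k = rect_int (fun w => f w - g w) a b c k.
  rewrite -[RHS]addr0 -g0 -rect_intD//; [|exact: ccont_rect_edges..].
  suff -> : (fun w => f w - g w + g w) = f by [].
  by apply/funext => w; rewrite subrK.
have hs : 0 <= (b - a) + (k - c) by lra.
apply: (le_trans (@rect_int_bound _ _ _ _ _ (e / 8 * ((b - a) + (k - c))) _ _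
  (ccont_rect_edges cfg) _)) => //.
  move=> w [[/andP[wa wb] /andP[wc wk]] _].
  have wz : cabs (w - z) <= (b - a) + (k - c).
    rewrite (le_trans (cabs_le_ReIm _))// ReD ImD ReN ImN lerD// ler_norml; lra.
  have -> : f w - g w = f (z + (w - z)) - f z - l * (w - z).
    by rewrite /g subrKC opprD addrA.
  apply: le_trans (Hd _ _) _; first by apply: le_lt_trans wz _; lra.
  by apply: ler_wpM2l => //; rewrite ltW.
set u := b - a; set v := k - c.
have : 0 <= (u - v) ^+ 2 by exact: sqr_ge0.
nra.
Qed.

End Rectangles.

(** * Cauchy's formula *)

Section CauchyFormula.
Context {R : realType}.
Implicit Types (f g F : R[i] -> R[i]) (x y : R) (z w : R[i]).

Lemma Re_inv (z : R[i]) : Re z^-1 = Re z / (Re z ^+ 2 + Im z ^+ 2).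
Proof. by case: z. Qed.
Lemma Im_inv (z : R[i]) : Im z^-1 = - Im z / (Re z ^+ 2 + Im z ^+ 2).
Proof. by case: z => a b /=; rewrite mulNr. Qed.

Lemma cdiff_quot F z w l : w != z -> cdiff F w l ->
  cdiffable (fun v => (F v - F z) / (v - z)) w.
Proof.
move=> wz dF.
have dw : cdiff (fun v => v - z) w 1.
  by apply: cdiff_eq (cdiffB (cdiff_id w) (cdiff_cst z w)) _; rewrite subr0.
have wz0 : w - z != 0 by rewrite subr_eq0.
eexists; apply: (cdiffM (cdiffB dF (cdiff_cst (F z) w))).
exact: (cdiff_comp dw (cdiffV wz0)).
Qed.

(** Cutting along the sides of a small square centred at u + iv leaves four rectangles that miss
    this point, and their integrals vanish by assumption. *)
Lemma rect_int_shrink f x0 x1 y0 y1 (u v t : R) : ccont_rect f x0 x1 y0 y1 ->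
  (forall a b c k, x0 <= a -> a <= b -> b <= x1 -> y0 <= c -> c <= k -> k <= y1 ->
    (b < u \/ u < a \/ k < v \/ v < c) -> rect_int f a b c k = 0) ->
  0 < t -> t <= u - x0 -> t <= x1 - u -> t <= v - y0 -> t <= y1 - v ->
  rect_int f x0 x1 y0 y1 = rect_int f (u - t) (u + t) (v - t) (v + t).
Proof.
move=> cf Z t0 tx0 tx1 ty0 ty1.
have [a1 a2 a3] : [/\ x0 <= u - t, u - t <= u + t & u + t <= x1] by split; lra.
have [b1 b2 b3] : [/\ y0 <= v - t, v - t <= v + t & v + t <= y1] by split; lra.
have ut : u - t < u by rewrite gtrBl.
have ut' : u < u + t by rewrite ltrDl.
have vt : v - t < v by rewrite gtrBl.
have vt' : v < v + t by rewrite ltrDl.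
have b13 := le_trans b1 b2; have a13 := le_trans a1 a2.
have b23 := le_trans b2 b3; have a23 := le_trans a2 a3.
have y01 := le_trans b13 b3.
have c1 : ccont_rect f (u - t) x1 y0 y1 by exact: ccont_rect_sub cf a1 _ _ _.
have c2 : ccont_rect f (u - t) (u + t) y0 y1 by exact: ccont_rect_sub c1 _ a3 _ _.
have c3 : ccont_rect f (u - t) (u + t) (v - t) y1 by exact: ccont_rect_sub c2 _ _ b1 _.
rewrite (rect_int_splitx (m := u - t) y01 _ cf) ?a1//.
rewrite (Z x0 (u - t) y0 y1)//; last by left.
rewrite add0r (rect_int_splitx (m := u + t) y01 _ c1) ?a2//.
rewrite (Z (u + t) x1 y0 y1)//; last by right; left.
rewrite addr0 (rect_int_splity (m := v - t) a2 _ c2) ?b1//.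
rewrite (Z (u - t) (u + t) y0 (v - t))//; last by do 2 right; left.
rewrite add0r (rect_int_splity (m := v + t) a2 _ c3) ?b2//.
rewrite (Z (u - t) (u + t) (v + t) y1) ?addr0//.
by do 3 right.
Qed.

(** The singularity is removable: extended by the derivative [l], the quotient is continuous at z
    and bounded by [M] near it. The integral thus equals that over a square of half-side t about z,
    which is at most 16 M t. *)
Lemma cauchy_quotient F x0 x1 y0 y1 z : chol_rect F x0 x1 y0 y1 ->
  x0 < Re z < x1 -> y0 < Im z < y1 ->
  rect_int (fun w => (F w - F z) / (w - z)) x0 x1 y0 y1 = 0.
Proof.
move=> hF /andP[x0z zx1] /andP[y0z zy1].
have x01 : x0 <= x1 by lra.
have y01 : y0 <= y1 by lra.
have [l dF] : cdiffable F z by apply: hF; split; apply/andP; split; lra.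
pose psi w := if w == z then l else (F w - F z) / (w - z).
have psiE w : w != z -> psi w = (F w - F z) / (w - z).
  by rewrite /psi => /negbTE ->.
have dpsi w : in_rect x0 x1 y0 y1 w -> w != z -> cdiffable psi w.
  move=> hw wz; have [k dFw] := hF w hw.
  have [k' dq] := cdiff_quot wz dFw.
  exists k'; apply: (@cdiff_near _ _ _ _ _ (cabs (w - z)) _ _ dq).
    by rewrite cabs_gt0 subr_eq0.
  move=> v hv; rewrite psiE//; apply/eqP => vz; move: hv.
  by rewrite vz cabsBC ltxx.
have psil (e : R) : 0 < e -> exists2 d : R, 0 < d & forall h, cabs h < d -> cabs (psi (z + h) - l) <= e.
  move=> e0; have [d d0 Hd] := dF e e0; exists d => // h hd.
  have [->|h0] := eqVneq h 0; first by rewrite addr0 /psi eqxx subrr cabs0 ltW.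
  rewrite psiE; last by rewrite -subr_eq0 addrC addKr.
  have -> : z + h - z = h by rewrite addrC addKr.
  have -> : (F (z + h) - F z) / h - l = (F (z + h) - F z - l * h) / h by field.
  by rewrite cabsM cabsV ler_pdivrMr ?cabs_gt0// Hd.
have cpsi : ccont_rect psi x0 x1 y0 y1.
  move=> w hw; have [->|wz] := eqVneq w z.
    by move=> e /psil[d d0 Hd]; exists d => // h /Hd; rewrite {3}/psi eqxx.
  by have [k /cdiff_cont] := dpsi _ hw wz.
rewrite (@eq_rect_int _ _ psi)//; last first.
  move=> w [_ hw]; rewrite psiE//; apply/eqP => wz; move: hw.
  by rewrite wz => -[] H; move: x0z zx1 y0z zy1; rewrite H ltxx.
apply: cabs0_eq; apply/eqP; rewrite eq_le cabs_ge0 andbT.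
apply/ler_addgt0Pr => e e0; rewrite add0r.
have [d d0 Hd] := psil 1 ltr01.
pose M := cabs l + 1.
have M0 : 0 < M by rewrite ltr_wpDl// cabs_ge0.
pose t := Num.min (Num.min (d / 4) (e / (16 * M)))
  (Num.min (Num.min (Re z - x0) (x1 - Re z)) (Num.min (Im z - y0) (y1 - Im z))).
have t0 : 0 < t by rewrite !lt_min !subr_gt0 x0z zx1 y0z zy1 !divr_gt0 ?mulr_gt0.
have [td te tx0 [tx1 ty0 ty1]] : [/\ t <= d / 4, t <= e / (16 * M), t <= Re z - x0 &
   [/\ t <= x1 - Re z, t <= Im z - y0 & t <= y1 - Im z]].
  by have := lexx t; rewrite {2}/t !le_min => /andP[/andP[-> ->] /andP[/andP[-> ->] /andP[-> ->]]].
have Z a b c k : x0 <= a -> a <= b -> b <= x1 -> y0 <= c -> c <= k -> k <= y1 ->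
    (b < Re z \/ Re z < a \/ k < Im z \/ Im z < c) -> rect_int psi a b c k = 0.
  move=> xa ab bx yc ck ky H; apply: goursat => // w hw.
  apply: dpsi; first exact: in_rect_sub hw _ _ _ _.
  case: hw => /andP[w1 w2] /andP[w3 w4]; apply/eqP => wz.
  by move: H; rewrite -wz; lra.
rewrite (rect_int_shrink cpsi Z t0 tx0 tx1 ty0 ty1).
apply: (le_trans (@rect_int_bound _ _ _ _ _ _ M _ _ _ _)); try lra.
- by apply: ccont_rect_edges; apply: ccont_rect_sub cpsi _ _ _ _; lra.
- move=> w [[/andP[w1 w2] /andP[w3 w4]] _].
  have -> : psi w = (psi (z + (w - z)) - l) + l by rewrite subrKC; ring.
  rewrite (le_trans (cabsD _ _))// addrC lerD2l Hd//.
  rewrite (le_lt_trans (cabs_le_ReIm _))// ReD ImD ReN ImN.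
  by have : `|Re w - Re z| <= t /\ `|Im w - Im z| <= t;
    [split; rewrite ler_norml; lra|lra].
rewrite ler_pdivlMr ?mulr_gt0// in te.
have -> : Re z + t - (Re z - t) + (Im z + t - (Im z - t)) = 4 * t by ring.
by have -> : 4 * M * (4 * t) = t * (16 * M) by ring.
Qed.

End CauchyFormula.

Section CauchyFormula2.
Context {R : realType}.
Implicit Types (f g F : R[i] -> R[i]) (x y : R) (z w : R[i]).

Lemma ccont_inv_sub z w : w != z -> ccont (fun v => (v - z)^-1) w.
Proof.
move=> wz.
have dw : cdiff (fun v => v - z) w 1.
  by apply: cdiff_eq (cdiffB (cdiff_id w) (cdiff_cst z w)) _; rewrite subr0.
have wz0 : w - z != 0 by rewrite subr_eq0.
exact: cdiff_cont (cdiff_comp dw (cdiffV wz0)).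
Qed.

Lemma on_edges_neq x0 x1 y0 y1 (z w : R[i]) : x0 < Re z < x1 -> y0 < Im z < y1 ->
  on_edges x0 x1 y0 y1 w -> w != z.
Proof.
move=> /andP[x0z zx1] /andP[y0z zy1] [_ hw]; apply/eqP => wz; move: hw.
by rewrite wz => -[] H; move: x0z zx1 y0z zy1; rewrite H ltxx.
Qed.

Lemma rint_gt0 a b (u : R -> R) (m : R) : a < b -> 0 < m -> cont_on a b u ->
  (forall t, a <= t <= b -> m <= u t) -> 0 < rint a b u.
Proof.
move=> ab m0 cu H; apply: (@lt_le_trans _ _ (m * (b - a))).
  by rewrite mulr_gt0// subr_gt0.
by rewrite -rint_cst ?(ltW ab)//; apply: rint_le => // t _; exact: cvg_cst.
Qed.

(* Each of the four edges contributes a nonnegative amount to the imaginary part. *)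
Lemma winding_neq0 x0 x1 y0 y1 z : x0 < Re z < x1 -> y0 < Im z < y1 ->
  rect_int (fun w => (w - z)^-1) x0 x1 y0 y1 != 0.
Proof.
move=> xz yz; have cK : ccont_edges (fun w => (w - z)^-1) x0 x1 y0 y1.
  by move=> w hw; apply: ccont_inv_sub; exact: on_edges_neq hw.
move: xz yz => /andP[x0z zx1] /andP[y0z zy1].
have x01 : x0 <= x1 by lra.
have y01 : y0 <= y1 by lra.
suff : 0 < Im (rect_int (fun w => (w - z)^-1) x0 x1 y0 y1).
  by apply: contraTneq => ->; rewrite ltxx.
rewrite /rect_int !ImD !ImN !ImM /= !mul0r !mul1r !add0r.
set u1 := fun t : R => Im _; set u2 := fun t : R => Re _; set u3 := fun t : R => Im _.
set u4 := fun t : R => Re _.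
have h1 : 0 <= rint x0 x1 u1.
  apply: rint_ge0 => t ht; rewrite /u1 Im_inv ImD ImN /=.
  by apply: divr_ge0; [lra|rewrite addr_ge0 ?sqr_ge0].
have h3 : 0 <= rint x0 x1 (fun t => -1 * u3 t).
  apply: rint_ge0 => t ht; rewrite /u3 Im_inv ImD ImN /= mulN1r mulNr opprK.
  by apply: divr_ge0; [lra|rewrite addr_ge0 ?sqr_ge0].
have h4 : 0 <= rint y0 y1 (fun t => -1 * u4 t).
  apply: rint_ge0 => t ht; rewrite /u4 Re_inv ReD ReN /= mulN1r -mulNr.
  by apply: divr_ge0; [lra|rewrite addr_ge0 ?sqr_ge0].
rewrite rintZ in h3; last first.
  by apply: pcont_on_Im; apply: ccont_edges_hor cK _ _ => //; auto.
rewrite rintZ in h4; last first.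
  by apply: pcont_on_Re; apply: ccont_edges_ver cK _ _ => //; auto.
pose a := x1 - Re z; pose b := y1 - y0.
have a0 : 0 < a by rewrite /a; lra.
have h2 : 0 < rint y0 y1 u2.
  apply: (@rint_gt0 _ _ _ (a / (a ^+ 2 + b ^+ 2))); first lra.
  - by rewrite divr_gt0// ltr_pwDl ?sqr_ge0// exprn_gt0.
  - by apply: pcont_on_Re; apply: ccont_edges_ver cK _ _ => //; auto.
  move=> t /andP[t1 t2]; rewrite /u2 Re_inv ReD ReN ImD ImN /= -/a.
  rewrite ler_pM2l// lef_pV2 ?posrE ?ltr_pwDl ?sqr_ge0 ?exprn_gt0//.
  have tb : `|t - Im z| <= b by rewrite ler_norml /b; lra.
  by rewrite lerD2l -(real_normK (num_real (t - Im z))) lerXn2r ?nnegrE ?(le_trans _ tb).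
by move: h1 h2 h3 h4; lra.
Qed.

(** Cauchy's formula with the integral of 1 / (w - z) left unevaluated: it is enough that this
    integral is nonzero, so its value 2 pi i never has to be computed. *)
Lemma cauchy_bound F x0 x1 y0 y1 z M r : chol_rect F x0 x1 y0 y1 ->
  x0 < Re z < x1 -> y0 < Im z < y1 -> 0 < r ->
  (forall w, on_edges x0 x1 y0 y1 w -> cabs (F w) <= M /\ r <= cabs (w - z)) ->
  cabs (rect_int (fun w => (w - z)^-1) x0 x1 y0 y1) * cabs (F z) <=
  4 * (M / r) * ((x1 - x0) + (y1 - y0)).
Proof.
move=> hF xz yz r0 HM.
have x01 : x0 <= x1 by lra.
have y01 : y0 <= y1 by lra.
have nz := on_edges_neq xz yz.
have cK : ccont_edges (fun w => (w - z)^-1) x0 x1 y0 y1.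
  by move=> w hw; apply: ccont_inv_sub; exact: nz.
have cFK : ccont_edges (fun w => F w / (w - z)) x0 x1 y0 y1.
  move=> w hw; have [l dF] := hF w hw.1.
  have [k' /cdiff_cont cq] := cdiff_quot (nz _ hw) dF.
  have wz : w - z != 0 by rewrite subr_eq0 nz.
  have dw : cdiff (fun v => v - z) w 1.
    by apply: cdiff_eq (cdiffB (cdiff_id w) (cdiff_cst z w)) _; rewrite subr0.
  exact: cdiff_cont (cdiffM dF (cdiff_comp dw (cdiffV wz))).
rewrite -cabsM mulrC.
have -> : F z * rect_int (fun w => (w - z)^-1) x0 x1 y0 y1 =
    rect_int (fun w => F w / (w - z)) x0 x1 y0 y1.
  rewrite -rect_intZ// -[LHS]add0r -(cauchy_quotient hF xz yz) -rect_intD//.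
  - by apply: eq_rect_int => // w _; rewrite -mulrDl subrK.
  - move=> w hw; have [l dF] := hF w hw.1.
    by have [k' /cdiff_cont cq] := cdiff_quot (nz _ hw) dF.
  - move=> w hw; apply: cdiff_cont; apply: cdiffZ.
    have wz : w - z != 0 by rewrite subr_eq0 nz.
    have dw : cdiff (fun v => v - z) w 1.
      by apply: cdiff_eq (cdiffB (cdiff_id w) (cdiff_cst z w)) _; rewrite subr0.
    exact: cdiff_comp dw (cdiffV wz).
apply: rect_int_bound => // w hw; have [h1 h2] := HM w hw.
rewrite cabsM cabsV ler_pM ?invr_ge0 ?cabs_ge0// lef_pV2 ?posrE//.
exact: lt_le_trans h2.
Qed.

Let sqr_sub_le (x y h : R) : x <= y -> y - x <= h -> (y - x) ^+ 2 <= h ^+ 2.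
Proof. by rewrite -subr_ge0 => h0 h1; rewrite lerXn2r ?nnegrE// (le_trans h0). Qed.

(* Multiplying by [exp (lam ((w - a)^2 - (z - a)^2))] makes the part of the boundary
   to the left of [x1] negligible, so smallness on the right propagates to [z]. *)
Lemma small_propagation (f : nat -> R[i] -> R[i]) xL x1 xR y h M z :
  xL < Re z < xR -> xL < x1 <= xR -> Im z = y -> 0 < h -> x1 - xL <= h ->
  (forall n, chol_rect (f n) xL xR (y - h) (y + h)) ->
  (forall n w, on_edges xL xR (y - h) (y + h) w -> cabs (f n w) <= M) ->
  (forall e : R, 0 < e -> exists n, forall w, on_edges xL xR (y - h) (y + h) w ->
     x1 <= Re w -> cabs (f n w) <= e) ->
  forall e : R, 0 < e -> exists n, cabs (f n z) <= e.
Proof.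
move=> /andP[xLz zxR] /andP[xL1 x1R] zy h0 x1h hf HM Hsm e e0.
have xz : xL < Re z < xR by rewrite xLz zxR.
have yz : y - h < Im z < y + h by rewrite zy; lra.
pose a := xL +i* y.
pose k := (Re z - xL) ^+ 2; pose L := (xR - xL) ^+ 2.
have k0 : 0 < k by rewrite exprn_gt0// subr_gt0.
pose c := cabs (rect_int (fun w => (w - z)^-1) xL xR (y - h) (y + h)).
have c0 : 0 < c by rewrite cabs_gt0 winding_neq0.
pose r := Num.min (Num.min (Re z - xL) (xR - Re z)) h.
have r0 : 0 < r by rewrite !lt_min h0 !subr_gt0 xLz zxR.
have Hr w : on_edges xL xR (y - h) (y + h) w -> r <= cabs (w - z).
  have [r1 r2 r3] : [/\ r <= Re z - xL, r <= xR - Re z & r <= h].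
    by have := lexx r; rewrite {2}/r !le_min => /andP[/andP[-> ->] ->].
  have := Re_le_cabs (w - z); have := Im_le_cabs (w - z).
  rewrite ReD ImD ReN ImN !ler_norml zy => /andP[q1 q2] /andP[q3 q4].
  by move=> [_ [] q]; move: q1 q2 q3 q4; rewrite q; lra.
have M0 : 0 <= M.
  apply: le_trans (HM 0%N (xL +i* y) _); first exact: cabs_ge0.
  by split; [split => /=; lra|exact: Or41].
pose P := (xR - xL) + (y + h - (y - h)).
have P0 : 0 < P by rewrite /P; lra.
pose K := 4 / r * P / c.
have K0 : 0 < K by rewrite /K divr_gt0// mulr_gt0// divr_gt0.
(* [lam] is such that the left part contributes at most [e / 2] *)
pose lam := Num.max 0 (ln ((M + 1) * K * 2 / e) / k).
have lam0 : 0 <= lam by rewrite le_max lexx.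
have lamE : M * expR (- (lam * k)) * K <= e / 2.
  have q0 : 0 < (M + 1) * K * 2 / e.
    have M1 : 0 < M + 1 by lra.
    by rewrite divr_gt0// mulr_gt0// mulr_gt0.
  have : ln ((M + 1) * K * 2 / e) <= lam * k.
    by rewrite -ler_pdivrMr// le_max lexx orbT.
  rewrite -ler_expR lnK ?posrE// ler_pdivrMr// => q.
  rewrite expRN -mulrA mulrCA ler_pdivrMl ?expR_gt0//.
  have := K0; nra.
have eL : 0 < e / 2 / K / expR (lam * L) by rewrite divr_gt0 ?expR_gt0// divr_gt0// divr_gt0.
have [n Hn] := Hsm _ eL.
exists n.
pose G w := cexp (lam%:C * ((w - a) ^+ 2 - (z - a) ^+ 2)).
have cG w : cabs (G w) = expR (lam * ((Re w - xL) ^+ 2 - (Im w - y) ^+ 2 - k)).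
  rewrite /G cabs_cexp; congr expR; rewrite mulrC ReMr mulrC; congr (_ * _).
  rewrite ReD ReN !expr2 !ReM !ReD !ImD !ReN !ImN /= zy /k; ring.
have Gz : G z = 1 by rewrite /G subrr mulr0 cexp0.
have dG w : cdiffable G w.
  have dwa := cdiffB (cdiff_id w) (cdiff_cst a w).
  eexists; apply: cdiff_cexp_comp; apply: cdiffZ.
  exact: (cdiffB (cdiff_comp dwa (cdiffX 2 _)) (cdiff_cst ((z - a) ^+ 2) w)).
have hF : chol_rect (fun w => f n w * G w) xL xR (y - h) (y + h).
  move=> w hw; have [l1 d1] := hf n w hw; have [l2 d2] := dG w.
  by eexists; exact: cdiffM d1 d2.
pose B := M * expR (- (lam * k)) + e / 2 / K.
have HB w : on_edges xL xR (y - h) (y + h) w ->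
    cabs (f n w * G w) <= B /\ r <= cabs (w - z).
  move=> hw; split; last exact: Hr.
  rewrite cabsM cG.
  have eK : 0 <= e / 2 / K by rewrite ltW// divr_gt0// divr_gt0.
  have Mk : 0 <= M * expR (- (lam * k)) by rewrite mulr_ge0 ?expR_ge0.
  have [[/andP[w1 w2] /andP[w3 w4]] we] := hw.
  have [x1w|wx1] := leP x1 (Re w).
    apply: (@le_trans _ _ (e / 2 / K)); last by rewrite /B lerDr.
    rewrite -[leRHS](divfK (_ : expR (lam * L) != 0)); last by rewrite gt_eqF// expR_gt0.
    apply: ler_pM; rewrite ?cabs_ge0 ?expR_ge0//; first exact: Hn.
    rewrite ler_expR ler_wpM2l//.
    have : (Re w - xL) ^+ 2 <= L by exact: sqr_sub_le w1 (lerB w2 (lexx _)).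
    have := sqr_ge0 (Im w - y); lra.
  apply: (@le_trans _ _ (M * expR (- (lam * k)))); last by rewrite /B lerDl.
  apply: ler_pM; rewrite ?cabs_ge0 ?expR_ge0//; first exact: HM.
  rewrite ler_expR -(mulrN lam k) ler_wpM2l//.
  (* The part of the boundary left of [x1] consists of the left side, where Re w = xL, and of pieces
     of the horizontal sides, where |Im w - y| = h >= x1 - xL. This is why h has to be at least x1 -
     xL. *)
  suff : (Re w - xL) ^+ 2 <= (Im w - y) ^+ 2 by lra.
  have q : (Re w - xL) ^+ 2 <= h ^+ 2 by exact: sqr_sub_le w1 (le_trans (lerB (ltW wx1) (lexx _)) x1h).
  case: we => we.
  - by rewrite we subrr expr0n sqr_ge0.
  - by move: wx1; rewrite we ltNge x1R.
  - by rewrite we; have -> : (y - h - y) ^+ 2 = h ^+ 2 by ring.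
  - by rewrite we; have -> : (y + h - y) ^+ 2 = h ^+ 2 by ring.
have := cauchy_bound hF xz yz r0 HB; rewrite -/c -/P Gz mulr1 => H.
have : cabs (f n z) <= B * K.
  by rewrite /K mulrA ler_pdivlMr// mulrC (le_trans H)// le_eqVlt; apply/orP; left;
    apply/eqP; ring.
move=> /le_trans; apply; rewrite /B mulrDl divfK ?gt_eqF//; lra.
Qed.

End CauchyFormula2.

(** * Growth and continuation of zeta *)

Section ZetaGrowth.
Context {R : realType}.
Implicit Types (s w z : R[i]) (x y a t : R).

Definition cpow x w : R[i] := cexp (w * (ln x)%:C).

Lemma natpowE n w : natpow n w = cpow n%:R w. Proof. by []. Qed.

Lemma cabs_cpow x w : cabs (cpow x w) = expR (Re w * ln x).
Proof. by rewrite cabs_cexp ReMr. Qed.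

Lemma cpowD x w z : cpow x (w + z) = cpow x w * cpow x z.
Proof. by rewrite /cpow mulrDl cexpD. Qed.

Lemma cpowN1 x : 0 < x -> cpow x (-1) = (x^-1)%:C.
Proof.
by move=> x0; rewrite /cpow mulN1r cexpN cexp_real lnK// real_complexV.
Qed.

Lemma pdiff_comp (p : R -> R[i]) f t l k : pdiff p t l -> cdiff f (p t) k ->
  pdiff (fun r : R => f (p r)) t (k * l).
Proof.
move=> dp df e e0.
pose A := cabs l + 1; pose B := cabs k + 1.
have A0 : 0 < A by rewrite ltr_wpDl// cabs_ge0.
have B0 : 0 < B by rewrite ltr_wpDl// cabs_ge0.
have eA : 0 < e / 2 / A by rewrite !divr_gt0.
have eB : 0 < e / 2 / B by rewrite !divr_gt0.
have [d d0 Hg] := df _ eA.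
have [d1 d10 Hf1] := dp _ eB.
have [d2 d20 Hf2] := dp _ (@ltr01 R).
exists (Num.min (Num.min d1 d2) (d / A)).
  by rewrite !lt_min d10 d20 divr_gt0.
move=> h; rewrite !lt_min => /andP[/andP[/Hf1 h1 /Hf2 h2] hd].
rewrite ltr_pdivlMr// in hd.
set u := p (t + h) - p t.
have uE : p (t + h) = p t + u by rewrite /u; ring.
have hu : cabs u <= A * `|h|.
  have -> : u = (p (t + h) - p t - l * h%:C) + l * h%:C by rewrite /u; ring.
  by rewrite (le_trans (cabsD _ _))// cabsM cabs_real /A; lra.
have ud : cabs u < d by rewrite (le_lt_trans hu)// mulrC.
rewrite uE.
have -> : f (p t + u) - f (p t) - k * l * h%:C =
  (f (p t + u) - f (p t) - k * u) + k * (p (t + h) - p t - l * h%:C).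
  by rewrite /u; ring.
rewrite (le_trans (cabsD _ _))// cabsM.
have h3 : cabs (f (p t + u) - f (p t) - k * u) <= e / 2 * `|h|.
  rewrite (le_trans (Hg _ ud))// (le_trans (ler_wpM2l (ltW eA) hu))//.
  by rewrite mulrA divfK// gt_eqF.
have h4 : cabs k * cabs (p (t + h) - p t - l * h%:C) <= e / 2 * `|h|.
  rewrite (le_trans (ler_wpM2l (cabs_ge0 _) h1))//.
  rewrite mulrA ler_wpM2r//.
  rewrite mulrCA ler_piMr ?ltW ?divr_gt0//.
  by rewrite ltr_pdivrMr// mul1r /B ltrDl.
by lra.
Qed.

Lemma pdiff_real (u : R -> R) (t l : R) : is_derive t 1 u l ->
  pdiff (fun r : R => (u r)%:C) t l%:C.
Proof.
move=> /is_derive_epsdelta H e e0; have [d d0 Hd] := H _ e0.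
exists d => // h hd; rewrite -real_complexM -!rmorphB cabs_real; exact: Hd.
Qed.

Lemma pdiff_eq (p : R -> R[i]) t l k : pdiff p t l -> l = k -> pdiff p t k.
Proof. by move=> ? <-. Qed.

Lemma pdiff_cpow x w : 0 < x -> pdiff (fun t => cpow t w) x (w * cpow x (w - 1)).
Proof.
move=> x0.
have H := pdiff_real (is_derive1_ln x0).
have H2 := pdiff_comp H (cdiff_cexp_comp (cdiffZ w (cdiff_id _))).
by apply: (pdiff_eq H2); rewrite cpowD cpowN1// /cpow; ring.
Qed.

Lemma expR_ln_le x y a : 0 < x -> x <= y -> 0 <= a ->
  expR (- a * ln y) <= expR (- a * ln x).
Proof.
move=> x0 xy a0; rewrite ler_expR !mulNr lerN2 ler_wpM2l// ler_ln ?posrE//.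
exact: lt_le_trans xy.
Qed.

Lemma cpow_diff_le x y s : 0 < x -> x <= y -> 0 <= Re s ->
  cabs (cpow y (- s) - cpow x (- s)) <=
    2 * (cabs s * expR (- (Re s + 1) * ln x)) * (y - x).
Proof.
move=> x0 xy s0.
have tpos t : x <= t <= y -> 0 < t by move=> /andP[+ _]; exact: lt_le_trans.
have cp : pcont_on x y (fun t => - s * cpow t (- s - 1)).
  move=> t /tpos t0; apply: pcontM; first exact: pcont_cst.
  exact: pdiff_cont (pdiff_cpow _ t0).
rewrite -(cint_FTC (q := fun t => cpow t (- s)) xy cp); last first.
  by move=> t /tpos t0; exact: pdiff_cpow.
apply: cint_bound => // t /andP[xt ty].
rewrite cabsM cabsN cabs_cpow ler_wpM2l ?cabs_ge0//.
rewrite ReD !ReN -opprD; apply: expR_ln_le => //.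
by rewrite addr_ge0.
Qed.

(** With n = N + 1 this is n^(-s) minus the integral of x^(-s) over [n, n + 1], the term of
    Euler-Maclaurin summation. It has size |s| n^(-Re s - 1), which is summable for Re s > 0. *)
Definition zterm (N : nat) s : R[i] :=
  natpow N.+1 (- s) + (natpow N.+2 (1 - s) - natpow N.+1 (1 - s)) / (s - 1).

Lemma zterm_bound N s : 0 <= Re s -> s != 1 ->
  cabs (zterm N s) <= 4 * (cabs s * expR (- (Re s + 1) * ln N.+1%:R)).
Proof.
move=> s0 s1; rewrite /zterm !natpowE.
have x0 : 0 < N.+1%:R :> R by rewrite ltr0n.
have xy : N.+1%:R <= N.+2%:R :> R by rewrite ler_nat.
have y1 : N.+2%:R - N.+1%:R = 1 :> R by rewrite -natrB// subSnn.
set x := N.+1%:R in x0 xy y1 *; set y := N.+2%:R in xy y1 *.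
have tpos t : x <= t <= y -> 0 < t by move=> /andP[+ _]; exact: lt_le_trans.
have cp : pcont_on x y (fun t => cpow t (- s)).
  by move=> t /tpos t0; exact: pdiff_cont (pdiff_cpow _ t0).
have s1' : s - 1 != 0 by rewrite subr_eq0.
have E1 : cint x y (fun t => cpow t (- s)) =
    - (cpow y (1 - s) - cpow x (1 - s)) / (s - 1).
  have -> : - (cpow y (1 - s) - cpow x (1 - s)) / (s - 1) =
     - (s - 1)^-1 * cpow y (1 - s) - - (s - 1)^-1 * cpow x (1 - s) by ring.
  apply: (cint_FTC (q := fun t => - (s - 1)^-1 * cpow t (1 - s))) => // t /tpos t0.
  have H := pdiff_comp (pdiff_cpow (1 - s) t0) (cdiffZ (- (s - 1)^-1) (cdiff_id _)).
  apply: (pdiff_eq H); have -> : 1 - s - 1 = - s by ring.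
  by field.
have E2 : cint x y (fun=> cpow x (- s)) = cpow x (- s).
  have -> : cint x y (fun=> cpow x (- s)) =
      cpow x (- s) * y%:C - cpow x (- s) * x%:C; last first.
    by rewrite -mulrBr -rmorphB y1 mulr1.
  apply: (cint_FTC (q := fun t => cpow x (- s) * t%:C)) => // [t _|t _].
    exact: pcont_cst.
  move=> e e0; exists 1 => // h _.
  have -> : cpow x (- s) * (t + h)%:C - cpow x (- s) * t%:C - cpow x (- s) * h%:C = 0.
    by rewrite real_complexD; ring.
  by rewrite cabs0 mulr_ge0// ltW.
have -> : cpow x (- s) + (cpow y (1 - s) - cpow x (1 - s)) / (s - 1) =
    cint x y (fun t => cpow x (- s) - cpow t (- s)).
  rewrite cintB//; last by move=> t _; exact: pcont_cst.
  by rewrite E1 E2 mulNr opprK.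
apply: le_trans (@cint_bound _ _ _ _ (2 * (cabs s * expR (- (Re s + 1) * ln x)))
  xy _ _) _.
- by move=> t ht; apply: pcontD; [exact: pcont_cst|exact: (@pcont_onN _ x y)].
- move=> t ht; rewrite cabsBC; have /andP[h1 h2] := ht.
  apply: le_trans (@cpow_diff_le x t s x0 h1 s0) _.
  apply: ler_piMr; last lra.
  by rewrite !mulr_ge0 ?cabs_ge0 ?expR_ge0.
- by rewrite y1 mulr1; lra.
Qed.

(** The middle term is the integral of t^(-1-a) over [n + 1, n + 2]; by the mean value theorem it is
    a value of this decreasing function inside the interval. *)
Lemma power_sum_step a (n : nat) : 0 < a ->
  expR (- (1 + a) * ln n.+2%:R) <=
    (expR (- a * ln n.+1%:R) - expR (- a * ln n.+2%:R)) / a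
    <= expR (- (1 + a) * ln (n.+1%:R : R)).
Proof.
move=> a0.
have x0 : 0 < n.+1%:R :> R by rewrite ltr0n.
have xy : n.+1%:R < n.+2%:R :> R by rewrite ltr_nat.
have y1 : n.+2%:R - n.+1%:R = 1 :> R by rewrite -natrB// subSnn.
set x := n.+1%:R in x0 xy y1 *; set y := n.+2%:R in xy y1 *.
pose u t := expR (- a * ln t); pose du t := - a * expR (- (1 + a) * ln t).
have dut t : 0 < t -> is_derive t 1 u (du t).
  move=> t0; have dl := is_derive1_ln t0.
  have -> : du t = expR (- a * ln t) * (- a * t^-1).
    rewrite /du [RHS]mulrCA; congr (_ * _).
    have -> : t^-1 = expR (- ln t) by rewrite expRN lnK.
    by rewrite -expRD; congr expR; ring.
  exact: (@is_derive1_comp _ expR (fun r => - a * ln r)).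
have [t] : exists2 t, t \in `]x, y[%R & u y - u x = du t * (y - x).
  apply: MVT => // [t|]; first by rewrite in_itv /= => /andP[xt _]; apply: dut; exact: lt_trans xt.
  apply: cont_on_within => t /andP[xt _].
  have [dt _] := dut t (lt_le_trans x0 xt).
  by apply: differentiable_continuous; exact/derivable1_diffP.
rewrite in_itv /= => /andP[xt ty]; rewrite y1 mulr1 => E.
have -> : (expR (- a * ln x) - expR (- a * ln y)) / a = expR (- (1 + a) * ln t).
  have -> : expR (- a * ln x) - expR (- a * ln y) = - (u y - u x) by rewrite /u; ring.
  by rewrite E /du; field; rewrite gt_eqF.
have t0 : 0 < t by exact: lt_trans xt.
by apply/andP; split; apply: expR_ln_le => //; rewrite ?ltW// addr_gt0.
Qed.

Lemma power_sum_le a (m n : nat) : 0 < a -> (m <= n)%N ->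
  \sum_(m <= k < n) expR (- (1 + a) * ln (k.+2%:R : R)) <=
    expR (- a * ln m.+1%:R) / a.
Proof.
move=> a0 mn.
apply: (@le_trans _ _ ((expR (- a * ln m.+1%:R) - expR (- a * ln n.+1%:R)) / a)).
  elim: n mn => [|n IH]; first by rewrite leqn0 => /eqP ->; rewrite big_geq// subrr mul0r.
  rewrite leq_eqVlt => /predU1P[->|]; first by rewrite big_geq// subrr mul0r.
  rewrite ltnS => mn; rewrite big_nat_recr//=.
  have /andP[h _] := power_sum_step n a0.
  rewrite (le_trans (lerD (IH mn) h))// -mulrDl ler_wpM2r ?invr_ge0 ?(ltW a0)//; lra.
by rewrite ler_wpM2r ?invr_ge0 ?(ltW a0)// lerBlDr lerDl expR_ge0.
Qed.

Lemma power_sum_ge a (n : nat) : 0 < a ->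
  (1 - expR (- a * ln n.+1%:R)) / a <=
  \sum_(0 <= k < n) expR (- (1 + a) * ln (k.+1%:R : R)).
Proof.
move=> a0; elim: n => [|n IH]; first by rewrite big_geq// ln1 mulr0 expR0 subrr mul0r.
rewrite big_nat_recr//=; have /andP[_ h] := power_sum_step n a0.
by rewrite (le_trans _ (lerD IH h))// -mulrDl ler_wpM2r ?invr_ge0 ?(ltW a0)//; lra.
Qed.

End ZetaGrowth.

(** * Euler-Maclaurin sums and the growth of zeta in the strip *)

Section ZetaContinuation.
Context {R : realType}.
Implicit Types (s w z : R[i]) (x y a e : R).

Lemma natpow1 s : natpow 1 s = 1 :> R[i].
Proof. by rewrite /natpow ln1 mulr0 cexp0. Qed.

Lemma cabs_natpow n s : cabs (natpow n s) = expR (Re s * ln n%:R).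
Proof. exact: cabs_cpow. Qed.

Lemma exp_ln_small a e : 0 < a -> 0 < e ->
  exists N, forall n, (N <= n)%N -> expR (- a * ln (n.+1%:R : R)) <= e.
Proof.
move=> a0 e0; have q0 : 0 <= expR (- (ln e / a)) by exact: expR_ge0.
have := archi_boundP q0; set N := Num.bound _ => HN.
exists N => n Nn; rewrite -[leRHS]lnK ?posrE// ler_expR.
have : - (ln e / a) <= ln (n.+1%:R : R).
  rewrite -ler_expR lnK ?posrE// (le_trans (ltW HN))// ler_nat.
  exact: leqW.
rewrite -mulNr ler_pdivrMr//; lra.
Qed.

(** The partial sum of the Dirichlet series plus the integral of x^(-s) over [N + 1, oo) in closed
    form. Its increments are [zterm], so these sums settle down to the left of Re s = 1 as well. *)
Definition Ez N s : R[i] :=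
  \sum_(0 <= k < N) natpow k.+1 (- s) + natpow N.+1 (1 - s) / (s - 1).

Lemma EzS N s : Ez N.+1 s = Ez N s + zterm N s.
Proof. by rewrite /Ez /zterm big_nat_recr//=; ring. Qed.

Lemma Re_neq1 s : Re s != 1 -> s != 1.
Proof. by apply: contraNneq => ->. Qed.

Lemma Ez_diff m n s : 4^-1 <= Re s -> s != 1 -> (m <= n)%N ->
  cabs (Ez n.+1 s - Ez m.+1 s) <= 16 * cabs s * expR (- 4^-1 * ln m.+1%:R).
Proof.
move=> s4 s1 mn; have a4 : 0 < 4^-1 :> R by rewrite invr_gt0.
have H : cabs (Ez n.+1 s - Ez m.+1 s) <=
    4 * cabs s * \sum_(m <= k < n) expR (- (1 + 4^-1) * ln k.+2%:R).
  elim: n mn => [|n IH]; first by rewrite leqn0 => /eqP ->; rewrite subrr cabs0 big_geq// mulr0.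
  rewrite leq_eqVlt => /predU1P[->|]; first by rewrite subrr cabs0 big_geq// mulr0.
  rewrite ltnS => mn; rewrite big_nat_recr//= mulrDr EzS.
  have -> : Ez n.+1 s + zterm n.+1 s - Ez m.+1 s = Ez n.+1 s - Ez m.+1 s + zterm n.+1 s by ring.
  rewrite (le_trans (cabsD _ _))// lerD ?IH//.
  have s0 : 0 <= Re s by lra.
  rewrite (le_trans (zterm_bound n.+1 s0 s1))// -!mulrA ler_wpM2l// ler_wpM2l ?cabs_ge0//.
  by rewrite ler_expR !mulNr lerN2 ler_wpM2r ?ln_ge0 ?ler1n//; lra.
apply: (le_trans H); have := power_sum_le a4 mn; rewrite invrK => P.
by have := cabs_ge0 s; nra.
Qed.

Lemma Ez_bound n s : 4^-1 <= Re s -> s != 1 ->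
  cabs (Ez n s) <= (cabs (s - 1))^-1 + 20 * cabs s.
Proof.
move=> s4 s1; have s0 : 0 <= Re s by lra.
have E0 : Ez 0 s = (s - 1)^-1 by rewrite /Ez big_geq// natpow1 add0r mul1r.
have c0 := cabs_ge0 s.
case: n => [|n]; first by rewrite E0 cabsV; lra.
have -> : Ez n.+1 s = (Ez n.+1 s - Ez 1 s) + (zterm 0 s + (s - 1)^-1).
  by rewrite (EzS 0) E0; ring.
have h1 := Ez_diff s4 s1 (leq0n n); rewrite ln1 mulr0 expR0 mulr1 in h1.
have h2 := zterm_bound 0 s0 s1; rewrite ln1 mulr0 expR0 mulr1 in h2.
rewrite (le_trans (cabsD _ _))// (le_trans (lerD h1 (cabsD _ _)))//.
by rewrite cabsV; lra.
Qed.

Lemma ccont_rect_bounded (f : R[i] -> R[i]) x0 x1 y0 y1 : x0 <= x1 -> y0 <= y1 ->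
  ccont_rect f x0 x1 y0 y1 ->
  exists M : R, forall z, in_rect x0 x1 y0 y1 z -> cabs (f z) <= M.
Proof.
move=> x01 y01 cf.
apply: (rect_bisection (P := fun x0 x1 y0 y1 =>
  exists M : R, forall z, in_rect x0 x1 y0 y1 z -> cabs (f z) <= M)) => //.
  move=> a b c d _ _ _ _ _ _ [M1 h1] [M2 h2] [M3 h3] [M4 h4].
  exists (Num.max (Num.max M1 M2) (Num.max M3 M4)) => z [/andP[za zb] /andP[zc zd]].
  rewrite !le_max; have [zx|zx] := leP (Re z) ((a + b) / 2);
    have [zy|zy] := leP (Im z) ((c + d) / 2).
  - by rewrite h1//; split; lra.
  - by rewrite h3 ?orbT//; split; lra.
  - by rewrite h2 ?orbT//; split; lra.
  - by rewrite h4 ?orbT//; split; lra.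
move=> z /cf/(_ 1 ltr01)[d d0 Hd]; exists (d / 2); first by rewrite divr_gt0.
move=> a b c k _ _ _ _ _ _ [/andP[za zb] /andP[zc zk]] ab ck.
exists (cabs (f z) + 1) => w [/andP[wa wb] /andP[wc wk]].
have -> : f w = (f (z + (w - z)) - f z) + f z by rewrite subrKC subrK.
rewrite (le_trans (cabsD _ _))// addrC lerD2l Hd//.
rewrite (le_lt_trans (cabs_le_ReIm _))// ReD ImD ReN ImN.
have h1 : `|Re w - Re z| <= b - a by rewrite ler_norml; lra.
have h2 : `|Im w - Im z| <= k - c by rewrite ler_norml; lra.
by lra.
Qed.

Lemma Ez_cdiff n s : s != 1 -> cdiffable (Ez n) s.
Proof.
move=> s1; have s1' : s - 1 != 0 by rewrite subr_eq0.
have dpow m (a b : R[i]) z : cdiff (fun w => natpow m (a + b * w)) z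
    (cexp ((a + b * z) * (ln m%:R)%:C) * ((ln m%:R)%:C * b)).
  apply: cdiff_cexp_comp.
  apply: (cdiff_exteq (cdiffZ (ln m%:R)%:C (cdiffD (cdiff_cst a z) (cdiffZ b (cdiff_id z))))) => [w|].
    by rewrite mulrC.
  by rewrite add0r mulr1.
have d1 := cdiffB (cdiff_id s) (cdiff_cst 1 s).
eexists; apply: cdiffD; last first.
  apply: cdiffM; last exact: cdiff_comp d1 (cdiffV s1').
  by apply: (cdiff_ext _ (dpow n.+1 1 (-1) s)) => w; rewrite mulN1r.
apply: cdiff_sum => k.
by apply: (cdiff_ext _ (dpow k.+1 0 (-1) s)) => w; rewrite mulN1r add0r.
Qed.

Hypothesis RH : riemann_hypothesis R.

(** If no function met the specification, [xget] would return its default, the zero function. The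
    Riemann hypothesis would then put every point of the strip on Re s = 1/2, which fails at s =
    1/4. The existence of the continuation is thus contained in the hypothesis. *)
Lemma zeta_spec : is_riemann_zeta (@zeta R).
Proof.
apply: contrapT => H.
have z0 : @zeta R = fun=> 0.
  apply: xgetPN => f; apply/not_andP; apply: contrapT => ff.
  by apply: H; apply: xgetPex; exists f; apply: contrapT => /not_andP.
have h : (4^-1 : R) < 1 by rewrite invf_lt1// ltr1n.
have h0 : (0 : R) < 4^-1 by rewrite invr_gt0.
have := RH (s := 4^-1 +i* 0) h0 h; rewrite z0 => /(_ erefl) /= E.
have : (4^-1 : R)^-1 = (2^-1)^-1 by rewrite E.
by rewrite !invrK => /eqP; rewrite eqr_nat.
Qed.

Lemma zeta_cdiffable s : s != 1 -> cdiffable (@zeta R) s.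
Proof. by move=> s1; apply: derivable_cdiffable; apply: zeta_spec.2. Qed.

Lemma zeta_series s : 1 < Re s -> forall e : R, 0 < e -> exists N, forall n, (N <= n)%N ->
  cabs (\sum_(0 <= k < n) natpow k.+1 (- s) - zeta s) <= e.
Proof.
move=> s1 e e0; have := zeta_spec.1 s s1.
have eC : (0 : R[i]) < e%:C by rewrite ltcR.
move=> /cvgrPdist_le/(_ _ eC)[N _ HN]; exists N => n Nn.
have := HN n Nn; rewrite /= distrC normc_def -cabsE lecR.
by rewrite /series.
Qed.

(** For Re w >= 3/2 the closed-form tail in [Ez N w] tends to 0, so [Ez N w] tends to zeta(w); the
    bound is [Ez_diff] in the limit N to infinity. *)
Lemma zeta_Ez_right n w : 3 / 2 <= Re w ->
  cabs (zeta w - Ez n.+1 w) <= 16 * cabs w * expR (- 4^-1 * ln n.+1%:R).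
Proof.
move=> w32; apply/ler_addgt0Pr => e e0.
have e2 : 0 < e / 2 by rewrite divr_gt0.
have e4 : 0 < e / 4 by rewrite divr_gt0.
have w1 : 1 < Re w by lra.
have w4 : 4^-1 <= Re w.
  have h : (4^-1 : R) <= 1 by rewrite invf_le1// ler1n.
  lra.
have wn1 : w != 1 by apply: Re_neq1; rewrite gt_eqF.
have [N1 H1] := zeta_series w1 e2.
have h2 : 0 < 2^-1 :> R by rewrite invr_gt0.
have [N2 H2] := exp_ln_small h2 e4.
pose N := maxn n (maxn N1 N2).
have nN : (n <= N)%N by rewrite leq_maxl.
have N1N : (N1 <= N.+1)%N by rewrite leqW// /N maxnCA leq_maxl.
have N2N : (N2 <= N.+1)%N by rewrite leqW// /N maxnA leq_maxr.
have -> : zeta w - Ez n.+1 w = (Ez N.+1 w - Ez n.+1 w) +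
  (natpow N.+2 (1 - w) / (1 - w) - (\sum_(0 <= k < N.+1) natpow k.+1 (- w) - zeta w)).
  by rewrite /Ez -(opprB w 1) invrN; ring.
rewrite (le_trans (cabsD _ _))// lerD ?Ez_diff//.
rewrite (le_trans (cabsB _ _))// (splitr e) lerD ?H1//.
rewrite cabsM cabsV ler_pdivrMr; last by rewrite cabs_gt0 subr_eq0 eq_sym.
have hw : 2^-1 <= cabs (1 - w).
  rewrite cabsBC (le_trans _ (Re_le_cabs _))// ReD ReN /= ler_normr; lra.
rewrite cabs_natpow ReD ReN /=.
apply: (@le_trans _ _ (e / 4)); last by have := ltW e0; nra.
apply: le_trans _ (H2 _ N2N); rewrite ler_expR ler_wpM2r ?ln_ge0 ?ler1n//; lra.
Qed.

(** The sums [Ez n] are bounded linearly in |s| on Re s >= 1/4, but only for Re s >= 3/2 is their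
    distance to zeta known to be small. [small_propagation] carries this smallness to s. It needs
    just some bound for zeta on the box, and compactness provides one of unknown size, which
    disappears from the result. *)
Lemma zeta_growth s : 2^-1 <= Re s <= 2 -> 3 <= Im s -> cabs (zeta s) <= 21 * cabs s.
Proof.
move=> /andP[s2 s3] si.
have q4 : 4^-1 < 2^-1 :> R by rewrite ltf_pV2 ?posrE// ltr_nat.
have q1 : 2^-1 < 1 :> R by rewrite invf_lt1// ltr1n.
have q0 : 0 < 4^-1 :> R by rewrite invr_gt0.
have neq1 w : in_rect 4^-1 3 (Im s - 2) (Im s + 2) w -> w != 1.
  move=> [_ /andP[h _]]; apply/eqP => w1; move: h; rewrite w1 /=; lra.
have sr : in_rect 4^-1 3 (Im s - 2) (Im s + 2) s by split; lra.
have cz : ccont_rect (@zeta R) 4^-1 3 (Im s - 2) (Im s + 2).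
  by move=> w /neq1 /zeta_cdiffable[l /cdiff_cont].
have x03 : (4^-1 : R) <= 3 by lra.
have y03 : Im s - 2 <= Im s + 2 by lra.
have [M0 HM0] := ccont_rect_bounded x03 y03 cz.
have bw w : in_rect 4^-1 3 (Im s - 2) (Im s + 2) w ->
    1 <= cabs (w - 1) /\ cabs w <= 3 + (Im s + 2).
  move=> [/andP[w1 w2] /andP[w3 w4]]; split.
    by rewrite (le_trans _ (Im_le_cabs _))// ImD ImN /= subr0 ler_normr; lra.
  rewrite (le_trans (cabs_le_ReIm _))// lerD// ger0_norm; lra.
pose M := M0 + (1 + 20 * (3 + (Im s + 2))).
have small : forall e : R, 0 < e -> exists n : nat, cabs (zeta s - Ez n.+1 s) <= e.
  apply: (@small_propagation _ (fun n w => zeta w - Ez n.+1 w) 4^-1 (3 / 2) 3 (Im s) 2 M) => //; try lra.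
  - move=> n w hw; have [l1 d1] := zeta_cdiffable (neq1 _ hw).
    by have [l2 d2] := Ez_cdiff n.+1 (neq1 _ hw); eexists; exact: cdiffB d1 d2.
  - move=> n w [hw _]; have [b1 b2] := bw _ hw.
    rewrite (le_trans (cabsB _ _))// lerD ?HM0// (le_trans (Ez_bound _ _ _)) ?neq1//.
      by case: hw => /andP[].
    rewrite lerD ?ler_wpM2l// invf_le1//; lra.
  - move=> e e0; pose K := 16 * (3 + (Im s + 2)).
    have K0 : 0 < K by rewrite /K; lra.
    have [N HN] := exp_ln_small q0 (divr_gt0 e0 K0).
    exists N => w [hw _] w32; have [b1 b2] := bw _ hw.
    apply: (le_trans (zeta_Ez_right N w32)).
    apply: (@le_trans _ _ (K * (e / K))); last by rewrite mulrC divfK// gt_eqF.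
    apply: ler_pM; rewrite ?expR_ge0 ?mulr_ge0 ?cabs_ge0//; last exact: HN.
    by rewrite /K ler_wpM2l.
apply/ler_addgt0Pr => e e0; have [n Hn] := small e e0.
have -> : zeta s = (zeta s - Ez n.+1 s) + Ez n.+1 s by ring.
rewrite (le_trans (cabsD _ _))// addrC lerD//.
have [b1 _] := bw _ sr.
rewrite (le_trans (Ez_bound _ _ _)) ?neq1//; first lra.
have h : (cabs (s - 1))^-1 <= 1 by rewrite invf_le1//; lra.
have : 3 <= cabs s by rewrite (le_trans _ (Im_le_cabs _))// ler_normr; lra.
lra.
Qed.

End ZetaContinuation.

(** * Euler product and nonvanishing *)

Section EulerProduct.
Context {R : realType}.
Implicit Types (s w z : R[i]) (x a e : R) (m n p q y : nat).

Lemma sum_nat_drop (F : nat -> R) m n p : (m <= n <= p)%N ->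
  (forall k, (m <= k < n)%N -> F k = 0) ->
  \sum_(m <= k < p) F k = \sum_(n <= k < p) F k.
Proof.
move=> /andP[mn np] H; rewrite (big_cat_nat mn np) /= big_nat_cond big1 ?add0r//.
by move=> k; rewrite andbT => /H.
Qed.

Definition rough y m := all (fun p => (y < p)%N) (primes m).

Lemma rough0 m : rough 0 m.
Proof. by apply/allP => p; rewrite mem_primes => /andP[/prime_gt0]. Qed.

Lemma rough_nonprime y m : ~~ prime y.+1 -> rough y.+1 m = rough y m.
Proof.
move=> ny; apply: eq_in_all => p; rewrite mem_primes => /andP[pp _].
by rewrite [RHS]leq_eqVlt; case: eqP => // E; move: ny; rewrite E pp.
Qed.

Lemma rough_prime y m : (0 < m)%N -> prime y.+1 ->
  rough y.+1 m = rough y m && ~~ (y.+1 %| m)%N.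
Proof.
move=> m0 py; apply/allP/andP => [H|[/allP H nd] p pm].
  split; first by apply/allP => p /H; exact: ltnW.
  by apply/negP => ym; have := H y.+1; rewrite mem_primes py m0 ym ltnn => /(_ isT).
rewrite ltn_neqAle H// andbT; apply: contra nd => /eqP ->.
by move: pm; rewrite mem_primes => /and3P[].
Qed.

Lemma rough_mul y m : (0 < m)%N -> prime y.+1 -> rough y (y.+1 * m) = rough y m.
Proof.
move=> m0 py; apply/allP/allP => H p.
  by move=> pm; apply: H; rewrite primesM// pm orbT.
by rewrite primesM// primes_prime// inE => /orP[/eqP ->//|/H].
Qed.

Lemma rough_gt y m : (1 < m)%N -> rough y m -> (y < m)%N.
Proof.
move=> m1 /allP H; have pm : pdiv m \in primes m.
  by rewrite mem_primes pdiv_prime// pdiv_dvd (ltnW m1).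
by rewrite (leq_trans (H _ pm))// pdiv_leq// ltnW.
Qed.

Lemma natpowM m n s : (0 < m)%N -> (0 < n)%N ->
  natpow (m * n) s = natpow m s * natpow n s :> R[i].
Proof.
move=> m0 n0; rewrite /natpow natrM lnM ?posrE ?ltr0n//.
by rewrite real_complexD mulrDr cexpD.
Qed.

Definition rsum s y n : R[i] := \sum_(1 <= m < n.+1 | rough y m) natpow m (- s).

Lemma sum_dvd (F : nat -> R[i]) q n : (0 < q)%N ->
  \sum_(1 <= m < n.+1 | (q %| m)%N) F m = \sum_(1 <= k < (n %/ q).+1) F (q * k)%N.
Proof.
move=> q0; elim: n => [|n IH]; first by rewrite div0n !big_geq.
rewrite big_mkcond big_nat_recr//= -big_mkcond IH divnS//.
have [qn|qn] := boolP (q %| n.+1)%N; last by rewrite add0n addr0.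
rewrite add1n [RHS]big_nat_recr//=; congr (_ + F _).
by have := divnK qn; rewrite divnS// qn add1n mulnC.
Qed.

(** One step of the sieve of Eratosthenes: the y-rough multiples of the prime y + 1 up to n are y +
    1 times the y-rough numbers up to n / (y + 1). *)
Lemma rsum_step s y n : prime y.+1 ->
  rsum s y.+1 n = rsum s y n - natpow y.+1 (- s) * rsum s y (n %/ y.+1).
Proof.
move=> py; apply/eqP; rewrite eq_sym subr_eq eq_sym; apply/eqP.
have -> : natpow y.+1 (- s) * rsum s y (n %/ y.+1) =
    \sum_(1 <= m < n.+1 | (y.+1 %| m)%N) (if rough y m then natpow m (- s) else 0).
  rewrite sum_dvd// /rsum big_mkcond mulr_sumr; apply: eq_big_nat => k /andP[k0 _].
  by rewrite rough_mul//; case: ifP => _; rewrite ?mulr0// natpowM.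
rewrite /rsum [X in X + _]big_mkcond [X in _ + X]big_mkcond [RHS]big_mkcond -big_split /=.
apply: eq_big_nat => m /andP[m0 _].
rewrite rough_prime//; case: (rough y m) => /=; case: (y.+1 %| m)%N => /=;
  by rewrite ?addr0 ?add0r.
Qed.

Definition ccvg (u : nat -> R[i]) l := forall e, 0 < e ->
  exists N, forall n, (N <= n)%N -> cabs (u n - l) <= e.

Definition eprod s y : R[i] := \prod_(1 <= p < y.+1 | prime p) (1 - natpow p (- s)).

Lemma eprodS s y : eprod s y.+1 =
  eprod s y * (if prime y.+1 then 1 - natpow y.+1 (- s) else 1).
Proof. by rewrite /eprod big_mkcond big_nat_recr//= -big_mkcond. Qed.

Lemma cabs_natpow_lt1 n s : 0 < Re s -> (0 < n)%N -> cabs (natpow n (- s)) <= 1.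
Proof.
move=> s0 n0; rewrite cabs_natpow ReN -[leRHS]expR0 ler_expR mulNr oppr_le0.
by rewrite mulr_ge0 ?ln_ge0 ?ler1n// ltW.
Qed.

Hypothesis RH : riemann_hypothesis R.

(** The Euler product by sieving: each prime struck out of the Dirichlet series multiplies its sum
    by 1 - p^(-s). *)
Lemma rsum_cvg s y : 1 < Re s -> ccvg (rsum s y) (zeta s * eprod s y).
Proof.
move=> s1; elim: y => [|y IH].
  move=> e e0; have [N HN] := zeta_series RH s1 e0; exists N => n Nn.
  rewrite /eprod big_geq// mulr1 /rsum (eq_bigl xpredT) ?big_add1 ?HN//.
  by move=> m; rewrite rough0.
rewrite eprodS; case: ifPn => py; last first.
  by rewrite mulr1 => e /IH[N HN]; exists N => n /HN; rewrite /rsum (eq_bigl _ _ (fun m => rough_nonprime m py)).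
move=> e e0; have e2 : 0 < e / 2 by rewrite divr_gt0.
have [N HN] := IH _ e2; exists (N * y.+1)%N => n Nn.
rewrite rsum_step//.
have -> : rsum s y n - natpow y.+1 (- s) * rsum s y (n %/ y.+1) -
    zeta s * (eprod s y * (1 - natpow y.+1 (- s))) =
  (rsum s y n - zeta s * eprod s y) -
  natpow y.+1 (- s) * (rsum s y (n %/ y.+1) - zeta s * eprod s y) by ring.
rewrite (le_trans (cabsB _ _))// (splitr e) lerD//.
  by apply: HN; rewrite (leq_trans _ Nn)// leq_pmulr.
rewrite cabsM -[leRHS]mul1r ler_pM ?cabs_ge0//.
  by apply: cabs_natpow_lt1 => //; lra.
by apply: HN; rewrite leq_divRL.
Qed.

(** A (y + 1)-rough number other than 1 exceeds y + 1, so what remains is part of a tail of the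
    series of n^(-1-a). *)
Lemma rsum_near1 s y n a : 0 < a -> Re s = 1 + a -> (0 < n)%N ->
  cabs (rsum s y.+1 n - 1) <= expR (- a * ln y.+1%:R) / a.
Proof.
move=> a0 sa n0.
have -> : rsum s y.+1 n - 1 = \sum_(2 <= m < n.+1 | rough y.+1 m) natpow m (- s).
  by rewrite /rsum big_ltn_cond// natpow1; have -> : rough y.+1 1 by []; rewrite addrC addKr.
apply: (le_trans (cabs_sum _ _ _)).
apply: (@le_trans _ _ (\sum_(y.+2 <= m < y.+2 + n.+1) expR (- (1 + a) * ln (m%:R : R)))).
  apply: (@le_trans _ _ (\sum_(y.+2 <= m < n.+1 | rough y.+1 m) cabs (natpow m (- s) : R[i]))).
    rewrite [leLHS]big_mkcond [leRHS]big_mkcond.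
    have [yn|ny] := leqP y.+2 n.+1; last first.
      rewrite big1_seq; first by apply: sumr_ge0 => m _; case: ifP => // _; exact: cabs_ge0.
      move=> m /andP[_]; rewrite mem_index_iota => /andP[m2 mn].
      case: ifP => // rm; have := rough_gt m2 rm; lia.
    rewrite (@sum_nat_drop _ _ y.+2); [exact: lexx|lia|] => m /andP[m2 my].
    case: ifP => // rm; have := rough_gt m2 rm; lia.
  apply: (@le_trans _ _ (\sum_(y.+2 <= m < n.+1) expR (- (1 + a) * ln (m%:R : R)))).
    rewrite big_mkcond; apply: ler_sum => m _.
    by case: ifP; rewrite ?expR_ge0// cabs_natpow ReN sa.
  have [yn|ny] := leqP y.+2 n.+1; last by rewrite big_geq ?sumr_ge0 1?ltnW// => m _; exact: expR_ge0.
  rewrite [leRHS](@big_cat_nat _ _ _ n.+1)//=; last by lia.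
  by rewrite lerDl sumr_ge0// => m _; exact: expR_ge0.
by rewrite !big_add1; exact: power_sum_le a0 (leq_addr n.+1 y).
Qed.

Lemma euler_product s y a : 0 < a -> Re s = 1 + a ->
  cabs (zeta s * eprod s y.+1 - 1) <= expR (- a * ln y.+1%:R) / a.
Proof.
move=> a0 sa; apply/ler_addgt0Pr => e e0.
have s1 : 1 < Re s by lra.
have [N HN] := rsum_cvg y.+1 s1 e0.
have := HN N.+1 (leqnSn N); rewrite cabsBC => h1.
have h2 := rsum_near1 y a0 sa (ltn0Sn N).
have -> : zeta s * eprod s y.+1 - 1 = (zeta s * eprod s y.+1 - rsum s y.+1 N.+1)
  + (rsum s y.+1 N.+1 - 1) by ring.
by rewrite (le_trans (cabsD _ _))// addrC lerD.
Qed.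

Lemma zeta_neq0_right s : 1 < Re s -> zeta s != 0.
Proof.
move=> s1; pose a := Re s - 1.
have a0 : 0 < a by rewrite subr_gt0.
have a2 : 0 < a / 2 by rewrite divr_gt0.
have [N HN] := exp_ln_small a0 a2.
have := @euler_product s N a a0; have -> : Re s = 1 + a by rewrite /a; ring.
move=> /(_ erefl) h; apply: contraTneq h => ->.
rewrite mul0r sub0r cabsN cabs1 -ltNge ltr_pdivrMr// mul1r.
by rewrite (le_lt_trans (HN _ (leqnn N)))// ltr_pdivrMr//; lra.
Qed.

(** Truncation of the series of -log(1 - z). *)
Definition Lam J z : R[i] := \sum_(0 <= j < J) z ^+ j.+1 / j.+1%:R.

Lemma cdiff_Lam J z : cdiff (Lam J) z (\sum_(0 <= j < J) z ^+ j).
Proof.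
apply: cdiff_sum => j.
apply: (cdiff_exteq (cdiffZ (j.+1%:R)^-1 (cdiffX j.+1 z))) => [w|].
  by rewrite mulrC.
by rewrite /= mulKf// pnatr_eq0.
Qed.

Lemma Lam_bound J z : cabs z <= 2^-1 -> cabs (Lam J z) <= 2 * cabs z.
Proof.
move=> z2; have c0 := cabs_ge0 z.
apply: (@le_trans _ _ (\sum_(0 <= j < J) cabs z * 2^-1 ^+ j)).
  apply: (le_trans (cabs_sum _ _ _)); apply: ler_sum => j _.
  rewrite cabsM cabsX exprS cabsV -mulrA ler_wpM2l//.
  have -> : cabs (j.+1%:R : R[i]) = j.+1%:R.
    by rewrite -(rmorph_nat (real_complex R)) cabs_real ger0_norm.
  rewrite -[leRHS]mulr1 ler_pM ?exprn_ge0 ?invr_ge0//.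
    by rewrite lerXn2r ?nnegrE ?invr_ge0.
  by rewrite invf_le1 ?ltr0n// ler1n.
rewrite -mulr_sumr mulrC ler_wpM2r//.
suff : \sum_(0 <= j < J) 2^-1 ^+ j = 2 - 2 * 2^-1 ^+ J :> R.
  by move=> ->; rewrite gerBl mulr_ge0 ?exprn_ge0 ?invr_ge0.
elim: J => [|J IH]; first by rewrite big_geq// expr0; ring.
by rewrite big_nat_recr//= IH exprS; field.
Qed.

(** The derivative of exp(Lam w) (1 - w) collapses to -exp(Lam w) w^J, because Lam' is a geometric
    sum; it remains to integrate from 0 to z. *)
Lemma exp_Lam J z : cabs z <= 2^-1 ->
  cabs (cexp (Lam J z) * (1 - z) - 1) <= 2 * expR 1 * cabs z ^+ J.+1.
Proof.
move=> z2; have c0 := cabs_ge0 z.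
pose Phi w := cexp (Lam J w) * (1 - w).
have dPhi w : cdiff Phi w (- (cexp (Lam J w) * w ^+ J)).
  apply: (cdiff_exteq (cdiffM (cdiff_cexp_comp (cdiff_Lam J w))
    (cdiffB (cdiff_cst 1 w) (cdiff_id w)))) => // ; rewrite /=.
  have HS : (\sum_(0 <= j < J) w ^+ j) * (1 - w) = 1 - w ^+ J.
    by rewrite big_mkord -[RHS]opprB subrX1 -mulNr opprB mulrC.
  by rewrite -mulrA HS; ring.
have lin t : pdiff (fun r : R => Phi (0 + r%:C * z)) t (- (cexp (Lam J (0 + t%:C * z)) * (0 + t%:C * z) ^+ J) * z).
  exact: pdiff_line.
have cP w : ccont (fun w => - (cexp (Lam J w) * w ^+ J)) w.
  apply: cdiff_cont; apply: cdiffN; apply: cdiffM (cdiffX J w).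
  exact: cdiff_cexp_comp (cdiff_Lam J w).
have cp : pcont_on 0 1 (fun t => - (cexp (Lam J (0 + t%:C * z)) * (0 + t%:C * z) ^+ J) * z).
  by move=> t _; apply: pcontM (pcont_cst _ _); exact: (pcont_line (cP _)).
have := cint_FTC (ler01 : 0 <= 1 :> R) cp (fun t _ => lin t).
have -> : 0 + (1 : R)%:C * z = z by rewrite rmorph1 mul1r add0r.
have -> : 0 + (0 : R)%:C * z = 0 by rewrite rmorph0 mul0r addr0.
rewrite /Phi.
have -> : Lam J 0 = 0 by rewrite /Lam big1// => j _; rewrite expr0n mul0r.
rewrite cexp0 subr0 mulr1 => <-.
apply: (le_trans (cint_bound (ler01 : 0 <= 1 :> R) cp (M := expR 1 * cabs z ^+ J.+1) _)).
  move=> t /andP[t0 t1]; rewrite cabsM cabsN cabsM cabsX exprSr mulrA.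
  have tz : cabs (0 + t%:C * z) <= cabs z.
    by rewrite add0r cabsM cabs_real ger0_norm// ler_piMl.
  rewrite ler_wpM2r// ler_pM ?cabs_ge0 ?exprn_ge0 ?cabs_ge0//.
    rewrite cabs_cexp ler_expR (le_trans (ler_norm _))//.
    rewrite (le_trans (Re_le_cabs _))// (le_trans (Lam_bound _ _)) ?(le_trans tz)//.
    lra.
  by rewrite lerXn2r ?nnegrE ?cabs_ge0.
by rewrite subr0 mulr1 mulrA.
Qed.

End EulerProduct.

(** * Finite logarithms of zeta and the 3-4-1 inequality *)

Section ZetaOneLine.
Context {R : realType}.
Implicit Types (s w z : R[i]) (x a t e : R) (m n p q y : nat).

(** A finite stand-in for log zeta(s): primes up to Y, exponents up to J. It is entire and involves
    no choice of a branch. *)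
Definition Lsum Y J s : R[i] :=
  \sum_(1 <= p < Y.+1 | prime p) Lam J (natpow p (- s)).

Lemma natpow_prime_half p s : prime p -> 1 <= Re s ->
  cabs (natpow p (- s)) <= 2^-1.
Proof.
move=> /prime_gt1 p1 s1; rewrite cabs_natpow ReN mulNr expRN.
rewrite lef_pV2 ?posrE ?expR_gt0//.
have l2 : 0 <= ln (p%:R : R) by rewrite ln_ge0// ler1n ltnW.
apply: (@le_trans _ _ (p%:R)); first by rewrite ler_nat.
rewrite -[leLHS]lnK ?posrE ?ltr0n 1?ltnW// ler_expR.
by rewrite ler_peMl.
Qed.

Lemma prod_near1 (I : eqType) (r : seq I) (P : pred I) (F : I -> R[i]) c :
  (forall i, P i -> cabs (F i - 1) <= c) -> 0 <= c ->
  cabs (\prod_(i <- r | P i) F i - 1) <= expR (c * (size r)%:R) - 1.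
Proof.
move=> H c0; elim: r => [|i r IH].
  by rewrite big_nil subrr cabs0 mulr0 expR0 subrr.
have e1 : 1 <= expR c by rewrite -[leLHS]expR0 ler_expR.
have cn : 0 <= c * (size r)%:R by rewrite mulr_ge0.
have en : 1 <= expR (c * (size r)%:R) by rewrite -[leLHS]expR0 ler_expR.
rewrite big_cons /= -natr1 mulrDr mulr1 expRD; case: ifP => Pi; last first.
  by rewrite (le_trans IH)// lerD2r ler_peMr// expR_ge0.
set X := \prod_(j <- r | P j) F j in IH *.
have -> : F i * X - 1 = (F i - 1) * (X - 1) + (F i - 1) + (X - 1) by ring.
rewrite (le_trans (cabsD _ _))// (le_trans (lerD (cabsD _ _) (lexx _)))// cabsM.
have h : cabs (F i - 1) <= expR c - 1.
  by rewrite (le_trans (H i Pi))// lerBrDl expR_ge1Dx.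
have A0 := cabs_ge0 (F i - 1); have B0 := cabs_ge0 (X - 1).
have : (1 + cabs (F i - 1)) * (1 + cabs (X - 1)) <= expR c * expR (c * (size r)%:R).
  by apply: ler_pM; lra.
lra.
Qed.

Lemma cexp_Lsum Y J s : cexp (Lsum Y J s) =
  \prod_(1 <= p < Y.+1 | prime p) cexp (Lam J (natpow p (- s))).
Proof. exact: cexp_sum. Qed.

Lemma Lsum_eprod Y e : 0 < e -> exists J0 : nat, forall J, (J0 <= J)%N ->
  forall s, 1 <= Re s -> cabs (cexp (Lsum Y J s) * eprod s Y - 1) <= e.
Proof.
move=> e0; pose l := ln (1 + e).
have l0 : 0 < l by rewrite ln_gt0//; lra.
pose K := 2 * expR 1 * Y%:R / l : R.
have K0 : 0 <= K by rewrite /K divr_ge0 ?(ltW l0)// !mulr_ge0 ?expR_ge0.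
have := archi_boundP K0; set J0 := Num.bound _ => HJ.
exists J0 => J JJ s s1.
rewrite cexp_Lsum /eprod -big_split /=.
pose c : R := 2 * expR 1 * 2^-1 ^+ J.+1.
have c0 : 0 <= c by rewrite !mulr_ge0 ?expR_ge0 ?exprn_ge0 ?invr_ge0.
apply: (le_trans (@prod_near1 _ _ _ _ c _ c0)).
  move=> p pp; have h := natpow_prime_half pp s1.
  apply: (le_trans (exp_Lam J h)).
  rewrite ler_wpM2l ?mulr_ge0 ?expR_ge0// lerXn2r ?nnegrE ?cabs_ge0 ?invr_ge0//.
rewrite size_iota subn1 /= lerBlDl -[leRHS]lnK ?posrE ?addr_gt0// ler_expR -/l.
rewrite /c exprVn mulrAC ler_pdivrMr ?exprn_gt0//.
have : K <= 2 ^+ J.+1.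
  rewrite (le_trans (ltW HJ))// -natrX ler_nat.
  by rewrite (leq_trans JJ)// (leq_trans (leqnSn _))// ltnW// ltn_expl.
by rewrite /K ler_pdivrMr// [in X in _ -> X](mulrC l).
Qed.

Hypothesis RH : riemann_hypothesis R.

(** Two truncations in this order: Y makes the Euler product accurate on the whole line Re s = 1 +
    a, and then J, depending on Y, makes the logarithms of its finitely many factors accurate. The
    uniformity in Im s is what the approximation along a segment of Re s = 2 relies on. *)
Lemma Lsum_approx a e : 0 < a -> 0 < e -> exists Y0, forall Y, (Y0 <= Y)%N ->
  exists J0, forall J, (J0 <= J)%N -> forall s, Re s = 1 + a ->
  cabs (zeta s * cexp (- Lsum Y J s) - 1) <= e.
Proof.
move=> a0 e0; pose d := Num.min e 1 / 4.
have [d0 de d1] : [/\ 0 < d, d <= e / 4 & d <= 1 / 4].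
  split; first by rewrite divr_gt0// lt_min e0 ltr01.
    by rewrite ler_wpM2r// ge_min lexx.
  by rewrite ler_wpM2r// ge_min lexx orbT.
have da : 0 < d * a by rewrite mulr_gt0.
have [N HN] := exp_ln_small a0 da.
exists N.+1 => -[//|Y] NY; have [J0 HJ] := Lsum_eprod Y.+1 d0.
exists J0 => J JJ s sa; have s1 : 1 <= Re s by lra.
have h1 := HJ J JJ s s1.
have h2 : cabs (zeta s * eprod s Y.+1 - 1) <= d.
  by rewrite (le_trans (euler_product RH Y a0 sa))// ler_pdivrMr// HN.
rewrite cexpN; set E := cexp _ in h1 *; set P := eprod _ _ in h1 h2.
have E0 : E != 0 := cexp_neq0 _.
have P0 : P != 0.
  by apply: contraTneq h1 => ->; rewrite mulr0 sub0r cabsN cabs1 -ltNge; lra.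
have -> : zeta s / E - 1 = ((zeta s * P - 1) - (E * P - 1)) / (E * P).
  by field; rewrite E0 P0.
have h3 : 3 / 4 <= cabs (E * P).
  have := cabsB_ge 1 (1 - E * P); rewrite cabs1 subKr (cabsBC 1); lra.
rewrite cabsM cabsV ler_pdivrMr; last lra.
rewrite (le_trans (cabsB _ _))// (le_trans (lerD h2 h1))//.
have : e * (3 / 4) <= e * cabs (E * P) by rewrite ler_pM2l.
by lra.
Qed.

Lemma Re_Lam J (x y : R) : Re (Lam J (cexp (x +i* y))) =
  \sum_(0 <= j < J) expR x ^+ j.+1 / j.+1%:R * cos (y *+ j.+1).
Proof.
rewrite /Lam Re_sum; apply: eq_bigr => j _.
have -> : cexp (x +i* y) ^+ j.+1 = cexp ((x +i* y) *+ j.+1).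
  elim: j.+1 => [|k IH]; first by rewrite expr0 mulr0n cexp0.
  by rewrite exprS mulrS cexpD IH.
have ReMn k : Re ((x +i* y) *+ k) = x *+ k.
  by elim: k => [//|k IH]; rewrite !mulrS ReD IH.
have ImMn k : Im ((x +i* y) *+ k) = y *+ k.
  by elim: k => [//|k IH]; rewrite !mulrS ImD IH.
have -> : (j.+1%:R : R[i])^-1 = (j.+1%:R^-1)%:C.
  by rewrite real_complexV (rmorph_nat (real_complex R)).
rewrite ReMr /cexp /= ReMn ImMn; have -> : expR (x *+ j.+1) = expR x ^+ j.+1.
  by rewrite -expRM_natl mulr_natl.
by rewrite mulrAC.
Qed.

Let lin341 (I : Type) (r : seq I) (P : pred I) (f g h : I -> R) :
  3 * \sum_(i <- r | P i) f i + 4 * \sum_(i <- r | P i) g i + \sum_(i <- r | P i) h i =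
  \sum_(i <- r | P i) (3 * f i + 4 * g i + h i).
Proof. by rewrite !big_split !mulr_sumr. Qed.

(** The identity 3 + 4 cos v + cos 2v = 2 (1 + cos v)^2, applied to every power of z. *)
Lemma Re_Lam_341 J (r v : R) :
  0 <= 3 * Re (Lam J (cexp (r +i* 0))) + 4 * Re (Lam J (cexp (r +i* v)))
    + Re (Lam J (cexp (r +i* (v *+ 2)))).
Proof.
rewrite [X in 3 * X]Re_Lam [X in 4 * X]Re_Lam [X in _ + X]Re_Lam lin341; apply: sumr_ge0 => j _ /=.
have u0 : 0 <= expR r ^+ j.+1 / j.+1%:R by rewrite divr_ge0// exprn_ge0// expR_ge0.
rewrite mul0rn cos0 -mulrnA mulnC mulrnA mulr2n cosD -!expr2 sin2cos2.
move: (cos _) (expR r ^+ _ / _) u0 => c u u0.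
have -> : 3 * (u * 1) + 4 * (u * c) + u * (c ^+ 2 - (1 - c ^+ 2)) = 2 * u * (1 + c) ^+ 2 by ring.
by rewrite mulr_ge0 ?sqr_ge0// mulr_ge0.
Qed.

Lemma Lsum_341 Y J a t :
  0 <= 3 * Re (Lsum Y J ((1 + a) +i* 0)) + 4 * Re (Lsum Y J ((1 + a) +i* t))
    + Re (Lsum Y J ((1 + a) +i* (t *+ 2))).
Proof.
have E v : Re (Lsum Y J ((1 + a) +i* v)) = \sum_(1 <= p < Y.+1 | prime p)
    Re (Lam J (cexp ((- (1 + a) * ln p%:R) +i* (- v * ln p%:R)))).
  rewrite Re_sum; apply: eq_bigr => p _; congr (Re (Lam J (cexp _))).
  by apply: complex_eq; rewrite ?ReMr ?ImMr ?ReN ?ImN.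
rewrite [X in 3 * X]E [X in 4 * X]E [X in _ + X]E lin341; apply: sumr_ge0 => p _.
have := Re_Lam_341 J (- (1 + a) * ln p%:R) (- t * ln p%:R).
by rewrite -mulrnAl -mulNrn oppr0 mul0r.
Qed.

Let exp_341 (d e L1 L2 L3 z1 z2 z3 : R) : d <= 2^-1 -> 8 * d <= e ->
  0 <= 3 * L1 + 4 * L2 + L3 -> (1 - d) * expR L1 <= z1 -> (1 - d) * expR L2 <= z2 ->
  (1 - d) * expR L3 <= z3 -> 1 <= z1 ^+ 3 * z2 ^+ 4 * z3 + e.
Proof.
move=> d1 d8 HL h1 h2 h3.
have d2 : 0 <= 1 - d.
  have h : (2^-1 : R) <= 1 by rewrite invf_le1// ler1n.
  by rewrite subr_ge0 (le_trans d1).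
have p1 : 0 <= (1 - d) * expR L1 by rewrite mulr_ge0// expR_ge0.
have p2 : 0 <= (1 - d) * expR L2 by rewrite mulr_ge0// expR_ge0.
have p3 : 0 <= (1 - d) * expR L3 by rewrite mulr_ge0// expR_ge0.
have P : ((1 - d) * expR L1) ^+ 3 * ((1 - d) * expR L2) ^+ 4 * ((1 - d) * expR L3)
    <= z1 ^+ 3 * z2 ^+ 4 * z3.
  apply: ler_pM => //; first by rewrite mulr_ge0 ?exprn_ge0.
  have q1 := le_trans p1 h1; have q2 := le_trans p2 h2.
  by apply: ler_pM; rewrite ?exprn_ge0// lerXn2r ?nnegrE.
rewrite -lerBlDr (le_trans _ P)//.
have -> : ((1 - d) * expR L1) ^+ 3 * ((1 - d) * expR L2) ^+ 4 * ((1 - d) * expR L3) =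
   (1 - d) ^+ 8 * (expR L1 ^+ 3 * expR L2 ^+ 4 * expR L3) by ring.
have E : 1 <= expR L1 ^+ 3 * expR L2 ^+ 4 * expR L3.
  rewrite -!expRM_natl -!expRD -[leLHS]expR0 ler_expR; lra.
have B n : 1 - n%:R * d <= (1 - d) ^+ n.
  elim: n => [|n IH]; first by rewrite mul0r subr0.
  rewrite exprS -natr1; have : 0 <= n%:R * d ^+ 2 by rewrite mulr_ge0 ?sqr_ge0.
  have : (1 - d) * (1 - n%:R * d) <= (1 - d) * (1 - d) ^+ n by rewrite ler_wpM2l.
  lra.
have := B 8%N; have : (1 - d) ^+ 8 <= (1 - d) ^+ 8 * (expR L1 ^+ 3 * expR L2 ^+ 4 * expR L3).
  by rewrite ler_peMr// exprn_ge0.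
lra.
Qed.

Lemma zeta_341 a t : 0 < a ->
  1 <= cabs (zeta ((1 + a) +i* 0)) ^+ 3 * cabs (zeta ((1 + a) +i* t)) ^+ 4
     * cabs (zeta ((1 + a) +i* (t *+ 2))).
Proof.
move=> a0; apply/ler_addgt0Pr => e e0.
pose d := Num.min (e / 8) 2^-1.
have d0 : 0 < d by rewrite lt_min divr_gt0//= invr_gt0.
have d1 : d <= 2^-1 by rewrite ge_min lexx orbT.
have d8 : 8 * d <= e by rewrite mulrC -ler_pdivlMr// ge_min lexx.
have [Y0 HY] := Lsum_approx a0 d0; have [J0 HJ] := HY _ (leqnn _).
have low s : Re s = 1 + a -> (1 - d) * expR (Re (Lsum Y0 J0 s)) <= cabs (zeta s).
  move=> sa; have h := HJ _ (leqnn _) s sa.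
  have := cabsB_ge 1 (1 - zeta s * cexp (- Lsum Y0 J0 s)).
  rewrite cabs1 subKr (cabsBC 1) [X in _ <= X -> _]cabsM cabs_cexp ReN expRN => h2.
  rewrite -ler_pdivlMr ?expR_gt0//; lra.
exact: exp_341 d1 d8 (Lsum_341 Y0 J0 a t) (low (_ +i* 0) erefl)
  (low (_ +i* t) erefl) (low (_ +i* (t *+ 2)) erefl).
Qed.

End ZetaOneLine.

(** * Nonvanishing to the right of the critical line, and an upper bound by primes *)

Section ZetaNonvanishing.
Context {R : realType}.
Implicit Types (s w z : R[i]) (x a t e : R) (m n p q y : nat).

Hypothesis RH : riemann_hypothesis R.

Lemma natpow_real n x : natpow n (x +i* 0) = (expR (x * ln n%:R))%:C :> R[i].
Proof. by rewrite /natpow -cexp_real; congr cexp; apply: complex_eq => /=; ring. Qed.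

Lemma zeta_real_le a : 0 < a -> cabs (zeta ((1 + a) +i* 0)) <= 1 + a^-1.
Proof.
move=> a0; apply/ler_addgt0Pr => e e0.
have s1 : 1 < Re ((1 + a) +i* 0) by rewrite /=; lra.
have [N HN] := zeta_series RH s1 e0; have := HN N.+1 (leqnSn N).
set S := \sum_(_ <= _ < _) _ => h.
have -> : zeta ((1 + a) +i* 0) = S - (S - zeta ((1 + a) +i* 0)) by ring.
rewrite (le_trans (cabsB _ _))// lerD//.
apply: (le_trans (cabs_sum _ _ _)); rewrite big_nat_recl// natpow1 cabs1 lerD2l.
have := power_sum_le a0 (leq0n N); rewrite ln1 mulr0 expR0 mul1r.
by apply: le_trans; apply: ler_sum => k _; rewrite cabs_natpow.
Qed.

Lemma zeta_real_ge a : 0 < a -> a^-1 <= cabs (zeta ((1 + a) +i* 0)).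
Proof.
move=> a0; apply/ler_addgt0Pr => e e0.
have s1 : 1 < Re ((1 + a) +i* 0) by rewrite /=; lra.
have e2 : 0 < e / 2 by rewrite divr_gt0.
have ea : 0 < a * (e / 2) by rewrite mulr_gt0.
have [N1 H1] := zeta_series RH s1 e2; have [N2 H2] := exp_ln_small a0 ea.
pose N := maxn N1 N2; have := H1 N (leq_maxl _ _).
set S := \sum_(_ <= _ < _) _ => h.
have SE : S = (\sum_(0 <= k < N) expR (- (1 + a) * ln (k.+1%:R : R)))%:C.
  rewrite /S (rmorph_sum (real_complex R)); apply: eq_bigr => k _.
  have -> : - ((1 + a) +i* 0) = - (1 + a) +i* 0 :> R[i].
    by apply: complex_eq; rewrite //= oppr0.
  exact: natpow_real.
have hS : a^-1 - e / 2 <= cabs S.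
  rewrite SE cabs_real (le_trans _ (ler_norm _))// (le_trans _ (power_sum_ge N a0))//.
  rewrite ler_pdivlMr// mulrBl mulVf ?gt_eqF// lerD2l lerN2 (mulrC (e / 2)).
  by apply: H2; exact: leq_maxr.
have := cabsB_ge S (S - zeta ((1 + a) +i* 0)); rewrite subKr; lra.
Qed.

(** A zero at 1 + it would bound the 3-4-1 product by (2/a)^3 (A a)^4 M = K a for small a: a zero
    taken four times beats a pole taken three times. *)
Lemma zeta_line1_neq0 t : t != 0 -> zeta (1 +i* t) != 0.
Proof.
move=> t0; apply/negP => /eqP z0.
have neq1 (u : R) : u != 0 -> 1 +i* u != 1 :> R[i].
  by move=> /eqP u0; apply/eqP => /(congr1 (@complex.Im R)) /=.
have [l dz] := zeta_cdiffable RH (neq1 _ t0).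
have t2 : t *+ 2 != 0 by rewrite mulrn_eq0.
have [l2 /cdiff_cont cz] := zeta_cdiffable RH (neq1 _ t2).
have [d1 d10 H1] := dz 1 ltr01; have [d2 d20 H2] := cz 1 ltr01.
pose A := cabs l + 1; pose M := cabs (zeta (1 +i* (t *+ 2))) + 1.
have A0 : 0 < A by rewrite ltr_wpDl ?cabs_ge0.
have M0 : 0 < M by rewrite ltr_wpDl ?cabs_ge0.
pose K := 8 * A ^+ 4 * M.
have K0 : 0 < K by rewrite mulr_gt0// mulr_gt0// exprn_gt0.
pose a := Num.min (Num.min (d1 / 2) (d2 / 2)) (Num.min 1 (K^-1 / 2)).
have a0 : 0 < a by rewrite !lt_min !divr_gt0 ?invr_gt0 ?ltr01.
have [a1 a2 a3 a4] : [/\ a <= d1 / 2, a <= d2 / 2, a <= 1 & a <= K^-1 / 2].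
  by have := lexx a; rewrite {2}/a !le_min => /andP[/andP[-> ->] /andP[-> ->]].
have aE u : (1 + a) +i* u = 1 +i* u + a%:C by apply: complex_eq => /=; ring.
have ca : cabs a%:C = a by rewrite cabs_real gtr0_norm.
have ha1 : cabs a%:C < d1 by rewrite ca; lra.
have ha2 : cabs a%:C < d2 by rewrite ca; lra.
have h1 := zeta_341 RH t a0.
have z1 := zeta_real_le a0.
have z2 : cabs (zeta ((1 + a) +i* t)) <= A * a.
  have := H1 _ ha1; rewrite -aE z0 subr0 ca => h.
  have -> : zeta ((1 + a) +i* t) = (zeta ((1 + a) +i* t) - l * a%:C) + l * a%:C by ring.
  by rewrite (le_trans (cabsD _ _))// cabsM ca /A; lra.
have z3 : cabs (zeta ((1 + a) +i* (t *+ 2))) <= M.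
  have := H2 _ ha2; rewrite -aE => h.
  rewrite -[X in cabs X](subrK (zeta (1 +i* (t *+ 2)))) (le_trans (cabsD _ _))//.
  by rewrite /M addrC lerD2l.
have z1' : cabs (zeta ((1 + a) +i* 0)) <= 2 / a.
  rewrite (le_trans z1)// ler_pdivlMr// mulrDl mulVf ?gt_eqF//; lra.
have : 1 <= (2 / a) ^+ 3 * (A * a) ^+ 4 * M.
  apply: (le_trans h1); have p1 := cabs_ge0 (zeta ((1 + a) +i* 0)).
  have p2 := cabs_ge0 (zeta ((1 + a) +i* t)).
  apply: ler_pM; rewrite ?mulr_ge0 ?exprn_ge0 ?cabs_ge0//.
  apply: ler_pM; rewrite ?exprn_ge0// lerXn2r ?nnegrE//.
    by rewrite (le_trans p1).
  by rewrite (le_trans p2).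
have -> : (2 / a) ^+ 3 * (A * a) ^+ 4 * M = K * a.
  by rewrite /K; field; rewrite gt_eqF.
apply/negP; rewrite -ltNge mulrC -ltr_pdivlMr// div1r (le_lt_trans a4)//.
by rewrite ltr_pdivrMr// ltr_pMr ?invr_gt0// ltr1n.
Qed.

Lemma zeta_neq0_RH s : 2^-1 < Re s -> Im s != 0 -> zeta s != 0.
Proof.
case: s => x t /= x2 t0; have [x1|x1|->] := ltgtP x 1.
- apply/negP => /eqP z0; have h : 0 < 2^-1 :> R by rewrite invr_gt0.
  have := RH (s := x +i* t) (lt_trans h x2) x1 z0 => /= E.
  by move: x2; rewrite E ltxx.
- exact: zeta_neq0_right.
- exact: zeta_line1_neq0.
Qed.

Lemma Lam_sub J z : (0 < J)%N -> cabs z <= 2^-1 -> cabs (Lam J z - z) <= cabs z ^+ 2.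
Proof.
case: J => // J _ z2; have c0 := cabs_ge0 z.
have -> : Lam J.+1 z - z = \sum_(0 <= j < J) z ^+ j.+2 / j.+2%:R.
  by rewrite /Lam big_nat_recl// expr1 divr1 addrC addKr.
apply: (@le_trans _ _ (\sum_(0 <= j < J) cabs z ^+ 2 / 2 * 2^-1 ^+ j)).
  apply: (le_trans (cabs_sum _ _ _)); apply: ler_sum => j _.
  have -> : z ^+ j.+2 = z ^+ 2 * z ^+ j by rewrite -exprD.
  rewrite cabsM cabsM !cabsX cabsV.
  have -> : cabs (j.+2%:R : R[i]) = j.+2%:R.
    by rewrite -(rmorph_nat (real_complex R)) cabs_real ger0_norm.
  rewrite mulrAC; apply: ler_pM; rewrite ?mulr_ge0 ?exprn_ge0 ?invr_ge0//.
    by rewrite ler_wpM2l ?exprn_ge0// lef_pV2 ?posrE ?ltr0n// ler_nat.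
  by rewrite lerXn2r ?nnegrE ?invr_ge0.
rewrite -mulr_sumr.
have -> : \sum_(0 <= j < J) 2^-1 ^+ j = 2 - 2 * 2^-1 ^+ J :> R.
  elim: J => [|J IH]; first by rewrite big_geq// expr0; ring.
  by rewrite big_nat_recr//= IH exprS; field.
have : 0 <= 2^-1 ^+ J :> R by rewrite exprn_ge0// invr_ge0.
have := sqr_ge0 (cabs z); nra.
Qed.

Lemma sum_prime_squares s Y : 1 <= Re s ->
  \sum_(1 <= p < Y.+1 | prime p) cabs (natpow p (- s)) ^+ 2 <= 1.
Proof.
move=> s1; have := power_sum_le (@ltr01 R) (leq0n Y); rewrite ln1 mulr0 expR0 mul1r invr1.
apply: le_trans.
apply: (@le_trans _ _ (\sum_(2 <= p < Y.+2) expR (- (1 + 1) * ln (p%:R : R)))); last first.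
  by rewrite !big_add1.
apply: (@le_trans _ _ (\sum_(2 <= p < Y.+1) expR (- (1 + 1) * ln (p%:R : R)))); last first.
  case: Y => [|Y]; first by rewrite !big_geq.
  by rewrite [leRHS](big_nat_recr (Y.+2))//= lerDl expR_ge0.
case: Y => [|Y]; first by rewrite !big_geq.
rewrite big_ltn_cond// big_mkcond; apply: ler_sum_nat => p /andP[p2 _].
case: ifP => _; last exact: expR_ge0.
have l0 : 0 <= ln (p%:R : R) by rewrite ln_ge0// ler1n ltnW.
rewrite cabs_natpow ReN -expRM_natl ler_expR; nra.
Qed.

(** The factor 2 comes from approximating zeta by exp([Lsum]) with relative error 1. The factor e
    accounts for the higher prime powers, which together contribute at most the sum of p^(-2), hence
    at most 1. *)
Lemma zeta_prime_bound s a : 0 < a -> Re s = 1 + a ->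
  exists Y0, forall Y, (Y0 <= Y)%N -> cabs (zeta s) <=
   2 * expR 1 * expR (\sum_(1 <= p < Y.+1 | prime p) Re (natpow p (- s))).
Proof.
move=> a0 sa; have s1 : 1 <= Re s by lra.
have [Y0 HY] := Lsum_approx RH a0 ltr01; exists Y0 => Y YY.
have [J0 HJ] := HY Y YY; have := HJ J0.+1 (leqnSn _) s sa => h.
have h1 : cabs (zeta s) <= 2 * expR (Re (Lsum Y J0.+1 s)).
  rewrite -ler_pdivrMr ?expR_gt0// -expRN -ReN -cabs_cexp -cabsM.
  have -> : zeta s * cexp (- Lsum Y J0.+1 s) = (zeta s * cexp (- Lsum Y J0.+1 s) - 1) + 1 by ring.
  by rewrite (le_trans (cabsD _ _))// cabs1; lra.
rewrite (le_trans h1)// -mulrA ler_wpM2l// -expRD ler_expR.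
rewrite addrC -lerBlDl Re_sum -sumrB.
apply: le_trans (sum_prime_squares Y s1); apply: ler_sum => p pp.
rewrite -ReN -ReD (le_trans (ler_norm _))// (le_trans (Re_le_cabs _))//.
by rewrite Lam_sub// natpow_prime_half.
Qed.

End ZetaNonvanishing.

(** * Logarithms on rectangles *)

Section HolomorphicLog.
Context {R : realType}.
Implicit Types (s w z h : R[i]) (f g : R[i] -> R[i]) (x y t e : R).

(** The principal logarithm on the half-plane Re z > 0, the only place where it is used as such. *)
Definition clog z : R[i] := ln (cabs z) +i* atan (Im z / Re z).

Lemma cexp_clog z : 0 < Re z -> cexp (clog z) = z.
Proof.
move=> x0; have z0 : 0 < cabs z by rewrite (lt_le_trans x0)// (le_trans (ler_norm _))// Re_le_cabs.
have zE : cabs z = Re z * Num.sqrt (1 + (Im z / Re z) ^+ 2).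
  rewrite cabsE -{2}(ger0_norm (ltW x0)) -sqrtr_sqr -sqrtrM ?sqr_ge0//.
  by congr Num.sqrt; field; rewrite gt_eqF.
have q0 : 0 < Num.sqrt (1 + (Im z / Re z) ^+ 2).
  by rewrite sqrtr_gt0 ltr_pwDl// sqr_ge0.
apply: complex_eq => /=; rewrite lnK ?posrE// ?cos_atan zE.
  by rewrite mulfK// gt_eqF.
have -> : sin (atan (Im z / Re z)) = Im z / Re z * cos (atan (Im z / Re z)).
  by rewrite -{2}(atanK (Im z / Re z)) /tan divfK// cos_atan invr_neq0// gt_eqF.
rewrite cos_atan; move: q0; set S := Num.sqrt _ => q0.
by field; rewrite !gt_eqF.
Qed.

Lemma ccont_clog z : 0 < Re z -> ccont clog z.
Proof.
move=> x0 e e0; have e2 : 0 < e / 2 by rewrite divr_gt0.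
have z0 : 0 < cabs z by rewrite (lt_le_trans x0)// (le_trans (ler_norm _))// Re_le_cabs.
have [d1 d10 H1] := (continuous_epsdelta (@ln R) (cabs z)).1 (continuous_ln z0) _ e2.
have [d2 d20 H2] := (continuous_epsdelta (@atan R) (Im z / Re z)).1 (@continuous_atan R _) _ e2.
pose x := Re z; pose y := Im z; pose B := (x + `|y|) / (x * (x / 2)).
have B0 : 0 < B.
  apply: divr_gt0; first by rewrite ltr_pwDl.
  by rewrite mulr_gt0// divr_gt0.
have x2 : 0 < x / 2 by rewrite divr_gt0.
exists (Num.min (Num.min d1 (x / 2)) (d2 / B)).
  by rewrite !lt_min d10 x2 (divr_gt0 d20 B0).
move=> h; rewrite !lt_min => /andP[/andP[h1 h2] h3].
have hR := Re_le_cabs h; have hI := Im_le_cabs h.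
have [hR1 hR2] : - (x / 2) <= Re h /\ Re h <= x / 2.
  by move: hR; rewrite ler_norml => /andP[? ?]; split; lra.
have L1 : `|ln (cabs (z + h)) - ln (cabs z)| <= e / 2.
  have -> : cabs (z + h) = cabs z + (cabs (z + h) - cabs z) by ring.
  apply: H1; apply: le_lt_trans h1; rewrite ler_norml.
  have := cabsD z h; have := cabsB_ge z (- h); rewrite opprK cabsN; lra.
have L2 : `|atan (Im (z + h) / Re (z + h)) - atan (Im z / Re z)| <= e / 2.
  have xh : x / 2 <= Re (z + h) by rewrite ReD -/x; lra.
  have xh0 : 0 < Re (z + h) by rewrite (lt_le_trans _ xh)// divr_gt0.
  set u := Im (z + h) / Re (z + h).
  have -> : u = Im z / Re z + (u - Im z / Re z) by ring.
  apply: H2; rewrite /u.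
  have -> : Im (z + h) / Re (z + h) - Im z / Re z =
     (Im h * x - y * Re h) / (x * Re (z + h)).
    by rewrite ImD -/x -/y; move: xh0; rewrite ReD -/x => q; field; rewrite !gt_eqF.
  rewrite ltr_pdivlMr// in h3; apply: le_lt_trans h3.
  rewrite normrM normfV [X in _ / X]gtr0_norm ?mulr_gt0//.
  have -> : cabs h * B = (cabs h * (x + `|y|)) / (x * (x / 2)) by rewrite [LHS]mulrA.
  apply: ler_pM.
  - exact: normr_ge0.
  - by rewrite invr_ge0 mulr_ge0 // ltW.
  - rewrite (le_trans (ler_normB _ _))// !normrM (gtr0_norm x0) mulrDr.
    rewrite (mulrC (cabs h) `|y|); apply: lerD; first exact: ler_wpM2r (ltW x0) _ _ hI.
    exact: ler_wpM2l (normr_ge0 _) _ _ hR.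
  - by rewrite lef_pV2 ?posrE ?mulr_gt0// ler_pM2l.
rewrite (le_trans (cabs_le_ReIm _))// !ReD !ImD !ReN !ImN /= -?ReD -?ImD.
by rewrite (splitr e) lerD.
Qed.

Lemma cexp_surj z : z != 0 -> exists w, cexp w = z.
Proof.
move=> z0; have [p|] := ltP 0 (Re z); first by exists (clog z); exact: cexp_clog.
rewrite le_eqVlt => /predU1P[r0|n]; last first.
  exists (clog (- z) + (0 +i* pi)); rewrite cexpD cexp_clog ?ReN ?oppr_gt0//.
  have -> : cexp (0 +i* pi) = -1 :> R[i].
    by apply: complex_eq; rewrite /= expR0 ?cospi ?sinpi; ring.
  by rewrite mulrN1 opprK.
have [p|] := ltP 0 (Im z).
  exists (clog (z * (0 +i* -1)) + (0 +i* (pi / 2))).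
  rewrite cexpD cexp_clog; last by rewrite ReM /=; lra.
  have -> : cexp (0 +i* (pi / 2)) = 0 +i* 1 :> R[i].
    by apply: complex_eq; rewrite /= expR0 ?cos_pihalf ?sin_pihalf; ring.
  by apply: complex_eq; rewrite ?ReM ?ImM /= ?ReM ?ImM /=; ring.
rewrite le_eqVlt => /predU1P[i0|n].
  by case/eqP: z0; apply: complex_eq.
exists (clog (z * (0 +i* 1)) - (0 +i* (pi / 2))).
rewrite cexpB cexp_clog; last by rewrite ReM /=; lra.
have -> : cexp (0 +i* (pi / 2)) = 0 +i* 1 :> R[i].
  by apply: complex_eq; rewrite /= expR0 ?cos_pihalf ?sin_pihalf; ring.
rewrite mulfK//; apply/eqP => /(congr1 (@complex.Im R)) /= /eqP.
by rewrite oner_eq0.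
Qed.

(** A continuous logarithm of a differentiable function is differentiable. Continuity makes k = g(z
    + h) - g(z) small; then exp(k) - 1 = (f(z + h) - f(z)) / f(z), and k equals exp(k) - 1 up to a
    small multiple of |k|. *)
Lemma log_cdiffable f g z (r : R) : 0 < r ->
  (forall w, cabs (w - z) < r -> cexp (g w) = f w) -> ccont g z -> cdiffable f z ->
  cdiffable g z.
Proof.
move=> r0 gf cg [l df]; have fz0 : f z != 0.
  by rewrite -gf ?cexp_neq0// subrr cabs0.
have c0 : 0 < cabs (f z) by rewrite cabs_gt0.
exists (l / f z) => e e0.
pose A := (cabs l + 1) / cabs (f z).
have A0 : 0 < A by rewrite divr_gt0// ltr_wpDl ?cabs_ge0.
have [d0 d00 H0] := @cexp_sub1_ge R.
have eA : 0 < e / 2 / (2 * A) by rewrite divr_gt0 ?divr_gt0// mulr_gt0.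
have [d1 d10 H1] := @cdiff_cexp0 R _ eA.
have ef : 0 < e / 2 * cabs (f z) by rewrite mulr_gt0// divr_gt0.
have [d2 d20 H2] := df _ ef; have [d4 d40 H4] := df _ ltr01.
have m0 : 0 < Num.min d0 d1 / 2 by rewrite divr_gt0// lt_min d00.
have [d3 d30 H3] := cg _ m0.
exists (Num.min (Num.min d2 d3) (Num.min d4 r)); first by rewrite !lt_min d20 d30 d40.
move=> h; rewrite !lt_min => /andP[/andP[/H2 h2 /H3 h3] /andP[/H4 h4 hr]].
set k := g (z + h) - g z in h3 *.
have km : cabs k < Num.min d0 d1 by rewrite (le_lt_trans h3)// ltr_pdivrMr// ltr_pMr ?ltr1n ?lt_min ?d00.
move: km; rewrite lt_min => /andP[/H0 k0 /H1].
rewrite add0r cexp0 mul1r => k1.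
have Ek : cexp k - 1 = (f (z + h) - f z) / f z.
  have zr : cabs (z + h - z) < r by have -> : z + h - z = h by ring.
  rewrite /k cexpB !gf ?subrr ?cabs0//; first by field.
have kA : cabs k <= 2 * A * cabs h.
  have : cabs (cexp k - 1) <= A * cabs h.
    rewrite Ek cabsM cabsV ler_pdivrMr//.
    have -> : A * cabs h * cabs (f z) = (cabs l + 1) * cabs h.
      by rewrite /A; field; rewrite gt_eqF.
    have -> : f (z + h) - f z = (f (z + h) - f z - l * h) + l * h by ring.
    by rewrite (le_trans (cabsD _ _))// cabsM; lra.
  lra.
have -> : k - l / f z * h = (f (z + h) - f z - l * h) / f z - (cexp k - 1 - k).
  by rewrite Ek; field.
rewrite (le_trans (cabsB _ _))// (splitr e) [leRHS]mulrDl lerD//.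
  by rewrite cabsM cabsV ler_pdivrMr// mulrAC.
rewrite (le_trans k1)// (le_trans (ler_wpM2l (ltW eA) kA))// mulrA divfK//.
by rewrite mulf_neq0 ?gt_eqF.
Qed.

Lemma cdiff_uniq f z l k : cdiff f z l -> cdiff f z k -> l = k.
Proof.
move=> H K; apply/eqP; rewrite -subr_eq0; apply/eqP; apply: cabs0_eq.
apply/eqP; rewrite eq_le cabs_ge0 andbT; apply/ler_addgt0Pr => e e0; rewrite add0r.
have e2 : 0 < e / 2 by rewrite divr_gt0.
have [d d0 Hd] := H _ e2; have [c c0 Kd] := K _ e2.
pose r := Num.min d c / 2; have m0 : 0 < Num.min d c by rewrite lt_min d0.
have r0 : 0 < r by rewrite divr_gt0.
have rr : cabs r%:C = r by rewrite cabs_real gtr0_norm.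
have : cabs r%:C < Num.min d c by rewrite rr /r ltr_pdivrMr// ltr_pMr// ltr1n.
rewrite lt_min => /andP[/Hd h1 /Kd h2]; rewrite rr in h1 h2.
rewrite -(ler_pM2r r0) -{1}rr -cabsM.
have -> : (l - k) * r%:C = (f (z + r%:C) - f z - k * r%:C) - (f (z + r%:C) - f z - l * r%:C) by ring.
by rewrite (le_trans (cabsB _ _))// (splitr e) [leRHS]mulrDl lerD.
Qed.

Definition copen (U : R[i] -> Prop) := forall z, U z ->
  exists2 d : R, 0 < d & forall w, cabs (w - z) < d -> U w.

Definition haslog (U : R[i] -> Prop) f := exists g, forall z, U z ->
  cexp (g z) = f z /\ cdiffable g z.

(** The difference D of the logarithms satisfies exp(D) = 1; differentiating this gives D' = 0, and
    integration along the segment from z to w finishes. *)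
Lemma log_diff_const (U : R[i] -> Prop) f g1 g2 z w : copen U ->
  (forall t, 0 <= t <= 1 -> U (z + t%:C * (w - z))) ->
  (forall v, U v -> cexp (g1 v) = f v /\ cdiffable g1 v) ->
  (forall v, U v -> cexp (g2 v) = f v /\ cdiffable g2 v) ->
  g1 w - g2 w = g1 z - g2 z.
Proof.
move=> oU seg H1 H2; pose D v := g1 v - g2 v.
have dD v : U v -> cdiff D v 0.
  move=> Uv; have [_ [l1 d1]] := H1 v Uv; have [_ [l2 d2]] := H2 v Uv.
  have dD := cdiffB d1 d2; have [r r0 Hr] := oU v Uv.
  have e1 u : U u -> cexp (D u) = 1.
    move=> Uu; have [E1 _] := H1 u Uu; have [E2 _] := H2 u Uu.
    by rewrite /D cexpB E1 E2 divff// -E2 cexp_neq0.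
  have c1 : cdiff (fun u => cexp (D u)) v 0.
    apply: (@cdiff_near _ (fun=> 1) _ _ _ r r0); last exact: cdiff_cst.
    by move=> u /Hr /e1 ->.
  have := cdiff_uniq (cdiff_cexp_comp dD) c1; rewrite e1// mul1r => E.
  by rewrite E in dD.
have c0 : pcont_on 0 1 (fun=> 0 : R[i]) by exact: pcont_on_cst.
have := @cint_FTC _ 0 1 (fun=> 0) (fun t => D (z + t%:C * (w - z))) ler01 c0.
rewrite cint0 rmorph0 mul0r addr0 rmorph1 mul1r subrKC => H.
apply/eqP; rewrite -subr_eq0; apply/eqP; rewrite -/(D w) -/(D z) -H// => t ht.
by have := pdiff_line (dD _ (seg t ht)); rewrite mul0r.
Qed.

Lemma haslog_sub (U V : R[i] -> Prop) f : (forall z, V z -> U z) -> haslog U f -> haslog V f.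
Proof. by move=> VU [g Hg]; exists g => z /VU /Hg. Qed.

(** On the convex intersection the two logarithms differ by a constant c with exp(c) = 1, so the
    second one shifted by c continues the first. *)
Lemma haslog_glue (U V : R[i] -> Prop) f z0 : copen U -> copen V -> U z0 -> V z0 ->
  (forall z w t, U z -> V z -> U w -> V w -> 0 <= t <= 1 ->
     U (z + t%:C * (w - z)) /\ V (z + t%:C * (w - z))) ->
  haslog U f -> haslog V f -> haslog (fun z => U z \/ V z) f.
Proof.
move=> oU oV U0 V0 cv [g1 H1] [g2 H2].
have oUV : copen (fun z => U z /\ V z).
  move=> z [/oU[d d0 Hd] /oV[c c0 Hc]]; exists (Num.min d c); first by rewrite lt_min d0.
  by move=> w; rewrite lt_min => /andP[/Hd ? /Hc ?].
have [E1 _] := H1 _ U0; have [E2 _] := H2 _ V0.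
pose c := g1 z0 - g2 z0.
have ec : cexp c = 1 by rewrite /c cexpB E1 E2 divff// -E2 cexp_neq0.
have agree w : U w -> V w -> g1 w = g2 w + c.
  move=> Uw Vw; suff : g1 w - g2 w = c by move=> <-; ring.
  apply: (@log_diff_const _ f _ _ z0 w oUV).
  - by move=> t ht; exact: cv.
  - by move=> v [Uv _]; exact: H1.
  - by move=> v [_ Vv]; exact: H2.
exists (fun z => if pselect (U z) then g1 z else g2 z + c) => z UVz.
have [Uz|nUz] := pselect (U z).
  have [E [l dl]] := H1 z Uz; split; first by case: pselect.
  exists l.
  have [d d0 Hd] := oU z Uz; apply: (@cdiff_near _ g1 _ _ _ d d0) => // w /Hd Uw.
  by case: pselect.
case: UVz => // Vz; have [E [l dl]] := H2 z Vz; split.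
  by case: pselect => [//|nU]; rewrite cexpD ec mulr1.
exists l; have [d d0 Hd] := oV z Vz.
apply: (@cdiff_near _ (fun w => g2 w + c) _ _ _ d d0).
  by move=> w /Hd Vw; case: pselect => // Uw; rewrite agree.
by rewrite -[l]addr0; apply: cdiffD dl (cdiff_cst c z).
Qed.

Definition orect a b c d z := a < Re z < b /\ c < Im z < d.

Lemma copen_orect a b c d : copen (orect a b c d).
Proof.
move=> z [/andP[za zb] /andP[zc zd]].
pose r := Num.min (Num.min (Re z - a) (b - Re z)) (Num.min (Im z - c) (d - Im z)).
exists r; first by rewrite !lt_min !subr_gt0 za zb zc zd.
move=> w; rewrite !lt_min => /andP[/andP[h1 h2] /andP[h3 h4]].
have := Re_le_cabs (w - z); have := Im_le_cabs (w - z).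
rewrite ReD ImD ReN ImN !ler_norml => /andP[q1 q2] /andP[q3 q4].
by split; apply/andP; split; lra.
Qed.

Lemma segment_gt t a u v : a < u -> a < v -> 0 <= t <= 1 -> a < u + (v - u) * t :> R.
Proof.
move=> au av /andP[t0 t1]; have [uv|vu] := leP u v.
  by have : 0 <= (v - u) * t; [rewrite mulr_ge0// subr_ge0|lra].
by have : 0 <= (u - v) * (1 - t); [rewrite mulr_ge0// subr_ge0// ltW|lra].
Qed.

Lemma segment_lt t a u v : u < a -> v < a -> 0 <= t <= 1 -> u + (v - u) * t < a :> R.
Proof.
move=> ua va ht; rewrite -ltrN2.
have -> : - (u + (v - u) * t) = - u + (- v - - u) * t by ring.
by apply: segment_gt; rewrite ?ltrN2.
Qed.

Lemma convex_orect a b c d z w t : orect a b c d z -> orect a b c d w -> 0 <= t <= 1 ->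
  orect a b c d (z + t%:C * (w - z)).
Proof.
move=> [/andP[za zb] /andP[zc zd]] [/andP[wa wb] /andP[wc wd]] ht.
rewrite /orect mulrC ReD ImD ReMr ImMr ReD ImD ReN ImN.
by split; apply/andP; split; (exact: segment_gt || exact: segment_lt).
Qed.

Lemma haslog_local f z (r : R) : 0 < r -> (forall w, cabs (w - z) < r -> cdiffable f w) ->
  f z != 0 -> exists2 d : R, 0 < d & haslog (fun w => cabs (w - z) < d) f.
Proof.
move=> r0 df fz; have [w0 Hw0] := cexp_surj fz.
have c0 : 0 < cabs (f z) by rewrite cabs_gt0.
have [l dfz] : cdiffable f z by apply: df; rewrite subrr cabs0.
have e0 : 0 < cabs (f z) / 2 by rewrite divr_gt0.
have [d d0 Hd] := cdiff_cont dfz e0.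
exists (Num.min d r); first by rewrite lt_min d0.
have pos w : cabs (w - z) < d -> 0 < Re (f w / f z).
  move=> /Hd; rewrite subrKC => h.
  have : cabs (f w / f z - 1) <= 2^-1.
    have -> : f w / f z - 1 = (f w - f z) / f z by field.
    by rewrite cabsM cabsV ler_pdivrMr// mulrC.
  move=> /(le_trans (Re_le_cabs _)); rewrite ReD ReN /= ler_norml => /andP[h1 _].
  have : (2^-1 : R) < 1 by rewrite invf_lt1// ltr1n.
  lra.
have E w : cabs (w - z) < d -> cexp (w0 + clog (f w / f z)) = f w.
  by move=> wd; rewrite cexpD Hw0 cexp_clog ?pos// mulrC divfK.
exists (fun w => w0 + clog (f w / f z)) => w; rewrite lt_min => /andP[wd wr].
split; first exact: E.
have q0 : 0 < d - cabs (w - z) by rewrite subr_gt0.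
have [l' dfw] := df w wr.
apply: (@log_cdiffable f _ w _ q0) => //; last by exists l'.
  move=> v hv; apply: E; have -> : v - z = (v - w) + (w - z) by ring.
  by rewrite (le_lt_trans (cabsD _ _))//; lra.
have cq : ccont (fun v => f v / f z) w.
  apply: (@cdiff_cont _ _ _ ((f z)^-1 * l')).
  by apply: (cdiff_ext _ (cdiffZ (f z)^-1 dfw)) => v; rewrite mulrC.
move=> e e0'; have [d1 d10 H1] := ccont_clog (pos w wd) e0'.
have d12 : 0 < d1 / 2 by rewrite divr_gt0.
have [d2 d20 H2] := cq _ d12.
exists d2 => // h /H2 h2.
have -> : w0 + clog (f (w + h) / f z) - (w0 + clog (f w / f z)) =
  clog (f w / f z + (f (w + h) / f z - f w / f z)) - clog (f w / f z).
  by rewrite subrKC; ring.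
by apply: H1; lra.
Qed.

Theorem holomorphic_log f x0 x1 y0 y1 : x0 <= x1 -> y0 <= y1 ->
  (forall z, in_rect x0 x1 y0 y1 z -> f z != 0 /\
    exists2 d : R, 0 < d & forall w, cabs (w - z) < d -> cdiffable f w) ->
  exists g, forall z, in_rect x0 x1 y0 y1 z -> cexp (g z) = f z /\ cdiffable g z.
Proof.
move=> x01 y01 Hf.
(* The margin r around the closed rectangle makes adjacent pieces overlap in an open rectangle,
   where the gluing can take place. *)
pose P a b c d := exists2 r : R, 0 < r & haslog (orect (a - r) (b + r) (c - r) (d + r)) f.
suff [r r0 [g Hg]] : P x0 x1 y0 y1.
  exists g => z [/andP[za zb] /andP[zc zd]]; apply: Hg.
  by split; apply/andP; split; lra.
apply: rect_bisection => // [a b c d _ ab _ _ cd _|z /Hf[fz [r r0 dfr]]].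
  move=> [r1 r10 L1] [r2 r20 L2] [r3 r30 L3] [r4 r40 L4].
  pose r := Num.min (Num.min r1 r2) (Num.min r3 r4).
  have r0 : 0 < r by rewrite !lt_min r10 r20 r30 r40.
  have [q1 q2 q3 q4] : [/\ r <= r1, r <= r2, r <= r3 & r <= r4].
    by have := lexx r; rewrite {2}/r !le_min => /andP[/andP[-> ->] /andP[-> ->]].
  have gluex c' d' : c' < d' ->
      haslog (orect (a - r) ((a + b) / 2 + r) c' d') f ->
      haslog (orect ((a + b) / 2 - r) (b + r) c' d') f ->
      haslog (orect (a - r) (b + r) c' d') f.
    move=> cd' h1 h2.
    apply: (haslog_sub _ (haslog_glue (z0 := ((a + b) / 2) +i* ((c' + d') / 2))
      (@copen_orect _ _ _ _) (@copen_orect _ _ _ _) _ _ _ h1 h2)).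
    - move=> v [/andP[v1 v2] v3]; have [v4|v4] := ltP (Re v) ((a + b) / 2 + r).
        by left; split=> //; apply/andP; split; lra.
      by right; split=> //; apply/andP; split; lra.
    - by split=> /=; lra.
    - by split=> /=; lra.
    - by move=> v w t v1 v2 w1 w2 ht; split; [exact: (convex_orect v1 w1 ht)|exact: (convex_orect v2 w2 ht)].
  have B : haslog (orect (a - r) (b + r) (c - r) ((c + d) / 2 + r)) f.
    apply: gluex; first lra.
      by apply: haslog_sub L1 => v [/andP[? ?] /andP[? ?]]; split; lra.
    by apply: haslog_sub L2 => v [/andP[? ?] /andP[? ?]]; split; lra.
  have T : haslog (orect (a - r) (b + r) ((c + d) / 2 - r) (d + r)) f.
    apply: gluex; first lra.
      by apply: haslog_sub L3 => v [/andP[? ?] /andP[? ?]]; split; lra.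
    by apply: haslog_sub L4 => v [/andP[? ?] /andP[? ?]]; split; lra.
  exists r => //.
  apply: (haslog_sub _ (haslog_glue (z0 := ((a + b) / 2) +i* ((c + d) / 2))
      (@copen_orect _ _ _ _) (@copen_orect _ _ _ _) _ _ _ B T)).
  - move=> v [v3 /andP[v1 v2]]; have [v4|v4] := ltP (Im v) ((c + d) / 2 + r).
      by left; split=> //; apply/andP; split; lra.
    by right; split=> //; apply/andP; split; lra.
  - by split=> /=; lra.
  - by split=> /=; lra.
  - by move=> v w t v1 v2 w1 w2 ht; split; [exact: (convex_orect v1 w1 ht)|exact: (convex_orect v2 w2 ht)].
have [d d0 L] := haslog_local r0 dfr fz.
exists (d / 4); first by rewrite divr_gt0.
move=> a b c k _ ab _ _ ck _ [/andP[za zb] /andP[zc zk]] h1 h2.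
exists (d / 8); first by rewrite divr_gt0.
apply: haslog_sub L => v [/andP[va vb] /andP[vc vk]].
rewrite (le_lt_trans (cabs_le_ReIm _))// ReD ImD ReN ImN.
have q1 : `|Re v - Re z| <= d / 4 + d / 8 by rewrite ler_norml; lra.
have q2 : `|Im v - Im z| <= d / 4 + d / 8 by rewrite ler_norml; lra.
lra.
Qed.

End HolomorphicLog.

(** * The weighted mean square *)

Section Weight.
Context {R : realType}.
Implicit Types (s w z : R[i]) (t : R) (K j : nat).
Local Notation ii := (0 +i* 1 : R[i]).

Definition wpoly K : {poly R[i]} := (1 - 'X^2) ^+ K.

Lemma wpolyE K z : (wpoly K).[z] = (1 - z ^+ 2) ^+ K.
Proof. by rewrite /wpoly !hornerE. Qed.

Lemma wpoly_deriv_factor K j : (j <= K)%N ->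
  exists Q : {poly R[i]}, (wpoly K)^`(j) = (1 - 'X^2) ^+ (K - j) * Q.
Proof.
elim: j => [|j IH] jK; first by exists 1; rewrite subn0 mulr1.
have [Q HQ] := IH (ltnW jK).
have -> : (K - j.+1 = (K - j).-1)%N by lia.
have : (0 < K - j)%N by rewrite subn_gt0.
rewrite derivnS HQ; case: (K - j)%N => // n _ /=.
exists ((1 - 'X^2)^`() * n.+1%:R * Q + (1 - 'X^2) * Q^`()).
rewrite derivM deriv_exp /= -[_ *+ n.+1]mulr_natr.
by rewrite mulrDr (exprSr _ n) -!mulrA mulrCA.
Qed.

Lemma poly_bounded (p : {poly R[i]}) (r : R) : 0 <= r ->
  exists2 C : R, 0 <= C & forall z, cabs z <= r -> cabs p.[z] <= C.
Proof.
move=> r0; exists (\sum_(i < size p) cabs p`_i * r ^+ i).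
  by apply: sumr_ge0 => i _; rewrite mulr_ge0 ?cabs_ge0 ?exprn_ge0.
move=> z zr; rewrite horner_coef (le_trans (cabs_sum _ _ _))//.
apply: ler_sum => i _; rewrite cabsM cabsX ler_wpM2l ?cabs_ge0//.
by rewrite lerXn2r ?nnegrE ?cabs_ge0.
Qed.

(** The j-th derivative still vanishes at the points 1 and -1 to order K - j, the source of all
    savings in H. [K - j] is truncated subtraction: beyond j = K the bound is a mere constant. *)
Lemma wpoly_deriv_bound K : exists2 C : R, 0 <= C & forall j z, (j < K.*2.+1)%N ->
  cabs z <= 2 -> cabs (wpoly K)^`(j).[z] <= C * cabs (1 - z ^+ 2) ^+ (K - j).
Proof.
have H j : exists2 C : R, 0 <= C & forall z, cabs z <= 2 ->
    cabs (wpoly K)^`(j).[z] <= C * cabs (1 - z ^+ 2) ^+ (K - j).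
  have [jK|Kj] := leqP j K.
    have [Q HQ] := wpoly_deriv_factor jK.
    have [C C0 HC] := poly_bounded Q (ler0n R 2).
    exists C => // z z2; rewrite HQ hornerM horner_exp !hornerE cabsM cabsX mulrC.
    by rewrite ler_wpM2r ?exprn_ge0 ?cabs_ge0// HC.
  have [C C0 HC] := poly_bounded (wpoly K)^`(j) (ler0n R 2).
  exists C => // z z2; have -> : (K - j = 0)%N by lia.
  by rewrite expr0 mulr1 HC.
pose c j := s2val (cid2 (H j)).
have Hc j : 0 <= c j /\ forall z, cabs z <= 2 ->
    cabs (wpoly K)^`(j).[z] <= c j * cabs (1 - z ^+ 2) ^+ (K - j).
  by split; [exact: s2valP (cid2 (H j))|exact: s2valP' (cid2 (H j))].
exists (\sum_(j < K.*2.+1) c j); first by apply: sumr_ge0 => j _; have [] := Hc j.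
move=> j z jK z2; have [cj hj] := Hc j; rewrite (le_trans (hj z z2))//.
rewrite ler_wpM2r ?exprn_ge0 ?cabs_ge0// (bigD1 (Ordinal jK))//= lerDl.
by apply: sumr_ge0 => i _; have [] := Hc i.
Qed.

Lemma wpoly_deriv0 K : (wpoly K)^`(K.*2.+1) = 0.
Proof.
apply: derivn_poly0; apply: (leq_trans (size_poly_exp_leq _ _)).
have : (size (1 - 'X^2 : {poly R[i]})%R <= 3)%N.
  by rewrite (leq_trans (size_polyD _ _))// size_polyN size_poly1 size_polyXn.
by move=> h; rewrite ltnS -mul2n leq_mul2r; apply/orP; right; lia.
Qed.

Section Scaled.
Variables (K : nat) (s0 u H : R).
Hypothesis H1 : 1 <= H.

(** Sends the segment Re s = s0, |Im s - u| <= H onto [-1, 1]; H is half the length of the interval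
    of integration. *)
Definition wmap s : R[i] := (s - (s0 +i* u)) / (0 +i* H).
Definition weight s : R[i] := (wpoly K).[wmap s].

Let iH0 : 0 +i* H != 0 :> R[i].
Proof. by apply/eqP => /(congr1 (@complex.Im R)) /= E; move: H1; rewrite E; lra. Qed.

Let H0 : 0 < H. Proof. exact: lt_le_trans ltr01 H1. Qed.

Lemma wmapE (x t : R) : wmap (x +i* t) = ((t - u) / H) +i* (- ((x - s0) / H)).
Proof.
rewrite /wmap; apply: (canLR (mulfK iH0)); have := H0.
by move=> h; apply: complex_eq; rewrite ?ReM ?ImM ?ReD ?ImD ?ReN ?ImN /=; field; rewrite gt_eqF.
Qed.

Lemma cdiff_wmap s : cdiff wmap s (0 +i* H)^-1.
Proof.
apply: (cdiff_exteq (cdiffZ (0 +i* H)^-1 (cdiffB (cdiff_id s) (cdiff_cst (s0 +i* u) s)))).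
  by move=> w; rewrite mulrC.
by rewrite subr0 mulr1.
Qed.

Lemma cdiff_wderiv j s : cdiff (fun w => (wpoly K)^`(j).[wmap w]) s
  ((wpoly K)^`(j.+1).[wmap s] / (0 +i* H)).
Proof. by rewrite derivnS; exact: cdiff_comp (cdiff_wmap s) (cdiff_horner _ _). Qed.

Lemma cdiff_weight s : cdiffable weight s.
Proof. by eexists; exact: (cdiff_wderiv 0 s). Qed.

Lemma wmap_bounds x t : s0 <= x <= s0 + 2 -> t = u - H \/ t = u + H -> 2 <= H ->
  cabs (wmap (x +i* t)) <= 2 /\ cabs (1 - wmap (x +i* t) ^+ 2) <= 8 / H.
Proof.
move=> /andP[x0 x2] ht H2; rewrite wmapE.
set d := (x - s0) / H.
have d0 : 0 <= d by rewrite divr_ge0 ?(ltW H0)// subr_ge0.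
have d2 : d <= 2 / H by rewrite ler_wpM2r ?invr_ge0 ?(ltW H0)//; lra.
have H21 : 2 / H <= 1 by rewrite ler_pdivrMr// mul1r.
have tE : ((t - u) / H = 1) \/ ((t - u) / H = -1).
  by case: ht => ->; [right|left]; field; rewrite gt_eqF.
split.
  rewrite (le_trans (cabs_le_ReIm _))//= normrN (ger0_norm d0).
  have -> : `|(t - u) / H| = 1 by case: tE => ->; rewrite ?normrN normr1.
  lra.
have -> : 1 - ((t - u) / H +i* - d) ^+ 2 = (d ^+ 2) +i* (2 * ((t - u) / H) * d).
  by rewrite expr2; case: tE => ->; apply: complex_eq; rewrite ?ReD ?ImD ?ReN ?ImN ?ReM ?ImM /=; ring.
rewrite (le_trans (cabs_le_ReIm _))//= ger0_norm ?sqr_ge0//.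
have -> : `|2 * ((t - u) / H) * d| = 2 * d.
  by case: tE => ->; rewrite ?mulr1 ?mulrN1 ?mulNr ?normrN (ger0_norm (mulr_ge0 (ler0n R 2) d0)).
have : d ^+ 2 <= 2 / H by rewrite expr2 (le_trans _ d2)// ler_piMr//; lra.
lra.
Qed.

Lemma weight_end_bound x t : s0 <= x <= s0 + 2 -> t = u - H \/ t = u + H -> 2 <= H ->
  cabs (weight (x +i* t)) <= (8 / H) ^+ K.
Proof.
move=> hx ht H2; have [_ h] := wmap_bounds hx ht H2.
by rewrite /weight wpolyE cabsX lerXn2r ?nnegrE ?cabs_ge0// divr_ge0// ltW.
Qed.

(** The primitive of exp(th s) times the weight that 2K + 1 integrations by parts produce. It is
    exact, because the weight is a polynomial of degree 2K and the last remainder vanishes. *)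
Definition osc_prim (th : R) s : R[i] := cexp (th%:C * s) *
  \sum_(0 <= j < K.*2.+1) (-1) ^+ j / (0 +i* H) ^+ j / th%:C ^+ j.+1 *
     (wpoly K)^`(j).[wmap s].

Let quotS (F : fieldType) (a b t : F) j : a / b / t ^+ j / t = a / b / t ^+ j.+1.
Proof. by rewrite -[LHS]mulrA -invfM -exprSr. Qed.

Let osc_telescope (F : fieldType) (h t p q : F) j : h != 0 -> t != 0 ->
  t * ((-1) ^+ j / h ^+ j / t ^+ j / t * p) + (-1) ^+ j / h ^+ j / t ^+ j / t * (q / h) =
  - ((-1) ^+ j.+1 / h ^+ j.+1 / t ^+ j.+1 * q - (-1) ^+ j / h ^+ j / t ^+ j * p).
Proof.
move=> h0 t0; rewrite !exprS !invfM mulN1r.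
move: ((-1) ^+ j) (h ^+ j)^-1 (t ^+ j)^-1 => x y z.
by field; rewrite h0 t0.
Qed.

Lemma cdiff_osc_prim th s : th != 0 -> cdiff (osc_prim th) s (cexp (th%:C * s) * weight s).
Proof.
move=> th0; have thC : th%:C != 0 :> R[i] by rewrite -(rmorph0 (real_complex R)) (inj_eq (@complexI R)).
have d1 : cdiff (fun w => cexp (th%:C * w)) s (cexp (th%:C * s) * (th%:C * 1)).
  exact: cdiff_cexp_comp (cdiffZ _ (cdiff_id s)).
pose c j : R[i] := (-1) ^+ j / (0 +i* H) ^+ j / th%:C ^+ j.
have d2 := cdiff_sum (index_iota 0 K.*2.+1)
  (fun j => cdiffZ (c j / th%:C) (cdiff_wderiv j s)).
apply: (cdiff_exteq (cdiffM d1 d2)) => [w|].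
  rewrite /osc_prim; congr (_ * _); apply: eq_bigr => j _; congr (_ * _).
  rewrite /c; exact: quotS.
rewrite mulr1 -mulrA -mulrDr; congr (_ * _).
rewrite mulr_sumr -big_split /=.
have -> : weight s = c 0%N * (wpoly K)^`(0).[wmap s] - c K.*2.+1 * (wpoly K)^`(K.*2.+1).[wmap s].
  by rewrite wpoly_deriv0 horner0 mulr0 subr0 /c !expr0 !invr1 !mulr1 mul1r.
rewrite -opprB -(telescope_sumr (fun j => c j * (wpoly K)^`(j).[wmap s]))//.
rewrite -sumrN; apply: eq_bigr => j _.
rewrite /c; exact: osc_telescope.
Qed.

End Scaled.

(** Apart from exp(th x), the j-th term of the primitive at an end is at most a constant times
    V^(j+1) H^(-j) (8/H)^(K-j); as 1 <= V <= H, all of them are at most 8^K V (V/H)^K up to that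
    constant. The constant depends on K alone, not on the line, the interval or the frequency. *)
Lemma osc_bound K : exists2 C : R, 0 <= C & forall (s0 u H V x th : R),
  s0 <= x <= s0 + 2 -> 2 <= H -> 1 <= V -> V <= H -> th != 0 -> `|th|^-1 <= V ->
  cabs (cint (u - H) (u + H) (fun t => cexp (th%:C * (x +i* t)) * weight K s0 u H (x +i* t)))
   <= expR (th * x) * (C * V * (V / H) ^+ K).
Proof.
have [C C0 HC] := wpoly_deriv_bound K.
exists (2 * (C * 8 ^+ K *+ K.*2.+1)); first by rewrite mulr_ge0// mulrn_wge0// mulr_ge0.
move=> s0 u H V x th hx H2 V1 VH th0 thV.
have H1 : 1 <= H by lra.
have H0 : 0 < H by lra.
have uH : u - H <= u + H by lra.
have cP s : ccont (fun s => cexp (th%:C * s) * weight K s0 u H s) s.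
  have [l dw] := cdiff_weight K s0 u H s.
  apply: cdiff_cont; apply: cdiffM dw.
  exact: cdiff_cexp_comp (cdiffZ _ (cdiff_id s)).
have cp : pcont_on (u - H) (u + H) (fun t => cexp (th%:C * (x +i* t)) * weight K s0 u H (x +i* t)).
  by move=> t _; exact: (pcont_ver (cP _)).
have i1 : cabs ii = 1 by rewrite cabs_i normr1.
set I := cint _ _ _; have <- : cabs (ii * I) = cabs I by rewrite cabsM i1 mul1r.
rewrite -cintZ//.
rewrite (cint_FTC (q := fun t => osc_prim K s0 u H th (x +i* t)) uH); first last.
- by move=> t _; rewrite mulrC; apply: pdiff_ver; exact: cdiff_osc_prim.
- by apply: pcont_onM => //; exact: pcont_on_cst.
have V0 : 0 < V by lra.
have VH1 : V / H <= 1 by rewrite ler_pdivrMr// mul1r.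
have VH0 : 0 <= V / H by rewrite divr_ge0 ?(ltW H0)// ltW.
have B t : t = u - H \/ t = u + H -> cabs (osc_prim K s0 u H th (x +i* t)) <=
    expR (th * x) * ((C * 8 ^+ K *+ K.*2.+1) * V * (V / H) ^+ K).
  move=> ht; have E : Re (th%:C * (x +i* t)) = th * x by rewrite mulrC ReMr mulrC.
  rewrite /osc_prim cabsM cabs_cexp E ler_wpM2l ?expR_ge0//.
  rewrite (le_trans (cabs_sum _ _ _))// mulrnAl mulrnAl -[X in _ *+ X]subn0 -sumr_const_nat.
  rewrite big_nat_cond [leRHS]big_nat_cond; apply: ler_sum => j; rewrite andbT => /andP[_ jK].
  have [w2 w8] := wmap_bounds H1 hx ht H2.
  rewrite !cabsM !cabsV !cabsX cabsN cabs1 expr1n mul1r cabs_i (gtr0_norm H0) cabs_real.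
  have h := HC j _ jK w2.
  have th_gt0 : 0 < `|th| by rewrite normr_gt0.
  apply: (@le_trans _ _ ((H ^+ j)^-1 * V ^+ j.+1 * (C * (8 / H) ^+ (K - j)))).
    apply: ler_pM; rewrite ?mulr_ge0 ?invr_ge0 ?exprn_ge0 ?cabs_ge0 ?(ltW H0)//.
      rewrite ler_wpM2l ?invr_ge0 ?exprn_ge0 ?(ltW H0)// -exprVn.
      by rewrite lerXn2r ?nnegrE ?invr_ge0// ltW.
    rewrite (le_trans h)// ler_wpM2l// lerXn2r ?nnegrE ?cabs_ge0//.
    by rewrite divr_ge0// ltW.
  have -> : C * 8 ^+ K * V * (V / H) ^+ K = V * (C * (8 ^+ K * (V / H) ^+ K)) by ring.
  have -> : (H ^+ j)^-1 * V ^+ j.+1 * (C * (8 / H) ^+ (K - j)) =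
     V * (C * (8 ^+ (K - j) * ((V / H) ^+ j * H^-1 ^+ (K - j)))).
    by rewrite exprS !exprMn !exprVn; ring.
  rewrite ler_pM2l// ler_wpM2l//.
  apply: ler_pM; rewrite ?mulr_ge0 ?exprn_ge0 ?invr_ge0 ?(ltW H0)//.
    by rewrite ler_weXn2l ?ler1n// leq_subr.
  have [jK'|Kj] := leqP j K.
    rewrite -[in leRHS](subnKC jK') exprD ler_wpM2l ?exprn_ge0//.
    rewrite lerXn2r ?nnegrE ?invr_ge0 ?(ltW H0)// -[leLHS]mul1r.
    by rewrite ler_wpM2r ?invr_ge0 ?(ltW H0).
  have -> : (K - j = 0)%N by apply/eqP; rewrite subn_eq0 ltnW.
  by rewrite expr0 mulr1 ler_wiXn2l// ltnW.
have h1 := B _ (or_introl erefl); have h2 := B _ (or_intror erefl).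
rewrite (le_trans (cabsB _ _))// (le_trans (lerD h2 h1))//.
set D := C * _ *+ _.
by rewrite le_eqVlt; apply/orP; left; apply/eqP; ring.
Qed.

End Weight.

(** * Mean values of products of Dirichlet polynomials *)

Section MeanValue.
Context {R : realType}.
Implicit Types (s w z : R[i]) (t x : R) (K : nat).
Local Notation ii := (0 +i* 1 : R[i]).

(** Only m is bounded by N, while n comes from F and may be arbitrarily large. Distinct integers
    differ by at least 1, and log y - log x >= 1 - x / y turns this into a gap of at least 1 /
    (2N). *)
Lemma ln_gap (m n N : nat) : (0 < m)%N -> (0 < n)%N -> (m <= N)%N -> m != n ->
  ln (m%:R : R) - ln n%:R != 0 /\ `|ln (m%:R : R) - ln n%:R|^-1 <= 2 * N%:R.
Proof.
move=> m0 n0 mN mn.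
have m0R : 0 < m%:R :> R by rewrite ltr0n.
have n0R : 0 < n%:R :> R by rewrite ltr0n.
have key (x y : R) : 0 < x -> x < y -> 1 - x / y <= ln y - ln x.
  move=> x0 xy; have y0 := lt_trans x0 xy.
  have := @le_ln1Dx R (x / y - 1); rewrite ltrBrDl subrr divr_gt0// => /(_ isT).
  by rewrite subrKC lnM ?posrE ?invr_gt0// lnV ?posrE//; lra.
have h2N : 0 < (2 * N%:R)^-1 :> R.
  by rewrite invr_gt0 mulr_gt0// ltr0n (leq_trans m0).
have N0 : 0 < N%:R :> R by rewrite ltr0n (leq_trans m0).
have m1 : 1 <= m%:R :> R by rewrite ler1n.
have mNR : m%:R <= N%:R :> R by rewrite ler_nat.
suff h : (2 * N%:R)^-1 <= `|ln (m%:R : R) - ln n%:R|.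
  have p := lt_le_trans h2N h; split; first by rewrite -normr_gt0.
  by rewrite -[leRHS]invrK lef_pV2// posrE.
have [lt|lt|E] := ltngtP m n; last by rewrite E eqxx in mn.
  have nm : m%:R + 1 <= n%:R :> R by rewrite natr1 ler_nat.
  have ltR : m%:R < n%:R :> R by rewrite ltr_nat.
  have h := key _ _ m0R ltR.
  rewrite distrC (le_trans _ (ler_norm _))// (le_trans _ h)//.
  have : m%:R / n%:R <= m%:R / (m%:R + 1) :> R.
    by rewrite ler_pM2l// lef_pV2// posrE addr_gt0.
  have : (2 * N%:R)^-1 <= (m%:R + 1)^-1 :> R by rewrite lef_pV2 ?posrE; lra.
  have : m%:R / (m%:R + 1) = 1 - (m%:R + 1)^-1 :> R by field; rewrite gt_eqF; lra.
  lra.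
have nm : n%:R + 1 <= m%:R :> R by rewrite natr1 ler_nat.
have ltR : n%:R < m%:R :> R by rewrite ltr_nat.
have h := key _ _ n0R ltR.
rewrite (le_trans _ (ler_norm _))// (le_trans _ h)//.
have : n%:R / m%:R <= (m%:R - 1) / m%:R :> R by rewrite ler_pM2r ?invr_gt0//; lra.
have : (2 * N%:R)^-1 <= m%:R^-1 :> R by rewrite lef_pV2 ?posrE; lra.
have : (m%:R - 1) / m%:R = 1 - m%:R^-1 :> R by field; rewrite gt_eqF.
lra.
Qed.

Lemma natpow_ratio (n m : nat) s :
  natpow n (- s) * natpow m s = cexp ((ln m%:R - ln n%:R)%:C * s).
Proof. by rewrite /natpow -cexpD; congr cexp; rewrite rmorphB; ring. Qed.

(** Each product n^(-s) m^s is exp(th s) with th = log m - log n. Diagonal pairs leave the integral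
    of the weight, the others fall under the oscillation bound with V = 2N. The diagonal is a
    condition on values, so several indices may share the same n. *)
Lemma mean_value_approx (K N : nat) (C s0 u H x : R) (I J : finType)
    (a : I -> R[i]) (n : I -> nat) (b : J -> R[i]) (m : J -> nat) :
  (forall V th : R, 1 <= V -> V <= H -> th != 0 -> `|th|^-1 <= V ->
   cabs (cint (u - H) (u + H) (fun t => cexp (th%:C * (x +i* t)) * weight K s0 u H (x +i* t)))
   <= expR (th * x) * (C * V * (V / H) ^+ K)) ->
  (forall i, 0 < n i)%N -> (forall j, 0 < m j <= N)%N -> (0 < N)%N -> 2 * N%:R <= H ->
  cabs (cint (u - H) (u + H) (fun t => (\sum_i a i * natpow (n i) (- (x +i* t)))
      * (\sum_j b j * natpow (m j) (x +i* t)) * weight K s0 u H (x +i* t)) -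
    cint (u - H) (u + H) (fun t => weight K s0 u H (x +i* t)) *
      (\sum_i \sum_j (if n i == m j then a i * b j else 0))) <=
  (\sum_i cabs (a i) * expR (- x * ln (n i)%:R)) *
  (\sum_j cabs (b j) * expR (x * ln (m j)%:R)) * (C * (2 * N%:R) * (2 * N%:R / H) ^+ K).
Proof.
move=> osc n0 mN N0 NH.
have cP th s : ccont (fun s => cexp (th%:C * s) * weight K s0 u H s) s.
  have [l dw] := cdiff_weight K s0 u H s.
  apply: cdiff_cont; apply: cdiffM dw.
  exact: cdiff_cexp_comp (cdiffZ _ (cdiff_id s)).
pose e th t := cexp (th%:C * (x +i* t)) * weight K s0 u H (x +i* t).
have ce th : pcont_on (u - H) (u + H) (e th).
  by move=> t _; exact: (pcont_ver (cP _ _)).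
pose th i j : R := ln (m j)%:R - ln (n i)%:R.
have ca i j : pcont_on (u - H) (u + H) (fun t => a i * b j * e (th i j) t).
  by apply: pcont_onM => //; exact: pcont_on_cst.
rewrite (@eq_cint _ _ _ _ (fun t => \sum_i \sum_j a i * b j * e (th i j) t)); last first.
  move=> t _; rewrite mulr_suml mulr_suml; apply: eq_bigr => i _.
  rewrite mulr_sumr mulr_suml; apply: eq_bigr => j _.
  by rewrite /e -natpow_ratio; ring.
rewrite cint_sum; last by move=> i; apply: pcont_on_sum => j; exact: ca.
rewrite [X in cabs (_ - X)]mulr_sumr -sumrB (le_trans (cabs_sum _ _ _))//.
rewrite mulr_suml [leRHS]mulr_suml; apply: ler_sum => i _.
rewrite cint_sum; last by move=> j; exact: ca.
rewrite [X in cabs (_ - X)]mulr_sumr -sumrB (le_trans (cabs_sum _ _ _))//.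
rewrite [in leRHS]mulr_sumr [leRHS]mulr_suml; apply: ler_sum => j _.
rewrite cintZ//.
have /andP[m0 mN'] := mN j.
have N1 : 1 <= N%:R :> R by rewrite ler1n.
have q : 1 <= 2 * N%:R :> R by lra.
have C0 : 0 <= C * (2 * N%:R) * (2 * N%:R / H) ^+ K.
  have := osc (2 * N%:R) 1 q NH; rewrite oner_eq0 normr1 invr1 => /(_ isT q).
  by move=> /(le_trans (cabs_ge0 _)); rewrite pmulr_rge0// expR_gt0.
have [E|nm] := eqVneq (n i) (m j).
  have -> : cint (u - H) (u + H) (e (th i j)) =
      cint (u - H) (u + H) (fun t => weight K s0 u H (x +i* t)).
    by apply: eq_cint => t _; rewrite /e /th E subrr rmorph0 mul0r cexp0 mul1r.
  rewrite mulrC subrr cabs0.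
  by rewrite mulr_ge0// mulr_ge0// mulr_ge0 ?cabs_ge0 ?expR_ge0.
have mn : m j != n i by rewrite eq_sym.
have [th0 thV] := ln_gap m0 (n0 i) mN' mn.
rewrite mulr0 subr0 !cabsM.
have h := osc (2 * N%:R) (th i j) q NH th0 thV.
rewrite (le_trans (ler_wpM2l _ h)) ?mulr_ge0 ?cabs_ge0//.
have -> : expR (th i j * x) = expR (- x * ln (n i)%:R) * expR (x * ln (m j)%:R).
  by rewrite -expRD; congr expR; rewrite /th; ring.
by rewrite le_eqVlt; apply/orP; left; apply/eqP; ring.
Qed.

Lemma shift_line (F : R[i] -> R[i]) x0 x1 y0 y1 (M : R) : x0 <= x1 -> y0 <= y1 ->
  chol_rect F x0 x1 y0 y1 ->
  (forall x y, x0 <= x <= x1 -> y = y0 \/ y = y1 -> cabs (F (x +i* y)) <= M) ->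
  cabs (cint y0 y1 (fun y => F (x1 +i* y)) - cint y0 y1 (fun y => F (x0 +i* y)))
    <= 4 * M * (x1 - x0).
Proof.
move=> x01 y01 hF HM; have := goursat x01 y01 hF; rewrite /rect_int.
have cF := ccont_rect_edges (chol_ccont hF).
have B y : y = y0 \/ y = y1 -> cabs (cint x0 x1 (fun x => F (x +i* y))) <= 2 * M * (x1 - x0).
  move=> hy; apply: cint_bound => //; first exact: ccont_edges_hor cF _ _.
  by move=> t ht; apply: HM.
have h0 := B _ (or_introl erefl); have h1 := B _ (or_intror erefl).
set A0 := cint _ _ _ in h0 *; set A1 := cint x0 x1 _ in h1 *.
set B1 := cint y0 y1 _; set B0 := cint y0 y1 _ => E.
have i1 : cabs ii = 1 by rewrite cabs_i normr1.
have -> : cabs (B1 - B0) = cabs (A1 - A0).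
  rewrite -[LHS]mul1r -{1}i1 -cabsM; congr cabs.
  by apply/eqP; rewrite -subr_eq0 -[X in _ == X]E; apply/eqP; ring.
by rewrite (le_trans (cabsB _ _))// (le_trans (lerD h1 h0))//; lra.
Qed.

Section Main.
Variables (K : nat) (s0 u H : R).
Hypothesis (s0_ge : 2^-1 <= s0) (s0_le : s0 <= 1) (H2 : 2 <= H).

Let H0 : 0 < H. Proof. exact: lt_le_trans (ltr0n R 2) H2. Qed.
Let H1 : 1 <= H. Proof. by apply: le_trans H2; rewrite ler1n. Qed.
Let uH : u - H <= u + H. Proof. by move: H0; lra. Qed.

Definition rweight t : R := (1 - ((t - u) / H) ^+ 2) ^+ K.

Lemma weight_real t : weight K s0 u H (s0 +i* t) = (rweight t)%:C.
Proof.
rewrite /weight wpolyE (wmapE s0 u H1) subrr mul0r oppr0.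
rewrite /rweight rmorphXn rmorphB rmorphXn rmorph1; congr (_ ^+ _).
Qed.

Lemma rweight01 t : u - H <= t <= u + H -> 0 <= rweight t <= 1.
Proof.
move=> /andP[t1 t2]; have h : ((t - u) / H) ^+ 2 <= 1.
  rewrite -[leRHS](expr1n _ 2) -[X in X <= _]real_normK ?num_real//.
  rewrite lerXn2r ?nnegrE// normrM normfV (gtr0_norm H0) ler_pdivrMr// mul1r.
  by rewrite ler_norml; lra.
have h2 := sqr_ge0 ((t - u) / H).
by rewrite /rweight exprn_ge0 ?exprn_ile1// ?subr_ge0//; lra.
Qed.

Lemma cont_rweight t : {for t, continuous rweight}.
Proof.
have -> : rweight = fun t => Re (weight K s0 u H (s0 +i* t)).
  by apply/funext => r; rewrite weight_real.
have [l dw] := cdiff_weight K s0 u H (s0 +i* t).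
exact: pcont_Re (pcont_ver (cdiff_cont dw)).
Qed.

Lemma rweight_int_ge : (3 / 4) ^+ K * H <= rint (u - H) (u + H) rweight.
Proof.
have cw a b : cont_on a b rweight by move=> t _; exact: cont_rweight.
have hH : 0 < H / 2 by rewrite divr_gt0.
rewrite (@rint_split _ (u - H) (u + H) (u - H / 2)); [|lra|exact: cw].
rewrite (@rint_split _ (u - H / 2) (u + H) (u + H / 2)); [|lra|exact: cw].
have p1 : 0 <= rint (u - H) (u - H / 2) rweight.
  apply: rint_ge0 => t ht; have /andP[] : 0 <= rweight t <= 1 by apply: rweight01; lra.
  by [].
have p2 : 0 <= rint (u + H / 2) (u + H) rweight.
  apply: rint_ge0 => t ht; have /andP[] : 0 <= rweight t <= 1 by apply: rweight01; lra.
  by [].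
suff : (3 / 4) ^+ K * H <= rint (u - H / 2) (u + H / 2) rweight by lra.
have -> : (3 / 4) ^+ K * H = (3 / 4) ^+ K * ((u + H / 2) - (u - H / 2)) :> R by field.
rewrite -rint_cst; last lra.
apply: rint_le => //; first by move=> t _; exact: cvg_cst.
move=> t /andP[t1 t2]; rewrite /rweight.
have h : ((t - u) / H) ^+ 2 <= 1 / 4.
  have -> : 1 / 4 = 2^-1 ^+ 2 :> R by field.
  rewrite -[X in X <= _]real_normK ?num_real//.
  rewrite lerXn2r ?nnegrE ?invr_ge0// normrM normfV (gtr0_norm H0) ler_pdivrMr//.
  by rewrite ler_norml; lra.
rewrite lerXn2r ?nnegrE ?divr_ge0//; lra.
Qed.

Lemma weight_shift x : s0 <= x <= 2 ->
  cabs (cint (u - H) (u + H) (fun t => weight K s0 u H (x +i* t)) -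
        (rint (u - H) (u + H) rweight)%:C) <= 8 * (8 / H) ^+ K.
Proof.
move=> /andP[x0 x2].
have -> : (rint (u - H) (u + H) rweight)%:C =
    cint (u - H) (u + H) (fun t => weight K s0 u H (s0 +i* t)).
  apply: complex_eq => /=; first by apply: eq_rint => t _; rewrite weight_real.
  rewrite (@eq_rint _ _ _ _ (fun=> 0)) ?rint_cst ?mul0r// => t _.
  by rewrite weight_real.
have hw : chol_rect (weight K s0 u H) s0 x (u - H) (u + H) by move=> z _; exact: cdiff_weight.
have p0 : 0 <= (8 / H) ^+ K by rewrite exprn_ge0// divr_ge0// ltW.
apply: (le_trans (shift_line x0 uH hw (M := (8 / H) ^+ K) _)).
  move=> y t /andP[y1 y2] ht; apply: weight_end_bound => //.
  by apply/andP; split; move: s0_ge; lra.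
have h0 : (0 : R) < 2^-1 by rewrite invr_gt0.
have h2 : x - s0 <= 2 by move: s0_ge; lra.
by move: p0; set p := _ ^+ K => p0; nra.
Qed.

End Main.

End MeanValue.

(** * The duality inequality *)

Section MainInequality.
Context {R : realType}.
Implicit Types (s w z : R[i]) (t x : R).

Lemma cdiff_natpow n s : cdiffable (natpow n : R[i] -> R[i]) s.
Proof.
eexists; apply: cdiff_cexp_comp.
apply: (cdiff_ext _ (cdiffZ (ln n%:R)%:C (cdiff_id s))) => w; exact: mulrC.
Qed.

Lemma cdiffable_dirichlet (J : finType) (b : J -> R[i]) (m : J -> nat) s :
  cdiffable (fun s => \sum_j b j * natpow (m j) s) s.
Proof.
have H j : {l | cdiff (fun s => b j * natpow (m j) s) s l}.
  apply: cid; have [l dl] := cdiff_natpow (m j) s.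
  by exists (b j * l); exact: cdiffZ.
by eexists; apply: cdiff_sum => j; exact: (svalP (H j)).
Qed.

Lemma natpow_conj n (x t : R) : natpow n (x +i* t) * natpow n (- (2 * x) +i* 0) =
  (natpow n (- (x +i* t)))^* :> R[i].
Proof.
rewrite /natpow -cexpD -cexp_conj; congr cexp; apply: complex_eq => /=; ring.
Qed.

Variables (K : nat) (C : R).
Hypothesis HC : forall s0 u H V x th : R,
  s0 <= x <= s0 + 2 -> 2 <= H -> 1 <= V -> V <= H -> th != 0 -> `|th|^-1 <= V ->
  cabs (cint (u - H) (u + H) (fun t => cexp (th%:C * (x +i* t)) * weight K s0 u H (x +i* t)))
   <= expR (th * x) * (C * V * (V / H) ^+ K).

Variables (s0 u H : R) (N : nat) (J : finType) (d : J -> R[i]) (m : J -> nat).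
Hypothesis (s0_ge : 2^-1 <= s0) (s0_le : s0 <= 1) (H2 : 2 <= H).
Hypothesis (N0 : (0 < N)%N) (NH : 2 * N%:R <= H).
Hypothesis (mN : forall j, (0 < m j <= N)%N) (m_inj : injective m).
Variables (F : R[i] -> R[i]) (M A : R).
Hypothesis (hF : chol_rect F s0 2 (u - H) (u + H)) (M0 : 0 <= M).
Hypothesis HM : forall x t, s0 <= x <= 2 -> t = u - H \/ t = u + H -> cabs (F (x +i* t)) <= M.
(** The unimodular c absorbs the ambiguity of the logarithms defining F. [A] is independent of e, so
    e can be removed at the end, and the coefficients at the frequencies [m j] are exactly [d j] for
    every e. *)
Hypothesis approx : forall e : R, 0 < e ->
  exists (I : finType) (a : I -> R[i]) (n : I -> nat) (c : R[i]),
  [/\ cabs c = 1, forall i, (0 < n i)%N,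
    forall t, u - H <= t <= u + H ->
      cabs (c * F (2 +i* t) - \sum_i a i * natpow (n i) (- (2 +i* t))) <= e,
    \sum_i cabs (a i) * expR (- 2 * ln (n i)%:R) <= A &
    forall j, \sum_i (if n i == m j then a i else 0) = d j].

Let dsum : R := \sum_j cabs (d j) ^+ 2 * expR (- (2 * s0) * ln (m j)%:R).
Let S1 : R := \sum_j cabs (d j) * expR ((2 - 2 * s0) * ln (m j)%:R).
Let W s := weight K s0 u H s.
(** On Re s = s0 the conjugate of m^(-s) is m^(s - 2 s0). So the entire function [Ds] coincides
    there with the conjugate of the Dirichlet polynomial with coefficients [d], and can be moved to
    Re s = 2. *)
Let b j := (d j)^* * natpow (m j) (- (2 * s0) +i* 0).
Let Ds s := \sum_j b j * natpow (m j) s.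
Let E := C * (2 * N%:R) * (2 * N%:R / H) ^+ K.

Let lnm j : 0 <= ln (m j)%:R :> R.
Proof. by have /andP[h _] := mN j; rewrite ln_ge0// ler1n. Qed.

Let cabs_b j : cabs (b j) = cabs (d j) * expR (- (2 * s0) * ln (m j)%:R).
Proof. by rewrite cabsM cabs_conj cabs_natpow. Qed.

Let Sb x : x <= 2 -> \sum_j cabs (b j) * expR (x * ln (m j)%:R) <= S1.
Proof.
move=> x2; apply: ler_sum => j _; rewrite cabs_b -mulrA -expRD.
by rewrite ler_wpM2l ?cabs_ge0// ler_expR -mulrDl ler_wpM2r//; lra.
Qed.

Let S1_ge0 : 0 <= S1.
Proof. by apply: sumr_ge0 => j _; rewrite mulr_ge0 ?cabs_ge0 ?expR_ge0. Qed.

Let dsum_ge0 : 0 <= dsum.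
Proof. by apply: sumr_ge0 => j _; rewrite mulr_ge0 ?exprn_ge0 ?cabs_ge0 ?expR_ge0. Qed.

Let H0 : 0 < H. Proof. exact: lt_le_trans (ltr0n R 2) H2. Qed.
Let uH : u - H <= u + H. Proof. by move: H0; lra. Qed.
Let p0 : 0 <= (8 / H) ^+ K. Proof. by rewrite exprn_ge0// divr_ge0// ltW. Qed.

Let Ds_bound x t : x <= 2 -> cabs (Ds (x +i* t)) <= S1.
Proof.
move=> /Sb; apply: le_trans; rewrite (le_trans (cabs_sum _ _ _))//.
by apply: ler_sum => j _; rewrite cabsM cabs_natpow.
Qed.

Let E_ge0 : 0 <= E.
Proof.
have q : 1 <= 2 * N%:R :> R by have : 1 <= N%:R :> R; [rewrite ler1n|lra].
have := HC u (_ : s0 <= s0 <= s0 + 2) H2 q NH (oner_neq0 R).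
rewrite normr1 invr1 => /(_ (_ : _ <= _ <= _)) h.
have hs : s0 <= s0 <= s0 + 2 by apply/andP; split; lra.
have := le_trans (cabs_ge0 _) (h hs q); by rewrite pmulr_rge0// expR_gt0.
Qed.

Let diag_dsum : \sum_j b j * d j = dsum%:C.
Proof.
rewrite /dsum rmorph_sum; apply: eq_bigr => j _.
by rewrite /b natpow_real mulrAC (mulrC _^*) mulJ -rmorphM.
Qed.

Let MV x (I : finType) (a : I -> R[i]) (n : I -> nat) : s0 <= x <= 2 ->
  (forall i, 0 < n i)%N ->
  (forall j, \sum_i (if n i == m j then a i else 0) = d j) ->
  cabs (cint (u - H) (u + H) (fun t => (\sum_i a i * natpow (n i) (- (x +i* t)))
      * Ds (x +i* t) * W (x +i* t)) -
    cint (u - H) (u + H) (fun t => W (x +i* t)) * dsum%:C) <=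
  (\sum_i cabs (a i) * expR (- x * ln (n i)%:R)) * S1 * E.
Proof.
move=> /andP[x0 x2] n0 hd.
have hx : s0 <= x <= s0 + 2 by apply/andP; split=> //; have := s0_ge; have : (0 : R) <= 2^-1; [rewrite invr_ge0|lra].
have := @mean_value_approx R K N C s0 u H x I J a n b m
  (fun V th V1 VH th0 thV => HC u hx H2 V1 VH th0 thV) n0 mN N0 NH.
have -> : \sum_i \sum_j (if n i == m j then a i * b j else 0) = dsum%:C.
  rewrite exchange_big -diag_dsum; apply: eq_bigr => j _.
  rewrite -hd mulr_sumr; apply: eq_bigr => i _.
  by case: ifP; rewrite ?mulr0// mulrC.
move=> /le_trans; apply; rewrite -/E ler_wpM2r// ler_wpM2l//.
  by apply: sumr_ge0 => i _; rewrite mulr_ge0 ?cabs_ge0 ?expR_ge0.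
exact: Sb.
Qed.

Let cF z : in_rect s0 2 (u - H) (u + H) z ->
  cdiffable (fun s => F s * Ds s * W s) z.
Proof.
move=> hz; have [l1 d1] := hF hz; have [l2 d2] := cdiffable_dirichlet b m z.
have [l3 d3] := cdiff_weight K s0 u H z.
by eexists; exact: cdiffM (cdiffM d1 d2) d3.
Qed.

Let s02 : s0 <= 2. Proof. by rewrite (le_trans s0_le)// ler1n. Qed.

Let in_line x t : s0 <= x <= 2 -> u - H <= t <= u + H -> in_rect s0 2 (u - H) (u + H) (x +i* t).
Proof. by []. Qed.

Let weight_right t : u - H <= t <= u + H -> cabs (W (2 +i* t)) <= 5 ^+ K.
Proof.
move=> /andP[t1 t2]; rewrite /W /weight wpolyE cabsX lerXn2r ?nnegrE ?cabs_ge0//.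
rewrite wmapE; last by rewrite (le_trans _ H2)// ler1n.
rewrite (le_trans (cabsB _ _))// cabs1 cabsX.
suff : cabs (((t - u) / H) +i* - ((2 - s0) / H)) ^+ 2 <= 2 ^+ 2 by rewrite (_ : 2 ^+ 2 = 4); [lra|ring].
rewrite lerXn2r ?nnegrE ?cabs_ge0// (le_trans (cabs_le_ReIm _))//= normrN !normrM normfV (gtr0_norm H0).
have h1 : `|t - u| / H <= 1 by rewrite ler_pdivrMr// mul1r ler_norml; lra.
have h2 : `|2 - s0| / H <= 1.
  rewrite ler_pdivrMr// mul1r ger0_norm; last by have := s02; lra.
  have := s0_ge; have : (0 : R) <= 2^-1 by [rewrite invr_ge0]; have := H2; lra.
lra.
Qed.

(** The four errors, in the order of the bound: moving F Ds W from s0 to 2, replacing c F by a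
    Dirichlet polynomial, the off-diagonal terms, and moving the integral of the weight back to
    s0. *)
Let line_bound (c : R[i]) (e : R) (I : finType) (a : I -> R[i]) (n : I -> nat) : 0 <= e ->
  cabs c = 1 -> (forall i, 0 < n i)%N ->
  (forall t, u - H <= t <= u + H ->
      cabs (c * F (2 +i* t) - \sum_i a i * natpow (n i) (- (2 +i* t))) <= e) ->
  \sum_i cabs (a i) * expR (- 2 * ln (n i)%:R) <= A ->
  (forall j, \sum_i (if n i == m j then a i else 0) = d j) ->
  cabs (c * cint (u - H) (u + H) (fun t => F (s0 +i* t) * Ds (s0 +i* t) * W (s0 +i* t))
    - (rint (u - H) (u + H) (rweight K u H) * dsum)%:C) <=
  8 * (M * S1 * (8 / H) ^+ K) + e * (S1 * 5 ^+ K * (4 * H)) + A * S1 * E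
  + 8 * (8 / H) ^+ K * dsum.
Proof.
move=> e0 c1 n0 hc hA hd.
set I0 := cint _ _ _.
pose I2 := cint (u - H) (u + H) (fun t => F (2 +i* t) * Ds (2 +i* t) * W (2 +i* t)).
pose IQ := cint (u - H) (u + H) (fun t => (\sum_i a i * natpow (n i) (- (2 +i* t)))
      * Ds (2 +i* t) * W (2 +i* t)).
pose om := cint (u - H) (u + H) (fun t => W (2 +i* t)).
have s0pos : 0 <= s0 by rewrite (le_trans _ s0_ge)// invr_ge0.
have l22 : s0 <= 2 <= (2 : R) by apply/andP; split; [exact: s02|exact: lexx].
have e1 : cabs (I2 - I0) <= 8 * (M * S1 * (8 / H) ^+ K).
  apply: (le_trans (@shift_line _ (fun s => F s * Ds s * W s) s0 2 (u - H) (u + H)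
     (M * S1 * (8 / H) ^+ K) s02 uH cF _)).
    move=> x t hx ht; rewrite !cabsM; have /andP[x0 x2] := hx.
    apply: ler_pM; rewrite ?mulr_ge0 ?cabs_ge0//.
      by apply: ler_pM; rewrite ?cabs_ge0 ?Ds_bound ?HM.
    have H1 : 1 <= H by rewrite (le_trans _ H2)// ler1n.
    by apply: weight_end_bound => //; apply/andP; split=> //; lra.
  have : 0 <= M * S1 * (8 / H) ^+ K by rewrite mulr_ge0// mulr_ge0.
  set q := M * S1 * _ => q0; have : 2 - s0 <= 2 by lra.
  by nra.
have cl (G : R[i] -> R[i]) : (forall z, in_rect s0 2 (u - H) (u + H) z -> cdiffable G z) ->
    pcont_on (u - H) (u + H) (fun t => G (2 +i* t)).
  move=> dG t ht; apply: pcont_ver; have [l] := dG _ (in_line l22 ht).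
  exact: cdiff_cont.
have cDs : pcont_on (u - H) (u + H) (fun t => Ds (2 +i* t)).
  by apply: cl => z _; exact: cdiffable_dirichlet.
have cW : pcont_on (u - H) (u + H) (fun t => W (2 +i* t)).
  by apply: cl => z _; exact: cdiff_weight.
have cQ : pcont_on (u - H) (u + H) (fun t => \sum_i a i * natpow (n i) (- (2 +i* t))).
  apply: pcont_on_sum => i; apply: pcont_onM; first exact: pcont_on_cst.
  apply: (cl (fun s => natpow (n i) (- s))) => z _.
  have [l dl] := cdiff_natpow (n i) (- z).
  by eexists; exact: (cdiff_comp (cdiffN (cdiff_id z)) dl).
have cFl : pcont_on (u - H) (u + H) (fun t => F (2 +i* t)) by apply: cl => z /hF.
have e2 : cabs (c * I2 - IQ) <= e * (S1 * 5 ^+ K * (4 * H)).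
  rewrite /I2 -cintZ; last by apply: pcont_onM => //; exact: pcont_onM.
  rewrite /IQ -cintB; first last.
  - by apply: pcont_onM => //; exact: pcont_onM.
  - apply: pcont_onM; first exact: pcont_on_cst.
    by apply: pcont_onM => //; exact: pcont_onM.
  apply: (le_trans (@cint_bound _ _ _ _ (e * S1 * 5 ^+ K) uH _ _)).
  - apply: pcont_onD; last by apply: pcont_onN; apply: pcont_onM => //; exact: pcont_onM.
    apply: pcont_onM; first exact: pcont_on_cst.
    by apply: pcont_onM => //; exact: pcont_onM.
  - move=> t ht; rewrite !mulrA -mulrBl -mulrBl !cabsM.
    apply: ler_pM; rewrite ?mulr_ge0 ?cabs_ge0 ?weight_right//.
    by apply: ler_pM; rewrite ?cabs_ge0 ?Ds_bound ?hc.
  - by rewrite le_eqVlt; apply/orP; left; apply/eqP; ring.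
have e3 : cabs (IQ - om * dsum%:C) <= A * S1 * E.
  by rewrite (le_trans (MV l22 n0 hd))// ler_wpM2r// ler_wpM2r.
have e4 : cabs (om - (rint (u - H) (u + H) (rweight K u H))%:C) <= 8 * (8 / H) ^+ K.
  exact: weight_shift.
set om0 := rint _ _ _ in e4 *.
have -> : c * I0 - (om0 * dsum)%:C = - (c * (I2 - I0)) + (c * I2 - IQ) + (IQ - om * dsum%:C)
   + (om - om0%:C) * dsum%:C by rewrite rmorphM; ring.
rewrite (le_trans (cabsD _ _))// lerD//; last first.
  by rewrite cabsM cabs_real (ger0_norm dsum_ge0) ler_wpM2r.
rewrite (le_trans (cabsD _ _))// lerD// (le_trans (cabsD _ _))// lerD//.
by rewrite cabsN cabsM c1 mul1r.
Qed.

Theorem main_inequality :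
  rint (u - H) (u + H) (rweight K u H) * dsum <=
  rint (u - H) (u + H) (fun t => cabs (F (s0 +i* t)) ^+ 2) +
  16 * (M * S1 * (8 / H) ^+ K) + 16 * (8 / H) ^+ K * dsum + (2 * A * S1 + S1 ^+ 2) * E.
Proof.
have l0 : s0 <= s0 <= 2 by apply/andP; split; [exact: lexx|exact: s02].
pose B := S1 * 5 ^+ K * (4 * H).
have B0 : 0 <= B by rewrite mulr_ge0 ?mulr_ge0 ?exprn_ge0// ltW.
apply/ler_addgt0Pr => e e0.
have eB : 0 < e / (2 * (B + 1)) by rewrite divr_gt0// mulr_gt0//; lra.
have [I [a [n [c [c1 n0 hc hA hd]]]]] := approx eB.
have h1 := line_bound (ltW eB) c1 n0 hc hA hd.
pose D t := \sum_j d j * natpow (m j) (- (s0 +i* t)).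
(* The mean square of D is the same mean value estimate with coefficients [d] and frequencies [m];
   by injectivity of [m] its diagonal is again [dsum]. *)
have hdd j : \sum_i (if m i == m j then d i else 0) = d j.
  rewrite (bigD1 j)//= eqxx big1 ?addr0// => i ij.
  by rewrite (inj_eq m_inj) (negbTE ij).
have h2 := @MV s0 J d m l0 (fun j => (andP (mN j)).1) hdd.
set ID := cint _ _ _ in h2; set om := cint _ _ _ in h2.
set om0 := rint _ _ _ in h1 *.
have omE : om = om0%:C.
  apply: complex_eq => /=.
    by apply: eq_rint => t _; rewrite /W weight_real.
  rewrite (@eq_rint _ _ _ _ (fun=> 0)) ?rint_cst ?mul0r// => t _.
  by rewrite /W weight_real.
have {}h2 : cabs (ID - (om0 * dsum)%:C) <= S1 ^+ 2 * E.
  rewrite real_complexM -omE (le_trans h2)// expr2 ler_wpM2r// ler_wpM2r//.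
  apply: ler_sum => j _; rewrite ler_wpM2l ?cabs_ge0// ler_expR ler_wpM2r//.
  by have := s0_le; have := s0_ge; have : (0 : R) <= 2^-1 by [rewrite invr_ge0]; lra.
set I0 := cint _ _ _ in h1.
have cl (G : R[i] -> R[i]) : (forall z, in_rect s0 2 (u - H) (u + H) z -> cdiffable G z) ->
    pcont_on (u - H) (u + H) (fun t => G (s0 +i* t)).
  move=> dG t ht; apply: pcont_ver; have [l] := dG _ (in_line l0 ht).
  exact: cdiff_cont.
have cI0 : pcont_on (u - H) (u + H) (fun t => F (s0 +i* t) * Ds (s0 +i* t) * W (s0 +i* t)).
  exact: (cl _ cF).
have cID : pcont_on (u - H) (u + H) (fun t => D t * Ds (s0 +i* t) * W (s0 +i* t)).
  apply: pcont_onM; last by apply: cl => z _; exact: cdiff_weight.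
  apply: pcont_onM; last by apply: cl => z _; exact: cdiffable_dirichlet.
  apply: pcont_on_sum => i; apply: pcont_onM; first exact: pcont_on_cst.
  apply: (cl (fun s => natpow (m i) (- s))) => z _.
  have [l dl] := cdiff_natpow (m i) (- z).
  by eexists; exact: (cdiff_comp (cdiffN (cdiff_id z)) dl).
have key : 2 * Re (c * I0) - Re ID <= rint (u - H) (u + H) (fun t => cabs (F (s0 +i* t)) ^+ 2).
  rewrite /I0 -cintZ//= -[X in _ + X]mulN1r -!rintZ; first last.
  - by apply: pcont_on_Re; apply: pcont_onM => //; exact: pcont_on_cst.
  - by apply: pcont_on_Re.
  rewrite -rintD; first last.
  - by apply: cont_onZ; apply: pcont_on_Re.
  - by apply: cont_onZ; apply: pcont_on_Re; apply: pcont_onM => //; exact: pcont_on_cst.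
  apply: rint_le.
  - move=> t ht; apply: cvgD.
      by apply: cont_onZ ht; apply: pcont_on_Re; apply: pcont_onM => //; exact: pcont_on_cst.
    by apply: cont_onZ ht; apply: pcont_on_Re.
  - move=> t ht; have contF : {for t, continuous (fun t => cabs (F (s0 +i* t)))}.
      by apply: pcont_cabs; apply: (cl F) => // z /hF.
    exact: (@cvgM _ _ _ _ _ _ _ _ contF contF).
  move=> t ht.
  have DsE : Ds (s0 +i* t) = (D t)^*.
    rewrite /D /Ds rmorph_sum; apply: eq_bigr => j _.
    by rewrite /b -mulrA (mulrC (natpow _ _)) natpow_conj rmorphM.
  rewrite /W weight_real// DsE mulrA !ReMr mulJ /=.
  set w := rweight K u H t; have /andP[w0 w1] : 0 <= w <= 1 by apply: rweight01.
  set X := c * (F (s0 +i* t) * (D t)^*).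
  have hX : 0 <= cabs (F (s0 +i* t)) ^+ 2 - 2 * Re X + cabs (D t) ^+ 2.
    have -> : cabs (F (s0 +i* t)) ^+ 2 = cabs (c * F (s0 +i* t)) ^+ 2.
      by rewrite cabsM c1 mul1r.
    rewrite !cabs_sqr; set Y := c * F _; have -> : X = Y * (D t)^* by rewrite /X /Y mulrA.
    have -> : Re (Y * (D t)^*) = Re Y * Re (D t) + Im Y * Im (D t).
      by rewrite ReM; case: (D t) => p q /=; ring.
    have := sqr_ge0 (Re Y - Re (D t)); have := sqr_ge0 (Im Y - Im (D t)); lra.
  have F0 : 0 <= cabs (F (s0 +i* t)) ^+ 2 by rewrite exprn_ge0 ?cabs_ge0.
  move: hX F0; set f2 := cabs (F _) ^+ 2; set D2 := cabs (D t) ^+ 2; set rx := Re X.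
  have -> : 2 * (rx * w) + -1 * (D2 * w) = (2 * rx - D2) * w by ring.
  move=> hX F0; apply: (@le_trans _ _ (f2 * w)); last by rewrite ler_piMr.
  by rewrite ler_wpM2r//; lra.
have r1 : om0 * dsum - cabs (c * I0 - (om0 * dsum)%:C) <= Re (c * I0).
  have := Re_le_cabs (c * I0 - (om0 * dsum)%:C); rewrite ReD ReN /= ler_norml => /andP[]; lra.
have r2 : Re ID <= om0 * dsum + cabs (ID - (om0 * dsum)%:C).
  have := Re_le_cabs (ID - (om0 * dsum)%:C); rewrite ReD ReN /= ler_norml => /andP[_]; lra.
have eBe : 2 * (e / (2 * (B + 1)) * B) <= e.
  have -> : 2 * (e / (2 * (B + 1)) * B) = e * (B / (B + 1)) by field; rewrite gt_eqF//; lra.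
  by rewrite ler_piMr ?(ltW e0)// ler_pdivrMr; lra.
move: h1 h2 key r1 r2 eBe; rewrite -/B.
set q1 := cabs _; set q2 := cabs _.
have -> : (2 * A * S1 + S1 ^+ 2) * E = 2 * (A * S1 * E) + S1 ^+ 2 * E by ring.
have -> : 16 * (8 / H) ^+ K * dsum = 2 * (8 * (8 / H) ^+ K * dsum) by ring.
lra.
Qed.

End MainInequality.

(** * Dirichlet polynomial approximation on the line of real part 2 *)

Section LineApproximation.
Context {R : realType}.
Implicit Types (s w z : R[i]) (x t e : R).

(** That exp(rho) is near 1 only places rho near some multiple of 2 pi i. Starting from 0, rho
    cannot reach another multiple: |rho| would take a value strictly between 2e and d on the way,
    where |exp(w) - 1| >= |w| / 2 > e. *)
Lemma continuous_log_small (rho : R -> R[i]) (t0 t1 d e : R) : t0 <= t1 ->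
  (forall w, cabs w < d -> cabs w / 2 <= cabs (cexp w - 1)) -> 0 <= e -> 2 * e < d ->
  pcont_on t0 t1 rho -> rho t0 = 0 ->
  (forall t, t0 <= t <= t1 -> cabs (cexp (rho t) - 1) <= e) ->
  forall t, t0 <= t <= t1 -> cabs (rho t) <= 2 * e.
Proof.
move=> t01 Hd e0 ed crho rho0 He t ht; rewrite leNgt; apply/negP => lt.
pose h r := cabs (rho r); have /andP[h1 h2] := ht.
pose v := Num.min (h t) ((2 * e + d) / 2).
have v1 : 2 * e < v by rewrite lt_min lt /=; lra.
have v2 : v < d by rewrite gt_min; apply/orP; right; lra.
have ch : {within `[t0, t], continuous h}.
  by apply: cont_on_within => r /andP[r1 r2]; apply: pcont_cabs; apply: crho; lra.
have h0 : h t0 = 0 by rewrite /h rho0 cabs0.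
have [|r] := IVT h1 ch (v := v).
  rewrite h0 ge_min le_max; apply/andP; split; first by apply/orP; left; lra.
  by apply/orP; right; rewrite ge_min lexx.
rewrite in_itv /= => /andP[r1 r2] hr.
have rt : t0 <= r <= t1 by rewrite r1 (le_trans r2).
have := Hd (rho r); rewrite -/(h r) hr => /(_ v2).
have := He _ rt; lra.
Qed.

Lemma cexp_sub1_le : exists2 d : R, 0 < d & forall w : R[i], cabs w < d ->
  cabs (cexp w - 1) <= 2 * cabs w.
Proof.
have [d d0 H] := @cdiff_cexp0 R 1 ltr01.
exists d => // w /H; rewrite add0r cexp0 !mul1r => hw.
have -> : cexp w - 1 = (cexp w - 1 - w) + w by ring.
by rewrite (le_trans (cabsD _ _))//; lra.
Qed.

Lemma sum_prime_line2 Y s : Re s = 2 ->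
  \sum_(1 <= p < Y.+1 | prime p) cabs (natpow p (- s)) <= 1.
Proof.
move=> s2; apply: le_trans (@sum_prime_squares R 1 Y _); last by [].
rewrite le_eqVlt; apply/orP; left; apply/eqP; apply: eq_bigr => p _.
by rewrite !cabs_natpow !ReN s2 -expRM_natl /=; congr expR; ring.
Qed.

Lemma Lsum_line2 Y J s : Re s = 2 -> cabs (Lsum Y J s) <= 2.
Proof.
move=> s2; rewrite (le_trans (cabs_sum _ _ _))//.
apply: (@le_trans _ _ (2 * \sum_(1 <= p < Y.+1 | prime p) cabs (natpow p (- s)))).
  rewrite mulr_sumr; apply: ler_sum => p pp; apply: Lam_bound.
  by apply: natpow_prime_half => //; rewrite s2 ler1n.
by have := @sum_prime_line2 Y s s2; lra.
Qed.

Lemma near1_Re w d : cabs (cexp w - 1) <= d -> d <= 2^-1 -> `|Re w| <= 2 * d.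
Proof.
move=> h d2; have h0 := le_trans (cabs_ge0 _) h.
have q2 : (2^-1 : R) < 1 by rewrite invf_lt1// ltr1n.
have h1 := cabsB_ge (cexp w) 1; have h2 := cabsB_ge 1 (cexp w).
rewrite cabsBC in h2; rewrite cabs1 cabs_cexp in h1 h2.
have e1 := expR_ge1Dx (Re w); have e2 := expR_ge1Dx (- Re w).
rewrite expRN in e2.
have e3 : (expR (Re w))^-1 <= 1 + 2 * d.
  rewrite -div1r ler_pdivrMr ?expR_gt0//.
  apply: (@le_trans _ _ ((1 + 2 * d) * (1 - d))); last by rewrite ler_wpM2l//; lra.
  have : 0 <= d * (2^-1 - d) by rewrite mulr_ge0// subr_ge0.
  have -> : d * (2^-1 - d) = d * 2^-1 - d * d by ring.
  lra.
by rewrite ler_norml; lra.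
Qed.

Lemma cexp_ratio_near1 z w d : cabs (cexp z - 1) <= d -> cabs (cexp w - 1) <= d ->
  d <= 2^-1 -> cabs (cexp (z - w) - 1) <= 4 * d.
Proof.
rewrite cexpB; have := @cexp_neq0 R w; move: (cexp z) (cexp w) => a b b0 ha hb d2.
have -> : a / b - 1 = ((a - 1) - (b - 1)) / b by field.
have q2 : (2^-1 : R) < 1 by rewrite invf_lt1// ltr1n.
have hh : 2^-1 <= cabs b by have := cabsB_ge 1 (1 - b); rewrite cabs1 subKr (cabsBC 1); lra.
have c0 : 0 < cabs b by rewrite cabs_gt0.
rewrite cabsM cabsV ler_pdivrMr// (le_trans (cabsB _ _))// (le_trans (lerD ha hb))//.
have d0 := le_trans (cabs_ge0 _) ha.
have : 4 * d * 2^-1 <= 4 * d * cabs b by rewrite ler_wpM2l// mulr_ge0.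
lra.
Qed.

Hypothesis RH : riemann_hypothesis R.

(** Along the segment [g k] minus [Lsum] stays close to one multiple of 2 pi i. Since [beta k] need
    not be an integer, these multiples survive exponentiation as a phase, and c removes it. *)
Lemma log_zeta_product_approx (m : nat) (alpha beta : 'I_m -> R) (g : 'I_m -> R[i] -> R[i])
    (t0 t1 : R) : (forall k, 0 <= beta k) -> t0 <= t1 ->
  (forall k t, t0 <= t <= t1 -> cdiffable (g k) (2 +i* t) /\
     cexp (g k (2 +i* t)) = zeta (2 +i* (t + alpha k))) ->
  forall e, 0 < e -> exists Y0, forall Y, (Y0 <= Y)%N -> exists J0, forall J, (J0 <= J)%N ->
  exists2 c, cabs c = 1 & forall t, t0 <= t <= t1 ->
    cabs (c * cexp (\sum_k (beta k)%:C * g k (2 +i* t)) -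
      cexp (\sum_k (beta k)%:C * Lsum Y J (2 +i* (t + alpha k)))) <= e.
Proof.
move=> b0 t01 Hg e e0.
pose B := \sum_k beta k; have B0 : 0 <= B by apply: sumr_ge0.
have [d d0 Hd] := @cexp_sub1_ge R; have [d' d'0 Hd'] := cexp_sub1_le.
pose Q := expR (2 * B) * 2; have Q0 : 0 < Q by rewrite mulr_gt0 ?expR_gt0.
pose D := 10 * (B + 1); have D0 : 0 < D by rewrite mulr_gt0//; lra.
(* In turn: exp([r k]) stays away from 0; 8 [del] < d keeps the continuity argument inside its
   radius; the total deviation [eta], at most D [del], stays below d' and below e / Q. *)
pose del := Num.min (Num.min 2^-1 (d / 9)) (Num.min (d' / D / 2) (e / Q / D)).
have del0 : 0 < del.
  have q1 : 0 < d / 9 by rewrite divr_gt0.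
  have q2 : 0 < d' / D / 2 by rewrite divr_gt0// divr_gt0.
  have q3 : 0 < e / Q / D by rewrite divr_gt0// divr_gt0.
  by rewrite !lt_min q1 q2 q3 invr_gt0 ltr0n.
have [m1 m2 m3 m4] : [/\ del <= 2^-1, del <= d / 9, del <= d' / D / 2 & del <= e / Q / D].
  by have := lexx del; rewrite {2}/del !le_min => /andP[/andP[-> ->] /andP[-> ->]].
have [Y0 HY] := Lsum_approx RH (@ltr01 R) del0.
exists Y0 => Y YY; have [J0 HJ] := HY Y YY; exists J0 => J JJ.
pose r k t := g k (2 +i* t) - Lsum Y J (2 +i* (t + alpha k)).
have er k t : t0 <= t <= t1 -> cabs (cexp (r k t) - 1) <= del.
  move=> ht; have [_ E] := Hg k t ht.
  by rewrite /r cexpD E HJ//=.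
have t00 : t0 <= t0 <= t1 by rewrite lexx.
have crho k : pcont_on t0 t1 (fun t => r k t - r k t0).
  move=> t ht; have [[l dg] _] := Hg k t ht.
  have cL : ccont (fun s => Lsum Y J (s + (0 +i* alpha k))) (2 +i* t).
    have dL p s : cdiff (fun s => if prime p then Lam J (natpow p (- s)) else 0) s
        (if prime p then (\sum_(0 <= j < J) natpow p (- s) ^+ j) * (cexp (- s * (ln p%:R)%:C) * ((ln p%:R)%:C * -1)) else 0).
      case: (prime p); last exact: cdiff_cst.
      apply: cdiff_comp (cdiff_Lam J _); apply: cdiff_cexp_comp.
      apply: (cdiff_ext _ (cdiffZ (ln p%:R)%:C (cdiffN (cdiff_id s)))) => w; exact: mulrC.
    have dS s := @cdiff_sum R nat (index_iota 1 Y.+1) _ _ s (fun p => dL p s).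
    have dsh := cdiffD (cdiff_id (2 +i* t)) (cdiff_cst (0 +i* alpha k) (2 +i* t)).
    apply: cdiff_cont (cdiff_ext _ (cdiff_comp dsh (dS _))) => w.
    by rewrite /Lsum [RHS]big_mkcond.
  have p1 := pcont_ver (cdiff_cont dg); have p2 := pcont_ver cL.
  have p3 : pcont (fun x => - Lsum Y J (2 +i* (x + alpha k))) t.
    apply: (@pcont_ext _ (fun x => -1 * Lsum Y J (2 +i* x + (0 +i* alpha k)))).
      move=> x; rewrite mulN1r; congr (- Lsum Y J _); apply: complex_eq => /=; ring.
    exact: pcontM (pcont_cst _ _) p2.
  exact: (pcontD (pcontD p1 p3) (pcont_cst (- r k t0) t)).
have rho_small k t : t0 <= t <= t1 -> cabs (r k t - r k t0) <= 8 * del.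
  have -> : 8 * del = 2 * (4 * del) by ring.
  apply: (continuous_log_small t01 Hd _ _ (crho k)); [lra|lra|exact: subrr|].
  by move=> t' ht'; exact: cexp_ratio_near1 (er k _ ht') (er k _ t00) m1.
pose w0 := \sum_k (beta k)%:C * r k t0.
exists (cexp (0 +i* - Im w0)); first by rewrite cabs_cexp expR0.
move=> t ht.
pose P := \sum_k (beta k)%:C * Lsum Y J (2 +i* (t + alpha k)).
pose eta := \sum_k (beta k)%:C * (r k t - r k t0) + (Re w0)%:C.
have -> : cexp (0 +i* - Im w0) * cexp (\sum_k (beta k)%:C * g k (2 +i* t)) = cexp P * cexp eta.
  rewrite -!cexpD /eta; congr cexp.
  have -> : \sum_k (beta k)%:C * g k (2 +i* t) = P + \sum_k (beta k)%:C * (r k t - r k t0) + w0.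
    by rewrite /P /w0 -!big_split /=; apply: eq_bigr => k _; rewrite -!mulrDr -addrA subrK /r subrKC.
  have <- : w0 + (0 +i* - Im w0) = (Re w0)%:C by apply: complex_eq; rewrite ?ReD ?ImD /=; ring.
  by rewrite [LHS]addrC !addrA.
have heta : cabs eta <= D * del.
  have s1 : cabs (\sum_k (beta k)%:C * (r k t - r k t0)) <= B * (8 * del).
    rewrite (le_trans (cabs_sum _ _ _))// mulr_suml; apply: ler_sum => k _.
    by rewrite cabsM cabs_real ger0_norm// ler_wpM2l// rho_small.
  have s2 : `|Re w0| <= B * (2 * del).
    rewrite /w0 Re_sum (le_trans (ler_norm_sum _ _ _))// mulr_suml; apply: ler_sum => k _.
    rewrite mulrC ReMr normrM (ger0_norm (b0 k)) mulrC ler_wpM2l//.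
    exact: near1_Re (er k _ t00) m1.
  rewrite (le_trans (cabsD _ _))// cabs_real (le_trans (lerD s1 s2))// /D.
  have : 0 <= del * 10 by lra.
  lra.
have hd' : cabs eta < d'.
  rewrite (le_lt_trans heta)//; rewrite ler_pdivlMr// ler_pdivlMr// in m3.
  have : 0 < del * D by rewrite mulr_gt0.
  lra.
have hP : cabs (cexp P) <= expR (2 * B).
  rewrite cabs_cexp ler_expR (le_trans (ler_norm _))// (le_trans (Re_le_cabs _))//.
  rewrite (le_trans (cabs_sum _ _ _))// mulr_sumr; apply: ler_sum => k _.
  by rewrite cabsM cabs_real ger0_norm// mulrC ler_wpM2r// Lsum_line2.
rewrite -/P -[X in _ - X]mulr1 -mulrBr cabsM.
rewrite (le_trans (ler_pM (cabs_ge0 _) (cabs_ge0 _) hP (Hd' _ hd')))//.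
rewrite mulrA -/Q.
have mD : del * D <= e / Q by rewrite -(ler_pdivlMr _ _ D0).
have hQ : cabs eta <= e / Q by rewrite (le_trans heta)// mulrC.
by rewrite mulrC -(ler_pdivlMr _ _ Q0).
Qed.

End LineApproximation.

(** * Truncated exponentials and coefficientwise majorants *)

Section Majorants.
Context {R : realType}.
Implicit Types (s w z v : R[i]) (x t e : R) (p q : {poly R[i]}) (P Q : {poly R}).

Definition texp n v : R[i] := \sum_(0 <= r < n) v ^+ r / r`!%:R.

Lemma cdiff_texp n v : cdiff (texp n.+1) v (texp n v).
Proof.
have d := cdiff_sum (index_iota 0 n.+1) (fun r => cdiffZ (r`!%:R)^-1 (cdiffX r v)).
apply: (cdiff_exteq d) => [w|]; first by apply: eq_bigr => r _; rewrite mulrC.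
rewrite big_nat_recl// mul0r mulr0 add0r; apply: eq_bigr => r _ /=.
rewrite factS natrM.
have r0 : r.+1%:R != 0 :> R[i] by rewrite pnatr_eq0.
by rewrite invfM mulrACA mulVf// mul1r mulrC.
Qed.

(** The derivative of texp(w) exp(-w) collapses to -(w^n / n!) exp(-w), which is integrated from 0
    to v. *)
Lemma texp_approx n v b : cabs v <= b ->
  cabs (texp n.+1 v * cexp (- v) - 1) <= 2 * (b ^+ n.+1 / n`!%:R * expR b).
Proof.
move=> vb; have c0 := cabs_ge0 v; have b0 := le_trans c0 vb.
pose Phi w := texp n.+1 w * cexp (- w).
have dPhi w : cdiff Phi w (- (w ^+ n / n`!%:R * cexp (- w))).
  have dm := cdiff_cexp_comp (cdiffN (cdiff_id w)).
  apply: (cdiff_exteq (cdiffM (cdiff_texp n w) dm)) => //.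
  have -> : texp n.+1 w = texp n w + w ^+ n / n`!%:R by rewrite /texp big_nat_recr.
  ring.
have cP w : ccont (fun w => - (w ^+ n / n`!%:R * cexp (- w))) w.
  apply: cdiff_cont; apply: cdiffN; apply: cdiffM (cdiff_cexp_comp (cdiffN (cdiff_id w))).
  by apply: (cdiff_ext _ (cdiffZ (n`!%:R)^-1 (cdiffX n w))) => z; rewrite mulrC.
pose G w := - (w ^+ n / n`!%:R * cexp (- w)).
have cp : pcont_on 0 1 (fun t => G (0 + t%:C * v) * v).
  by move=> t _; apply: pcontM (pcont_cst _ _); exact: (pcont_line (cP _)).
have := cint_FTC (q := fun t => Phi (0 + t%:C * v)) (ler01 : 0 <= 1 :> R) cp
  (fun t _ => pdiff_line (dPhi _)).
have -> : 0 + (1 : R)%:C * v = v by rewrite rmorph1 mul1r add0r.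
have -> : 0 + (0 : R)%:C * v = 0 by rewrite rmorph0 mul0r addr0.
have -> : Phi 0 = 1.
  rewrite /Phi /texp big_nat_recl// big1 ?addr0; last by move=> r _; rewrite expr0n mul0r.
  by rewrite expr0 fact0 invr1 mulr1 oppr0 cexp0 mulr1.
rewrite -[Phi v]/(texp n.+1 v * cexp (- v)) => <-.
apply: (le_trans (cint_bound (ler01 : 0 <= 1 :> R) cp (M := b ^+ n.+1 / n`!%:R * expR b) _)).
  move=> t /andP[t0 t1].
  have tv : cabs (0 + t%:C * v) <= b.
    by rewrite add0r cabsM cabs_real ger0_norm// (le_trans _ vb)// ler_piMl.
  rewrite /G !cabsM cabsN !cabsM cabsX cabsV cabs_cexp.
  have -> : cabs (n`!%:R : R[i]) = n`!%:R.
    by rewrite -(rmorph_nat (real_complex R)) cabs_real ger0_norm.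
  have -> : b ^+ n.+1 / n`!%:R * expR b = b ^+ n / n`!%:R * expR b * b by rewrite exprSr; ring.
  apply: ler_pM; rewrite ?mulr_ge0 ?exprn_ge0 ?invr_ge0 ?cabs_ge0 ?expR_ge0//.
  apply: ler_pM; rewrite ?mulr_ge0 ?exprn_ge0 ?invr_ge0 ?cabs_ge0 ?expR_ge0//.
    by rewrite ler_wpM2r ?invr_ge0// lerXn2r ?nnegrE ?cabs_ge0.
  by rewrite ler_expR (le_trans (ler_norm _))// (le_trans (Re_le_cabs _))// cabsN.
by rewrite subr0 mulr1.
Qed.

Lemma exp_coeff_small (b e : R) : 0 < e -> exists n0, forall n, (n0 <= n)%N ->
  b ^+ n / n`!%:R <= e.
Proof.
move=> e0; have /cvg_series_cvg_0/cvgrPdist_le/(_ _ e0)[n0 _ H] := is_cvg_series_exp_coeff b.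
exists n0 => n /H; rewrite sub0r normrN => /(le_trans (ler_norm _)).
by rewrite /exp_coeff.
Qed.

Lemma texp_real_le n (x : R) : 0 <= x -> \sum_(0 <= r < n) x ^+ r / r`!%:R <= expR x.
Proof.
move=> x0; apply: (@nondecreasing_cvgn_le _ (series (exp_coeff x))).
  apply: nondecreasing_series => k _ _.
  by rewrite /exp_coeff divr_ge0 ?exprn_ge0.
exact: is_cvg_series_exp_coeff.
Qed.

(** Domination by a real polynomial bounds the sum of absolute coefficients of [lpoly] without
    computing them. *)
Definition majorized p P := forall i, cabs p`_i <= P`_i.

Lemma majorized_ge0 p P i : majorized p P -> 0 <= P`_i.
Proof. by move=> /(_ i); apply: le_trans; exact: cabs_ge0. Qed.

Lemma majorized0 : majorized 0 0.
Proof. by move=> i; rewrite !coef0 cabs0. Qed.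

Lemma majorized1 : majorized 1 1.
Proof.
move=> i; rewrite !coef1; case: (i == 0%N); first by rewrite cabs1.
by rewrite cabs0.
Qed.

Lemma majorizedXn n : majorized 'X^n 'X^n.
Proof.
move=> i; rewrite !coefXn; case: (i == n); first by rewrite cabs1.
by rewrite cabs0.
Qed.

Lemma majorizedD p q P Q : majorized p P -> majorized q Q -> majorized (p + q) (P + Q).
Proof. by move=> h k i; rewrite !coefD (le_trans (cabsD _ _))// lerD. Qed.

Lemma majorizedZ (c : R[i]) (d : R) p P : cabs c <= d -> majorized p P ->
  majorized (c *: p) (d *: P).
Proof. by move=> h k i; rewrite !coefZ cabsM ler_pM ?cabs_ge0. Qed.

Lemma majorizedM p q P Q : majorized p P -> majorized q Q -> majorized (p * q) (P * Q).
Proof.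
move=> h k i; rewrite !coefM (le_trans (cabs_sum _ _ _))//.
by apply: ler_sum => j _; rewrite cabsM ler_pM ?cabs_ge0.
Qed.

Lemma majorizedX p P n : majorized p P -> majorized (p ^+ n) (P ^+ n).
Proof.
move=> h; elim: n => [|n IH]; first exact: majorized1.
by rewrite !exprS; exact: majorizedM.
Qed.

Lemma majorized_sum (I : Type) (r : seq I) (f : I -> {poly R[i]}) (F : I -> {poly R}) :
  (forall i, majorized (f i) (F i)) ->
  majorized (\sum_(i <- r) f i) (\sum_(i <- r) F i).
Proof.
move=> h; elim: r => [|i r IH]; first by rewrite !big_nil; exact: majorized0.
by rewrite !big_cons; exact: majorizedD.
Qed.

Lemma majorized_horner p P n x : majorized p P -> 0 <= x ->
  \sum_(i < n) cabs p`_i * x ^+ i <= P.[x].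
Proof.
move=> h x0; pose n' := maxn n (size P).
rewrite (@horner_coef_wide _ n'); last exact: leq_maxr.
apply: (@le_trans _ _ (\sum_(i < n) P`_i * x ^+ i)).
  by apply: ler_sum => i _; rewrite ler_wpM2r ?exprn_ge0.
rewrite (big_ord_widen n' (fun i => P`_i * x ^+ i)); last exact: leq_maxl.
rewrite big_mkcond; apply: ler_sum => i _; case: ifP => // _.
by rewrite mulr_ge0 ?exprn_ge0// (majorized_ge0 _ h).
Qed.

End Majorants.

Section LocalFactor.
Context {R : realType} (m : nat) (beta : 'I_m -> R) (u : 'I_m -> R[i]) (J n : nat).
Hypothesis (beta_ge0 : forall k, 0 <= beta k) (u1 : forall k, cabs (u k) <= 1).

Let B := \sum_k beta k.

(** The combination of truncated logarithms divided by z. Keeping the factor ['X^1] apart makes the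
    r-th term of [lpoly] visibly divisible by X^r. *)
Definition lquot : {poly R[i]} :=
  \sum_k (beta k)%:C *: \sum_(0 <= j < J) (u k ^+ j.+1 / j.+1%:R) *: 'X^j.

(** A polynomial stand-in for the local factor, the product over k of (1 - u_k z)^(-beta_k), as a
    truncated exponential of truncated logarithms. *)
Definition lpoly : {poly R[i]} :=
  \sum_(0 <= r < n) (r`!%:R)^-1 *: ('X^1 * lquot) ^+ r.

Lemma lquot_horner z : ('X^1 * lquot).[z] = \sum_k (beta k)%:C * Lam J (u k * z).
Proof.
rewrite hornerM hornerXn expr1 horner_sum mulr_sumr; apply: eq_bigr => k _.
rewrite hornerZ mulrCA; congr (_ * _); rewrite horner_sum mulr_sumr.
apply: eq_bigr => j _; rewrite hornerZ hornerXn exprMn exprS [z ^+ j.+1]exprS; ring.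
Qed.

Lemma lpoly_horner z : lpoly.[z] = texp n (\sum_k (beta k)%:C * Lam J (u k * z)).
Proof.
rewrite /lpoly horner_sum; apply: eq_bigr => r _.
by rewrite hornerZ horner_exp lquot_horner mulrC.
Qed.

(** These two coefficients are exact at every level of truncation, and D, supported on squarefree
    numbers, sees no others. *)
Lemma lpoly_coef01 : (0 < J)%N -> (1 < n)%N ->
  lpoly`_0 = 1 /\ lpoly`_1 = \sum_k (beta k)%:C * u k.
Proof.
move=> J0 n1; have q0 : lquot`_0 = \sum_k (beta k)%:C * u k.
  rewrite /lquot coef_sum; apply: eq_bigr => k _; rewrite coefZ; congr (_ * _).
  rewrite coef_sum; case: J J0 => // J' _; rewrite big_nat_recl// big1 ?addr0.
    by rewrite coefZ coefXn eqxx mulr1 expr1 divr1.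
  by move=> j _; rewrite coefZ coefXn mulr0.
rewrite /lpoly; case: n n1 => [//|[//|n']] _; rewrite !coef_sum !big_nat_recl//.
have E r i : (((r`!%:R)^-1 : R[i]) *: ('X^1 * lquot) ^+ r)`_i =
    (r`!%:R)^-1 * (if (i < r)%N then 0 else (lquot ^+ r)`_(i - r)).
  by rewrite coefZ exprMn -exprM mul1n coefXnM.
split.
  rewrite E big1 ?addr0 => [|r _]; last by rewrite E mulr0.
  by rewrite !E /= mulr0 addr0 expr0 coef1 fact0 invr1 mulr1.
rewrite [X in _ + (_ + X)]big1 ?addr0 => [|r _]; last by rewrite E mulr0.
rewrite !E /= expr0 coef1 mulr0 add0r subnn expr1 q0.
by rewrite (_ : 1`! = 1%N)// invr1 mul1r.
Qed.

Let lquotM : {poly R} :=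
  \sum_k (beta k) *: \sum_(0 <= j < J) (j.+1%:R)^-1 *: 'X^j.
Let lpolyM : {poly R} := \sum_(0 <= r < n) (r`!%:R)^-1 *: ('X^1 * lquotM) ^+ r.

Let cabs_natV k : cabs ((k%:R : R[i])^-1) = (k%:R)^-1.
Proof. by rewrite cabsV -(rmorph_nat (real_complex R)) cabs_real ger0_norm. Qed.

Let lpoly_majorized : majorized lpoly lpolyM.
Proof.
apply: majorized_sum => r; apply: majorizedZ; first by rewrite cabs_natV.
apply: majorizedX; apply: majorizedM; first exact: majorizedXn.
apply: majorized_sum => k; apply: majorizedZ; first by rewrite cabs_real ger0_norm.
apply: majorized_sum => j; apply: majorizedZ; last exact: majorizedXn.
rewrite cabsM cabs_natV ler_piMl ?invr_ge0// cabsX.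
by rewrite exprn_ile1 ?cabs_ge0.
Qed.

(** The majorant is the same construction with every u_k replaced by 1; its value at x is at most
    exp(B (x + x^2 / 2 + ...)), and x <= 1/2 bounds the exponent by 2 B x. *)
Lemma lpoly_abs_le x D : 0 <= x <= 2^-1 ->
  \sum_(i < D) cabs lpoly`_i * x ^+ i <= expR (2 * B * x).
Proof.
move=> /andP[x0 x2]; apply: (le_trans (majorized_horner _ lpoly_majorized x0)).
have vE : ('X^1 * lquotM).[x] = x * \sum_k beta k * \sum_(0 <= j < J) (j.+1%:R)^-1 * x ^+ j.
  rewrite hornerM hornerXn expr1 horner_sum; congr (_ * _); apply: eq_bigr => k _.
  rewrite hornerZ horner_sum; congr (_ * _); apply: eq_bigr => j _.
  by rewrite hornerZ hornerXn.
set v := ('X^1 * lquotM).[x] in vE.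
have geo : \sum_(0 <= j < J) (j.+1%:R)^-1 * x ^+ j <= 2.
  apply: (@le_trans _ _ (\sum_(0 <= j < J) 2^-1 ^+ j)).
    apply: ler_sum => j _; rewrite -[leRHS]mul1r ler_pM ?invr_ge0 ?exprn_ge0//.
      by rewrite invf_le1 ?ltr0n// ler1n.
    by rewrite lerXn2r ?nnegrE ?invr_ge0.
  have -> : \sum_(0 <= j < J) 2^-1 ^+ j = 2 - 2 * 2^-1 ^+ J :> R.
    elim: J => [|k IH]; first by rewrite big_geq// expr0; ring.
    by rewrite big_nat_recr//= IH exprS; field.
  by rewrite gerBl mulr_ge0 ?exprn_ge0 ?invr_ge0.
have v0 : 0 <= v.
  rewrite vE mulr_ge0//; apply: sumr_ge0 => k _; rewrite mulr_ge0//.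
  by apply: sumr_ge0 => j _; rewrite mulr_ge0 ?invr_ge0 ?exprn_ge0.
have vB : v <= 2 * B * x.
  rewrite vE mulrC ler_wpM2r// /B mulr_sumr; apply: ler_sum => k _.
  by rewrite mulrC ler_wpM2r.
rewrite /lpolyM horner_sum (eq_bigr (fun r => v ^+ r / r`!%:R)).
  by rewrite (le_trans (texp_real_le _ v0))// ler_expR.
by move=> r _; rewrite hornerZ horner_exp mulrC.
Qed.

End LocalFactor.

(** * Expanding a finite Euler product into a Dirichlet polynomial *)

Section DirichletExpansion.
Context {R : realType}.
Implicit Types (s z : R[i]).

Lemma logn_prod (I : Type) (r : seq I) (P : pred I) (F : I -> nat) q :
  (forall i, P i -> 0 < F i)%N ->
  logn q (\prod_(i <- r | P i) F i) = (\sum_(i <- r | P i) logn q (F i))%N.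
Proof.
move=> H; elim: r => [|i r IH]; first by rewrite !big_nil logn1.
rewrite !big_cons; case: ifP => // Pi; rewrite lognM ?H ?IH//.
by rewrite prodn_cond_gt0.
Qed.

Lemma natpow_prod (I : Type) (r : seq I) (P : pred I) (F : I -> nat) s :
  (forall i, P i -> 0 < F i)%N ->
  natpow (\prod_(i <- r | P i) F i) s = \prod_(i <- r | P i) natpow (F i) s :> R[i].
Proof.
move=> H; elim: r => [|i r IH]; first by rewrite !big_nil natpow1.
rewrite !big_cons; case: ifP => // Pi; rewrite natpowM ?H ?IH//.
by rewrite prodn_cond_gt0.
Qed.

Lemma natpowX n k s : (0 < n)%N -> natpow (n ^ k) s = natpow n s ^+ k :> R[i].
Proof.
move=> n0; elim: k => [|k IH]; first by rewrite expn0 expr0 natpow1.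
by rewrite expnS natpowM ?expn_gt0 ?n0// IH exprS.
Qed.

(** Squarefree numbers are represented by their sets of prime factors: sums over them expand finite
    products, and [setprod_inj] is unique factorization. *)
Definition setprod y (S : {set 'I_y.+1}) : nat := \prod_(p in S) (p : nat).

Lemma setprod_gt0 y (S : {set 'I_y.+1}) : (forall p, p \in S -> prime p) -> (0 < setprod S)%N.
Proof. by move=> H; rewrite prodn_cond_gt0// => p /H /prime_gt0. Qed.

Lemma logn_setprod y (S : {set 'I_y.+1}) q : (forall p, p \in S -> prime p) ->
  logn q (setprod S) = (\sum_(p in S) (q == p))%N.
Proof.
move=> H; rewrite logn_prod => [|p /H /prime_gt0//].
by apply: eq_bigr => p /H pp; rewrite logn_prime.
Qed.

Lemma logn_setprod_in y (S : {set 'I_y.+1}) (q : 'I_y.+1) :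
  (forall p, p \in S -> prime p) -> logn q (setprod S) = (q \in S).
Proof.
move=> H; rewrite logn_setprod//; have [qS|qS] := boolP (q \in S).
  rewrite (bigD1 q)//= eqxx big1 ?addn0// => p /andP[_ pq].
  by rewrite eq_sym; apply/eqP; rewrite eqb0 -val_eqE in pq *.
rewrite big1// => p pS; apply/eqP; rewrite eqb0; apply: contraNneq qS => qp.
by rewrite (_ : q = p)//; apply: val_inj.
Qed.

Lemma logn_setprod_gt y (S : {set 'I_y.+1}) q :
  (forall p, p \in S -> prime p) -> (y < q)%N -> logn q (setprod S) = 0%N.
Proof.
move=> H yq; rewrite logn_setprod// big1// => p pS; apply/eqP; rewrite eqb0.
by apply: contraTneq yq => ->; rewrite -leqNgt -ltnS.
Qed.

Lemma setprod_inj y (S T : {set 'I_y.+1}) :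
  (forall p, p \in S -> prime p) -> (forall p, p \in T -> prime p) ->
  setprod S = setprod T -> S = T.
Proof.
move=> HS HT E; apply/setP => p; have := logn_setprod_in p HS.
rewrite E (logn_setprod_in p HT) => /eqP.
by case: (p \in S); case: (p \in T).
Qed.

Section Expansion.
Variables (Y y : nat) (A : nat -> {poly R[i]}) (bb : nat -> R[i]) (B : R).
Hypothesis (yY : (y <= Y)%N) (B0 : 0 <= B).
Hypothesis A01 : forall p, prime p -> (A p)`_0 = 1 /\ (A p)`_1 = bb p.
Hypothesis Aabs : forall p D, prime p ->
  \sum_(i < D) cabs (A p)`_i * expR (- 2 * ln p%:R) ^+ i <= expR (2 * B * expR (- 2 * ln p%:R)).

(** Nonprimes receive the polynomial 1 and the base 1, so that a single product over all of
    ['I_Y.+1] can be distributed. *)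
Let A' p := if prime p then A p else 1.
Let base p := if prime p then p else 1%N.
(** The [.+2] makes the exponents 0 and 1 available everywhere, whatever the sizes of the
    polynomials; the exponent vector of a squarefree number needs both. *)
Let D := (\max_(p < Y.+1) size (A' p)).+2.
Let I := {ffun 'I_Y.+1 -> 'I_D}.
Let coef (phi : I) : R[i] := \prod_(p < Y.+1) (A' p)`_(phi p).
Let num (phi : I) : nat := \prod_(p < Y.+1) base p ^ phi p.

Let base_gt0 p : (0 < base p)%N.
Proof. by rewrite /base; case: ifP => // /prime_gt0. Qed.

Let num_gt0 phi : (0 < num phi)%N.
Proof. by rewrite prodn_gt0// => p; rewrite expn_gt0 base_gt0. Qed.

Let num_logn q phi : prime q -> logn q (num phi) = (\sum_(p < Y.+1) phi p * (q == p))%N.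
Proof.
move=> pq; rewrite logn_prod => [|p _]; last by rewrite expn_gt0 base_gt0.
apply: eq_bigr => p _; rewrite lognX /base; case: ifPn => pp.
  by rewrite logn_prime.
rewrite logn1 (_ : (q == p) = false)//; apply: contraNF pp => /eqP <-.
exact: pq.
Qed.

Let num_logn_in (q : 'I_Y.+1) phi : prime q -> logn q (num phi) = phi q.
Proof.
move=> pq; rewrite num_logn// (bigD1 q)//= eqxx muln1 big1 ?addn0// => p pq'.
by rewrite (_ : (q == p :> nat) = false) ?muln0//; apply/negbTE; rewrite eq_sym.
Qed.

Let expansion s : \prod_(p < Y.+1) (A' p).[natpow (base p) (- s)] =
  \sum_phi coef phi * natpow (num phi) (- s).
Proof.
rewrite (eq_bigr (fun p : 'I_Y.+1 => \sum_(i < D) (A' p)`_i * natpow (base p) (- s) ^+ i)).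
  rewrite bigA_distr_bigA; apply: eq_bigr => phi _.
  rewrite big_split; congr (_ * _); rewrite natpow_prod => [|p _]; last first.
    by rewrite expn_gt0 base_gt0.
  by apply: eq_bigr => p _; rewrite natpowX.
move=> p _; apply: horner_coef_wide; rewrite /D; do 2!apply: leqW.
exact: (leq_bigmax (F := fun p : 'I_Y.+1 => size (A' p))).
Qed.

Let abs_sum : \sum_phi cabs (coef phi) * expR (- 2 * ln (num phi)%:R) <= expR (2 * B).
Proof.
have E phi : cabs (coef phi) * expR (- 2 * ln (num phi)%:R) =
    \prod_(p < Y.+1) (cabs (A' p)`_(phi p) * expR (- 2 * ln (base p)%:R) ^+ phi p).
  rewrite big_split /=; congr (_ * _); first by rewrite /coef cabs_prod.
  have -> : expR (- 2 * ln (num phi)%:R) = cabs (natpow (num phi) (- 2 +i* 0) : R[i]).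
    by rewrite cabs_natpow.
  rewrite /num natpow_prod => [|p _]; last by rewrite expn_gt0 base_gt0.
  by rewrite cabs_prod; apply: eq_bigr => p _; rewrite natpowX// cabsX cabs_natpow.
rewrite (eq_bigr _ (fun phi _ => E phi)).
rewrite -(bigA_distr_bigA (fun (p : 'I_Y.+1) (i : 'I_D) => cabs (A' p)`_i * expR (- 2 * ln (base p)%:R) ^+ i)).
apply: (@le_trans _ _ (\prod_(p < Y.+1) (if prime p then expR (2 * B * expR (- 2 * ln p%:R)) else 1))).
  apply: ler_prod => p _; apply/andP; split.
    by apply: sumr_ge0 => i _; rewrite mulr_ge0 ?cabs_ge0 ?exprn_ge0 ?expR_ge0.
  rewrite /A' /base; case: ifP => pp; first exact: Aabs.
  rewrite (bigD1 ord0)//= coef1 cabs1 expr0 mulr1 big1 ?addr0// => i i0.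
  by rewrite coef1 -val_eqE /= in i0 *; rewrite (negbTE i0) cabs0 mul0r.
rewrite -big_mkcond /= -expR_sum ler_expR.
rewrite -mulr_sumr ler_piMr ?mulr_ge0//.
have -> : \sum_(p < Y.+1 | prime p) expR (- 2 * ln p%:R) =
    \sum_(1 <= p < Y.+1 | prime p) cabs (natpow p (- (2 +i* 0)) : R[i]).
  rewrite -(big_mkord (fun p => prime p) (fun p => expR (- 2 * ln (p%:R : R)))).
  have E0 (F : nat -> R) : \sum_(0 <= p < Y.+1 | prime p) F p =
      \sum_(1 <= p < Y.+1 | prime p) F p by rewrite big_ltn_cond.
  rewrite E0; apply: eq_bigr => p _.
  by rewrite cabs_natpow.
exact: sum_prime_line2.
Qed.

Section Diag.
Variable S : {set 'I_y.+1}.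
Hypothesis HS : forall p, p \in S -> prime p.

Let phiS : I := [ffun p : 'I_Y.+1 => inord (logn p (setprod S))].

Let logn_le1 q : (logn q (setprod S) <= 1)%N.
Proof.
have [qy|yq] := ltnP q y.+1; last by rewrite logn_setprod_gt.
by rewrite (logn_setprod_in (Ordinal qy) HS); case: (_ \in _).
Qed.

Let phiSE (p : 'I_Y.+1) : phiS p = logn p (setprod S) :> nat.
Proof. by rewrite ffunE inordK// (leq_ltn_trans (logn_le1 p)). Qed.

Let num_phiS : num phiS = setprod S.
Proof.
apply: eqn_from_log => [||q]; [exact: num_gt0|exact: setprod_gt0|].
have [pq|npq] := boolP (prime q); last by rewrite [LHS]lognE [RHS]lognE (negbTE npq).
have [qY|Yq] := ltnP q Y.+1.
  by rewrite (num_logn_in (q := Ordinal qY))// phiSE.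
rewrite num_logn// logn_setprod_gt//; last by rewrite (leq_ltn_trans yY).
rewrite big1// => p _; rewrite (_ : (q == p) = false) ?muln0//.
by apply: contraTF Yq => /eqP ->; rewrite -ltnNge.
Qed.

Let coef_phiS : coef phiS = \prod_(p in S) bb p.
Proof.
pose h (p : nat) := if logn p (setprod S) == 1%N then bb p else 1.
have -> : coef phiS = \prod_(p < Y.+1) h p.
  apply: eq_bigr => p _; rewrite phiSE /h /A'; case: ifPn => pp; last first.
    by rewrite lognE (negbTE pp) /= coef1.
  have [a0 a1] := A01 pp; have := logn_le1 p.
  by case: (logn p _) => [|[|//]] _.
have -> : \prod_(p in S) bb p = \prod_(p < y.+1) h p.
  rewrite big_mkcond; apply: eq_bigr => p _; rewrite /h (logn_setprod_in p HS).
  by case: (p \in S).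
rewrite -!(big_mkord xpredT h) (@big_cat_nat _ _ _ y.+1)//= [X in _ * X]big_nat_cond.
rewrite [X in _ * X]big1 ?mulr1// => p; rewrite andbT => /andP[yp _].
by rewrite /h logn_setprod_gt.
Qed.

(** By unique factorization, the only exponent vector with this value that is 0 at all nonprimes is
    the indicator of S. A nonzero exponent at a nonprime does not change the value, as the base is 1
    there, but it makes the coefficient 0. *)
Lemma diag_setprod : \sum_phi (if num phi == setprod S then coef phi else 0) = \prod_(p in S) bb p.
Proof.
rewrite (bigD1 phiS)//= num_phiS eqxx coef_phiS [X in _ + X]big1 ?addr0// => phi.
case: ifP => // /eqP E; have [/forallP H|] := boolP [forall p : 'I_Y.+1, prime p || (phi p == 0%N :> nat)].
  suff -> : phi = phiS by rewrite eqxx.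
  apply/ffunP => p; apply: val_inj; rewrite [RHS]phiSE [LHS]/=.
  have [pp|npp] := boolP (prime p); first by rewrite -(num_logn_in _ pp) E.
  by rewrite lognE (negbTE npp) /=; have := H p; rewrite (negbTE npp) => /eqP.
rewrite negb_forall => /existsP[p]; rewrite negb_or => /andP[np p0] _.
rewrite /coef (bigD1 p)//= /A' (negbTE np) coef1 (negbTE p0) mul0r//.
Qed.

End Diag.

Lemma dirichlet_expansion : exists (I : finType) (a : I -> R[i]) (n : I -> nat),
  [/\ forall i, (0 < n i)%N,
   forall s, \prod_(1 <= p < Y.+1 | prime p) (A p).[natpow p (- s)] =
     \sum_i a i * natpow (n i) (- s),
   \sum_i cabs (a i) * expR (- 2 * ln (n i)%:R) <= expR (2 * B) &
   forall S : {set 'I_y.+1}, (forall p, p \in S -> prime p) ->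
     \sum_i (if n i == setprod S then a i else 0) = \prod_(p in S) bb p].
Proof.
exists I, coef, num; split=> //; last exact: diag_setprod.
move=> s; rewrite -expansion.
rewrite -(big_mkord xpredT (fun p => (A' p).[natpow (base p) (- s)])) big_ltn//.
rewrite /A' /base /= hornerC mul1r big_mkcond; apply: eq_bigr => p _.
by case: ifP => // _; rewrite hornerC.
Qed.

End Expansion.

Hypothesis RH : riemann_hypothesis R.

Lemma line_dirichlet_approx (m : nat) (alpha beta : 'I_m -> R) (g : 'I_m -> R[i] -> R[i])
    (t0 t1 : R) (y : nat) : (forall k, 0 <= beta k) -> t0 <= t1 ->
  (forall k t, t0 <= t <= t1 -> cdiffable (g k) (2 +i* t) /\
     cexp (g k (2 +i* t)) = zeta (2 +i* (t + alpha k))) ->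
  forall e, 0 < e -> exists (I : finType) (a : I -> R[i]) (n : I -> nat) (c : R[i]),
  [/\ cabs c = 1, forall i, (0 < n i)%N,
    forall t, t0 <= t <= t1 ->
      cabs (c * cexp (\sum_k (beta k)%:C * g k (2 +i* t)) -
        \sum_i a i * natpow (n i) (- (2 +i* t))) <= e,
    \sum_i cabs (a i) * expR (- 2 * ln (n i)%:R) <= expR (2 * \sum_k beta k) &
    forall S : {set 'I_y.+1}, (forall p, p \in S -> prime p) ->
     \sum_i (if n i == setprod S then a i else 0) =
     \prod_(p in S) \sum_k (beta k)%:C * natpow p (0 +i* - alpha k)].
Proof.
move=> b0 t01 Hg e e0.
pose B := \sum_k beta k; have B0 : 0 <= B by apply: sumr_ge0.
have e2 : 0 < e / 2 by rewrite divr_gt0.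
have [Y0 HY] := log_zeta_product_approx RH b0 t01 Hg e2.
pose Y := maxn Y0 y; have [J0 HJ] := HY Y (leq_maxl _ _).
have {HJ} [c c1 Hc] := HJ J0.+1 (leqnSn _).
pose E2 := expR (2 * B); have E20 : 0 < E2 by exact: expR_gt0.
(* A product of Y factors within [del] of 1 stays within e / (2 [E2]) of 1, where [E2] bounds the
   product |P| that is being approximated. *)
pose del := ln (1 + e / 2 / E2) / Y.+1%:R.
have eE : 0 < e / 2 / E2 by rewrite divr_gt0.
have del0 : 0 < del by rewrite divr_gt0// ln_gt0//; lra.
have dd : 0 < del / (2 * expR B * (B + 1)).
  by rewrite divr_gt0// mulr_gt0 ?mulr_gt0 ?expR_gt0//; lra.
have [n0 Hn] := exp_coeff_small B dd.
pose n := n0.+1.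
pose u p k : R[i] := natpow p (0 +i* - alpha k).
have u1 p k : cabs (u p k) <= 1 by rewrite cabs_natpow /= mul0r expR0.
pose A p := lpoly beta (u p) J0.+1 n.+1.
pose bb p : R[i] := \sum_k (beta k)%:C * u p k.
have A01 p : prime p -> (A p)`_0 = 1 /\ (A p)`_1 = bb p.
  by move=> _; apply: lpoly_coef01.
have Aabs p D : prime p ->
  \sum_(i < D) cabs (A p)`_i * expR (- 2 * ln p%:R) ^+ i <= expR (2 * B * expR (- 2 * ln p%:R)).
  move=> pp; apply: lpoly_abs_le => //.
  have := @natpow_prime_half R p (2 +i* 0) pp (ler1n _ _ : 1 <= 2).
  by rewrite cabs_natpow expR_ge0.
have [I [a [num [num0 Ha Hs Hd]]]] := dirichlet_expansion (leq_maxr Y0 y) B0 A01 Aabs.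
exists I, a, num, c; split=> // t ht.
rewrite -Ha; set P := cexp (\sum_k (beta k)%:C * Lsum Y J0.+1 (2 +i* (t + alpha k))).
pose V p := \sum_k (beta k)%:C * Lam J0.+1 (u p k * natpow p (- (2 +i* t))).
have PE : P = \prod_(1 <= p < Y.+1 | prime p) cexp (V p).
  rewrite -cexp_sum; congr cexp; rewrite /V exchange_big; apply: eq_bigr => k _.
  rewrite /Lsum mulr_sumr; apply: eq_bigr => p pp; congr (_ * Lam _ _).
  by rewrite /u /natpow -cexpD; congr cexp; apply: complex_eq => /=; ring.
have hP : cabs P <= E2.
  rewrite cabs_cexp ler_expR (le_trans (ler_norm _))// (le_trans (Re_le_cabs _))//.
  rewrite (le_trans (cabs_sum _ _ _))// mulr_sumr; apply: ler_sum => k _.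
  by rewrite cabsM cabs_real ger0_norm// mulrC ler_wpM2r// Lsum_line2.
have hV p : prime p -> cabs (V p) <= B.
  move=> pp; rewrite (le_trans (cabs_sum _ _ _))//; apply: ler_sum => k _.
  rewrite cabsM cabs_real ger0_norm// ler_piMr//.
  have hz := @natpow_prime_half R p (2 +i* t) pp (ler1n _ _ : 1 <= 2).
  have hz2 : cabs (u p k * natpow p (- (2 +i* t))) <= 2^-1.
    by rewrite cabsM (le_trans _ hz)// ler_piMl ?cabs_ge0.
  by rewrite (le_trans (Lam_bound _ hz2))// mulrC -ler_pdivlMr// mul1r.
have hT p : prime p -> cabs (texp n.+1 (V p) * cexp (- V p) - 1) <= del.
  move=> /hV h; rewrite (le_trans (texp_approx n h))//.
  have q := Hn n (leqnSn _).
  have B1 : 0 < 2 * expR B * (B + 1) by rewrite !mulr_gt0 ?expR_gt0//; lra.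
  have {}q : B ^+ n / n`!%:R * (2 * expR B * (B + 1)) <= del by rewrite -ler_pdivlMr.
  apply: le_trans q.
  have X0 : 0 <= B ^+ n / n`!%:R by rewrite divr_ge0 ?exprn_ge0.
  have -> : 2 * (B ^+ n.+1 / n`!%:R * expR B) = B ^+ n / n`!%:R * (2 * expR B * B) by rewrite exprS; ring.
  rewrite ler_wpM2l// ler_wpM2l; [by []|by rewrite mulr_ge0 ?expR_ge0|lra].
set Q := \prod_(_ <= _ < _ | _) _.
have hQ : cabs (Q * P^-1 - 1) <= e / 2 / E2.
  rewrite PE -prodfV -big_split /=.
  apply: (le_trans (@prod_near1 _ _ _ _ _ del _ (ltW del0))).
    by move=> p pp; rewrite lpoly_horner -cexpN; exact: hT.
  rewrite lerBlDl size_iota -[leRHS]lnK ?posrE ?ler_expR; last lra.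
  rewrite /del subn1 /= mulrAC ler_pdivrMr// ler_wpM2l ?ler_nat//.
  by rewrite ln_ge0//; lra.
have P0 : P != 0 := cexp_neq0 _.
have -> : c * cexp (\sum_k (beta k)%:C * g k (2 +i* t)) - Q =
  (c * cexp (\sum_k (beta k)%:C * g k (2 +i* t)) - P) - P * (Q * P^-1 - 1).
  by rewrite mulrBr mulr1 mulrCA divff// mulr1; ring.
rewrite (le_trans (cabsB _ _))// (splitr e) lerD ?Hc// cabsM.
have : cabs P * cabs (Q / P - 1) <= E2 * (e / 2 / E2) by rewrite ler_pM ?cabs_ge0.
by rewrite [X in _ <= X -> _]mulrC divfK// gt_eqF.
Qed.

End DirichletExpansion.

(** * Sums over primes *)

Section PrimeSums.
Context {R : realType}.
Hypothesis RH : riemann_hypothesis R.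

Local Notation pw a p := (expR (- (1 + a) * ln (p%:R : R))).

Lemma Re_natpow_real p (a : R) : Re (natpow p (- ((1 + a) +i* 0))) = pw a p.
Proof.
have -> : - ((1 + a) +i* 0) = (- (1 + a)) +i* 0 :> R[i].
  by apply/eqP; rewrite eq_complex /= oppr0 !eqxx.
by rewrite natpow_real.
Qed.

(** The converse of [zeta_prime_bound] at a real point, combined with zeta(1 + a) <= 1 + 1/a. *)
Lemma prime_sum_upper (a : R) : 0 < a -> exists Y0, forall Y, (Y0 <= Y)%N ->
  expR (\sum_(1 <= p < Y.+1 | prime p) pw a p) <= 2 * expR 1 * (1 + a^-1).
Proof.
move=> a0; set s := (1 + a) +i* 0 : R[i].
have s1 : 1 <= Re s by rewrite /s /=; lra.
have h2 : (0 : R) < 2^-1 by rewrite invr_gt0.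
have [Y0 HY] := Lsum_approx RH a0 h2; exists Y0 => Y YY.
have [J0 HJ] := HY Y YY; have h := HJ J0.+1 (leqnSn _) s erefl.
have h1 : expR (Re (Lsum Y J0.+1 s)) <= 2 * cabs (zeta s).
  have h3 : 2^-1 <= cabs (zeta s * cexp (- Lsum Y J0.+1 s)).
    have := cabsB_ge 1 (1 - zeta s * cexp (- Lsum Y J0.+1 s)).
    by rewrite subKr cabs1 cabsBC; lra.
  move: h3; rewrite cabsM cabs_cexp ReN expRN => h3.
  have e0 := expR_gt0 (Re (Lsum Y J0.+1 s)).
  rewrite -[leLHS]mul1r -ler_pdivlMr// -mulrA.
  by rewrite -[leLHS](mulfV (lt0r_neq0 (ltr0n _ 2)))// ler_pM2l.
have hs : \sum_(1 <= p < Y.+1 | prime p) pw a p - 1 <= Re (Lsum Y J0.+1 s).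
  rewrite lerBlDr -lerBlDl Re_sum -sumrB.
  apply: le_trans (sum_prime_squares Y s1); apply: ler_sum => p pp.
  rewrite -Re_natpow_real -/s -ReN -ReD (le_trans (ler_norm _))// (le_trans (Re_le_cabs _))//.
  by rewrite cabsBC Lam_sub// natpow_prime_half.
rewrite -[leLHS](_ : expR 1 * expR (\sum_(1 <= p < Y.+1 | prime p) pw a p - 1) = _); last first.
  by rewrite -expRD addrC subrK.
have e1 : 0 < expR 1 :> R by rewrite expR_gt0.
rewrite [2 * _]mulrC -mulrA ler_pM2l//.
rewrite (le_trans _ (le_trans h1 _)) ?ler_expR// ler_pM2l//.
exact: (zeta_real_le RH).
Qed.

(** The exponentials of the prime sums are at most 2e (1 + 1/a) at a and at least 1 / (4 e a) at 2a;
    as (1 + 1/a) a <= 2, the quotient is at most 16 e^2. *)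
Definition prime_cst : R := ln (16 * expR 1 ^+ 2).

Lemma prime_cst_ge0 : 0 <= prime_cst.
Proof.
rewrite ln_ge0//; have := @expR_ge1Dx R 1; set e := expR 1 => h; nra.
Qed.

(* The sum of p^(-1-a) is log (1/a) + O(1) from both sides, so it changes by
   O(1) when a is doubled; this replaces Chebyshev's bounds. *)
Lemma prime_sum_diff (a : R) Y : 0 < a -> a <= 1 ->
  \sum_(1 <= p < Y.+1 | prime p) pw a p * (1 - expR (- a * ln p%:R)) <= prime_cst.
Proof.
move=> a0 a1; have [Y1 H1] := prime_sum_upper a0.
have a20 : 0 < 2 * a by lra.
have [Y2 H2] := @zeta_prime_bound _ RH ((1 + 2 * a) +i* 0) _ a20 erefl.
(* The summands are nonnegative, so Y may be enlarged until both bounds from zeta apply. *)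
pose Z := maxn Y (maxn Y1 Y2).
have ZY : (Y <= Z)%N by rewrite /Z; lia.
apply: (@le_trans _ _ (\sum_(1 <= p < Z.+1 | prime p) pw a p * (1 - expR (- a * ln p%:R)))).
  rewrite [leRHS](@big_cat_nat _ _ _ Y.+1)//= lerDl sumr_ge0// => p pp.
  rewrite mulr_ge0 ?expR_ge0// subr_ge0 -[leRHS]expR0 ler_expR.
  by rewrite mulNr oppr_le0 mulr_ge0 ?ln_ge0 ?ler1n ?prime_gt0// ltW.
rewrite (eq_bigr (fun p => pw a p - pw (2 * a) p)); last first.
  by move=> p _; rewrite mulrBr mulr1 -expRD; congr (_ - expR _); ring.
rewrite sumrB -ler_expR /prime_cst lnK; last first.
  by rewrite posrE mulr_gt0 ?exprn_gt0 ?expR_gt0.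
have {}H1 := H1 Z; have {}H2 := H2 Z.
have /H1 {}H1 : (Y1 <= Z)%N by rewrite /Z; lia.
have /H2 {}H2 : (Y2 <= Z)%N by rewrite /Z; lia.
move: H2; rewrite (eq_bigr (fun p => pw (2 * a) p)); last by move=> p _; rewrite Re_natpow_real.
have {H1} := H1; rewrite expRD expRN.
set X := expR (\sum_(_ <= _ < _ | _) _); set X2 := expR (\sum_(_ <= _ < _ | _) _) => H1 H2.
have X0 : 0 < X2 by rewrite expR_gt0.
have := le_trans (zeta_real_ge RH a20) H2; rewrite invfM => H3.
have e1 : 0 < expR 1 :> R by rewrite expR_gt0.
rewrite ler_pdivrMr//.
have H4 : 1 <= 4 * a * expR 1 * X2.
  have := H3; rewrite -invfM -[leLHS]mul1r ler_pdivrMr//; lra.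
have H5 : (1 + a^-1) * a <= 2 by rewrite mulrDl mulVf ?lt0r_neq0//; lra.
have ai : 0 <= 1 + a^-1 by rewrite addr_ge0// invr_ge0 ltW.
apply: (le_trans H1).
apply: (@le_trans _ _ (2 * expR 1 * (1 + a^-1) * (4 * a * expR 1 * X2))).
  by rewrite ler_peMr// !mulr_ge0// expR_ge0.
have -> : 2 * expR 1 * (1 + a^-1) * (4 * a * expR 1 * X2) =
  8 * expR 1 ^+ 2 * X2 * ((1 + a^-1) * a) by ring.
have -> : 16 * expR 1 ^+ 2 * X2 = 8 * expR 1 ^+ 2 * X2 * 2 by ring.
by rewrite ler_wpM2l// !mulr_ge0 ?sqr_ge0// ltW.
Qed.

Lemma one_sub_expRN_ge (x : R) : 0 <= x -> x <= 1 -> x / 2 <= 1 - expR (- x).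
Proof.
move=> x0 x1; have h := expR_ge1Dx x; rewrite expRN.
have p : 0 < expR x by rewrite expR_gt0.
have : (expR x)^-1 <= (1 + x)^-1 by rewrite lef_pV2 ?posrE//; lra.
have : (1 + x)^-1 * (1 + x) = 1 by rewrite mulVf// lt0r_neq0//; lra.
have : 0 <= (1 + x)^-1 by rewrite invr_ge0; lra.
set v := (1 + x)^-1; set w := (expR x)^-1; nra.
Qed.

(** Take a = 1/L in [prime_sum_diff]. With x = log p / L in [0, 1], the summand p^(-1-a) (1 -
    p^(-a)) is at least x / (2 e p): a Mertens-type bound with no counting of primes. *)
Lemma sum_logp_over_p y (L : R) : 1 <= L -> ln y%:R <= L ->
  \sum_(1 <= p < y.+1 | prime p) ln p%:R / p%:R <= 2 * expR 1 * prime_cst * L.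
Proof.
move=> L1 yL; have L0 : 0 < L by lra.
have a0 : 0 < L^-1 by rewrite invr_gt0.
have a1 : L^-1 <= 1 by rewrite invf_le1.
have h := prime_sum_diff y a0 a1.
have -> : 2 * expR 1 * prime_cst * L = 2 * expR 1 * L * prime_cst by ring.
have c0 : 0 <= 2 * expR 1 * L by rewrite !mulr_ge0 ?expR_ge0// ltW.
apply: le_trans (ler_wpM2l c0 h).
rewrite big_distrr/= big_nat_cond [leRHS]big_nat_cond; apply: ler_sum => p /andP[/andP[p1 py] pp].
have p0 : 0 < (p%:R : R) by rewrite ltr0n.
have l0 : 0 <= ln (p%:R : R) by rewrite ln_ge0// ler1n.
have py' : (p <= y)%N by rewrite -ltnS.
have lL : ln (p%:R : R) <= L.
  by apply: le_trans yL; rewrite ler_ln ?posrE ?ltr0n ?ler_nat// (leq_trans p1).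
set x := L^-1 * ln p%:R.
have xE : ln p%:R = L * x by rewrite /x mulrA divff ?mul1r// lt0r_neq0.
have x0 : 0 <= x by rewrite mulr_ge0// ltW.
have x1 : x <= 1 by rewrite -(@ler_pM2l _ L)// mulr1 -xE.
have -> : pw L^-1 p = p%:R^-1 * expR (- x).
  by rewrite mulNr mulrDl mul1r opprD expRD expRN lnK ?posrE.
have -> : - L^-1 * ln p%:R = - x by rewrite /x mulNr.
have hx := one_sub_expRN_ge x0 x1.
have he : 1 <= expR 1 * expR (- x) by rewrite -expRD -[leLHS]expR0 ler_expR; lra.
rewrite {1}xE.
have -> : 2 * expR 1 * L * (p%:R^-1 * expR (- x) * (1 - expR (- x))) =
  L * (expR 1 * expR (- x)) * (2 * (1 - expR (- x))) / p%:R by ring.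
rewrite ler_wpM2r ?invr_ge0 ?(ltW p0)//.
rewrite -mulrA ler_pM2l//; set u := expR 1 * _ in he *; set v := expR _ in hx *; nra.
Qed.

(** For p > y one has p^(-1/L) <= e^(-k), so the factor 1 - p^(-1/L) in [prime_sum_diff] is at least
    k / 2. *)
Lemma prime_sum_tail y Y (k L : R) : 1 <= L -> 0 < k -> k <= 1 ->
  (forall p, (y < p)%N -> k * L <= ln p%:R) ->
  \sum_(y.+1 <= p < Y.+1 | prime p) pw L^-1 p <= 2 * prime_cst / k.
Proof.
move=> L1 k0 k1 yL; have L0 : 0 < L by lra.
have a0 : 0 < L^-1 by rewrite invr_gt0.
have a1 : L^-1 <= 1 by rewrite invf_le1.
rewrite ler_pdivlMr// mulrC -ler_pdivrMl// mulrA.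
apply: le_trans (prime_sum_diff Y a0 a1).
have hpos p : prime p -> 0 <= pw L^-1 p * (1 - expR (- L^-1 * ln p%:R)).
  move=> pp; rewrite mulr_ge0 ?expR_ge0// subr_ge0 -[leRHS]expR0 ler_expR.
  by rewrite mulNr oppr_le0 mulr_ge0 ?ln_ge0 ?ler1n ?prime_gt0// ltW.
have [yY|Yy] := leqP y Y; last first.
  by rewrite [X in _ * X]big_geq ?mulr0 ?sumr_ge0//; lia.
rewrite [leRHS](@big_cat_nat _ _ _ y.+1)//= -[leLHS]add0r lerD ?sumr_ge0//.
rewrite big_distrr/= big_nat_cond [leRHS]big_nat_cond; apply: ler_sum => p /andP[/andP[p1 py] pp].
rewrite mulrC ler_wpM2l ?expR_ge0//.
have h := one_sub_expRN_ge (ltW k0) k1.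
apply: (@le_trans _ _ (k / 2)); first by rewrite mulrC.
rewrite (le_trans h)// lerD2l lerN2 ler_expR mulNr lerN2.
by rewrite mulrC ler_pdivlMr// yL.
Qed.

End PrimeSums.

(** * Rankin's trick *)

Section Rankin.
Context {R : realType}.
Implicit Types (w : nat -> R).

Lemma ln_prodn (I : Type) (r : seq I) (P : pred I) (F : I -> nat) :
  (forall i, P i -> 0 < F i)%N ->
  ln (\prod_(i <- r | P i) F i)%:R = \sum_(i <- r | P i) ln (F i)%:R :> R.
Proof.
move=> H; elim: r => [|i r IH]; first by rewrite !big_nil ln1.
rewrite !big_cons; case: ifP => // Pi.
by rewrite natrM lnM ?posrE ?ltr0n ?H ?IH// prodn_cond_gt0.
Qed.

Lemma expR_sub_sqr_le (x : R) : 0 <= x -> expR (x - x ^+ 2) <= 1 + x.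
Proof.
move=> x0; have h := expR_ge1Dx (- (x - x ^+ 2)); move: h; rewrite expRN.
have p := expR_gt0 (x - x ^+ 2); set e := expR _ in p * => h.
have : e^-1 * e = 1 by rewrite mulVf// lt0r_neq0.
have : 0 < e^-1 by rewrite invr_gt0.
move: h; set v := e^-1 => h v0 ve.
have h1 : (1 - x + x ^+ 2) * e <= 1 by rewrite -ve ler_wpM2r ?(ltW p)//; lra.
have h2 : 1 <= (1 - x + x ^+ 2) * (1 + x).
  have -> : (1 - x + x ^+ 2) * (1 + x) = 1 + x ^+ 3 by ring.
  by rewrite lerDl exprn_ge0.
have h3 : 0 < 1 - x + x ^+ 2 by have := sqr_ge0 (x - 2^-1); nra.
by rewrite -(ler_pM2l h3) (le_trans h1).
Qed.

Lemma expR_sub1_le (x : R) : 0 <= x -> x <= 1 -> expR x - 1 <= expR 1 * x.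
Proof.
move=> x0 x1; have h := expR_ge1Dx (- x); rewrite expRN in h.
have p := expR_gt0 x; have h1 : expR x <= expR 1 by rewrite ler_expR.
have : (expR x)^-1 * expR x = 1 by rewrite mulVf// lt0r_neq0.
move: h h1 p; set e := expR x; set v := e^-1; set e1 := expR 1 => h h1 p ve.
have : (1 - x) * e <= 1 by rewrite -ve ler_wpM2r ?(ltW p)//; lra.
nra.
Qed.

Lemma sum_prime_subsets w y :
  \sum_(S : {set 'I_y.+1} | [forall p in S, prime p]) \prod_(p in S) w p =
  \prod_(p < y.+1 | prime p) (1 + w p).
Proof.
rewrite big_mkcond [RHS]big_mkcond /=.
rewrite (eq_bigr (fun p : 'I_y.+1 => (if prime p then w p else 0) + 1)); last first.
  by move=> p _; case: ifP; rewrite ?add0r// addrC.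
rewrite bigA_distr/= [LHS]big_mkcond; apply: eq_bigr => S _; rewrite -big_mkcond/=.
case: ifPn => [/forall_inP H|/forall_inPn[p pS np]].
  by apply: eq_bigr => p pS; rewrite H.
by rewrite (bigD1 p)//= (negbTE np) mul0r.
Qed.

Hypothesis RH : riemann_hypothesis R.

Variables (w : nat -> R) (b : R) (y N : nat) (L : R).
Hypotheses (w0 : forall p, 0 <= w p) (wb : forall p, prime p -> w p <= b / p%:R).
Hypotheses (b0 : 0 <= b) (L1 : 1 <= L) (yL : ln y%:R <= L).
Hypothesis NL : (2 * expR 1 ^+ 2 * @prime_cst R * b + 1) * L <= ln N%:R.
Hypothesis N0 : (0 < N)%N.

Let full : R := \prod_(p < y.+1 | prime p) (1 + w p).

(** Since 1 + w >= exp(w - w^2), the loss is the sum of w^2, at most b^2 times the sum of p^(-2),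
    hence at most b^2. *)
Let full_ge : expR (\sum_(1 <= p < y.+1 | prime p) w p) * expR (- b ^+ 2) <= full.
Proof.
rewrite -expRD; apply: (@le_trans _ _ (expR (\sum_(1 <= p < y.+1 | prime p) (w p - w p ^+ 2)))).
  rewrite ler_expR sumrB lerD2l lerN2.
  have h := sum_prime_squares y (lexx 1 : 1 <= Re ((1 : R) +i* 0)).
  have h2 := ler_wpM2l (sqr_ge0 b) h; rewrite mulr1 in h2; apply: le_trans h2.
  rewrite mulr_sumr; apply: ler_sum => p pp.
  have p0 : 0 < (p%:R : R) by rewrite ltr0n prime_gt0.
  rewrite cabs_natpow ReN mulN1r expRN lnK ?posrE//.
  rewrite -exprMn.
  by rewrite lerXn2r ?nnegrE ?wb// divr_ge0.
rewrite expR_sum /full big_geq_mkord (eq_bigl (fun p : 'I_y.+1 => prime p)); last first.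
  by move=> p; rewrite andb_idr// => /prime_gt0.
by apply: ler_prod => p _; rewrite expR_ge0 expR_sub_sqr_le.
Qed.

Let good : R :=
  \sum_(S : {set 'I_y.+1} | [forall p in S, prime p] && (setprod S <= N)%N) \prod_(p in S) w p.

Let good_ge : (1 - expR (- 1)) * full <= good.
Proof.
have L0 : 0 < L := lt_le_trans ltr01 L1.
(* Rankin's weight p^(1/L). It raises the full product by a factor of at most exp(2 e^2 [prime_cst]
   b), while sets with product above N gain N^(-1/L); [NL] is the condition under which the net
   factor is at most 1/e. *)
pose wd p := w p * expR (ln p%:R / L).
have wd0 p : 0 <= wd p by rewrite mulr_ge0 ?expR_ge0.
have split_full : full = good + \sum_(S : {set 'I_y.+1} | [forall p in S, prime p] &&
    ~~ (setprod S <= N)%N) \prod_(p in S) w p.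
  by rewrite /full -sum_prime_subsets (bigID (fun S : {set 'I_y.+1} => (setprod S <= N)%N)).
have bad_le : \sum_(S : {set 'I_y.+1} | [forall p in S, prime p] &&
    ~~ (setprod S <= N)%N) \prod_(p in S) w p <=
    expR (- (ln N%:R / L)) * \prod_(p < y.+1 | prime p) (1 + wd p).
  rewrite -sum_prime_subsets big_distrr/= [leRHS](bigID (fun S : {set 'I_y.+1} => (setprod S <= N)%N))/=.
  rewrite -[leLHS]add0r lerD ?sumr_ge0// => [S _|].
    by rewrite mulr_ge0 ?expR_ge0// prodr_ge0.
  apply: ler_sum => S /andP[/forall_inP HS SN].
  rewrite big_split/= -expR_sum -big_distrl/= -ln_prodn; last by move=> p /HS /prime_gt0.
  rewrite mulrCA -expRD ler_peMr ?prodr_ge0// -[leLHS]expR0 ler_expR addrC subr_ge0.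
  rewrite ler_pM2r ?invr_gt0// ler_ln ?posrE ?ltr0n ?setprod_gt0// ?ler_nat.
  by rewrite -ltnNge in SN; exact: ltnW.
have wd_le (p : 'I_y.+1) : prime p ->
    1 + wd p <= (1 + w p) * expR (expR 1 * b / L * (ln p%:R / p%:R)).
  move=> pp; have p0 : 0 < (p%:R : R) by rewrite ltr0n prime_gt0.
  have l0 : 0 <= ln (p%:R : R) / L.
    by rewrite divr_ge0 ?(ltW L0)// ln_ge0// ler1n prime_gt0.
  have l1 : ln (p%:R : R) / L <= 1.
    have py : (p <= y)%N by rewrite -ltnS.
    have y0 : (0 < y)%N := leq_trans (prime_gt0 pp) py.
    by rewrite ler_pdivrMr// mul1r (le_trans _ yL)// ler_ln ?posrE ?ltr0n ?ler_nat// prime_gt0.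
  have h := expR_sub1_le l0 l1.
  apply: (@le_trans _ _ ((1 + w p) * (1 + expR 1 * b / L * (ln p%:R / p%:R)))); last first.
    by rewrite ler_wpM2l ?expR_ge1Dx// addr_ge0.
  have -> : expR 1 * b / L * (ln p%:R / p%:R) = b / p%:R * (expR 1 * (ln p%:R / L)).
    by field; rewrite !lt0r_neq0.
  rewrite /wd; have := wb pp; have := w0 p.
  have : 0 <= expR 1 * (ln p%:R / L) by rewrite mulr_ge0 ?expR_ge0.
  move: h; set e := expR (_ / _); set x := expR 1 * _; set v := b / _; set u := w p => h x0 u0 uv.
  have : u * (e - 1) <= v * x by apply: (le_trans (ler_wpM2l u0 h)); rewrite ler_wpM2r.
  have : 0 <= u * (v * x) := mulr_ge0 u0 (mulr_ge0 (le_trans u0 uv) x0).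
  nra.
have prod_le : \prod_(p < y.+1 | prime p) (1 + wd p) <=
    full * expR (expR 1 * b / L * (2 * expR 1 * @prime_cst R * L)).
  apply: (@le_trans _ _ (\prod_(p < y.+1 | prime p) ((1 + w p) *
      expR (expR 1 * b / L * (ln p%:R / p%:R))))).
    by apply: ler_prod => p /wd_le ->; rewrite addr_ge0.
  rewrite big_split/= -/full -expR_sum -big_distrr/= ler_wpM2l//.
    by rewrite prodr_ge0// => p _; rewrite addr_ge0.
  rewrite ler_expR ler_wpM2l ?divr_ge0 ?mulr_ge0 ?expR_ge0 ?(ltW L0)//.
  apply: le_trans (sum_logp_over_p RH L1 yL); rewrite big_geq_mkord.
  by rewrite [leRHS](eq_bigl (fun p : 'I_y.+1 => prime p))// => p; rewrite andb_idr// => /prime_gt0.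
have full0 : 0 <= full by rewrite prodr_ge0// => p _; rewrite addr_ge0.
rewrite mulrBl mul1r lerBlDr split_full lerD2l (le_trans bad_le)// -split_full.
apply: (le_trans (ler_wpM2l (expR_ge0 _) prod_le)).
rewrite mulrCA [leRHS]mulrC ler_wpM2l// -expRD ler_expR.
have -> : expR 1 * b / L * (2 * expR 1 * @prime_cst R * L) = 2 * expR 1 ^+ 2 * @prime_cst R * b.
  by field; rewrite lt0r_neq0.
have := NL; rewrite -ler_pdivlMr//; set u := _ / L; set v := 2 * _ * _ * _; lra.
Qed.

Lemma rankin : expR (\sum_(1 <= p < y.+1 | prime p) w p) * (expR (- b ^+ 2) / 2) <=
  \sum_(S : {set 'I_y.+1} | [forall p in S, prime p] && (setprod S <= N)%N) \prod_(p in S) w p.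
Proof.
apply: le_trans good_ge; have h := full_ge.
have e2 : expR (- 1) <= 2^-1 :> R.
  rewrite expRN lef_pV2 ?posrE ?expR_gt0//; have := @expR_ge1Dx R 1; lra.
have f0 : 0 <= full by rewrite prodr_ge0// => p _; rewrite addr_ge0.
rewrite mulrA; move: h e2; set u := _ * _; set e := expR (- 1) => h e2; nra.
Qed.

End Rankin.

(** * The diagonal sum in terms of zeta near 1 *)

Section DiagonalSum.
Context {R : realType}.
Hypothesis RH : riemann_hypothesis R.

Lemma sum_sym m (F : 'I_m -> 'I_m -> R) : (forall j k, F j k = F k j) ->
  \sum_j \sum_k F j k = \sum_k F k k + \sum_(j < m) \sum_(k < m | (j < k)%N) 2 * F j k.
Proof.
move=> FS; have -> : \sum_j \sum_k F j k = \sum_(j < m) (F j j +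
    (\sum_(k < m | (j < k)%N) F j k + \sum_(k < m | (k < j)%N) F j k)).
  apply: eq_bigr => j _; rewrite (bigD1 j)//=; congr (_ + _).
  rewrite (bigID (fun k : 'I_m => (nat_of_ord j < k)%N))/=; congr (_ + _); apply: eq_bigl => k.
    by rewrite andbC andb_idr// -val_eqE/= neq_ltn orbC => ->.
  by rewrite -val_eqE/= neq_ltn; case: ltngtP.
rewrite big_split/=; congr (_ + _); rewrite big_split/=.
have -> : \sum_(j < m) \sum_(k < m | (k < j)%N) F j k =
    \sum_(j < m) \sum_(k < m | (j < k)%N) F j k.
  rewrite (exchange_big_dep xpredT)//=; apply: eq_bigr => j _.
  by apply: eq_bigr => k _; rewrite FS.
rewrite -big_split/=; apply: eq_bigr => j _; rewrite -big_split/=.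
by apply: eq_bigr => k _; ring.
Qed.

Variables (m : nat) (alpha beta : 'I_m -> R).
Hypothesis beta0 : forall k, 0 <= beta k.

Definition twist p : R[i] := \sum_k (beta k)%:C * natpow p (0 +i* - alpha k).

Local Notation B := (\sum_k beta k).
Local Notation pw a p := (expR (- (1 + a) * ln (p%:R : R))).

Lemma cabs_twist p : cabs (twist p) <= B.
Proof.
apply: (le_trans (cabs_sum _ _ _)); apply: ler_sum => k _.
by rewrite cabsM cabs_natpow mul0r expR0 mulr1 cabs_real ger0_norm.
Qed.

Lemma twist_sqr p : cabs (twist p) ^+ 2 =
  \sum_j \sum_k beta j * beta k * cos ((alpha j - alpha k) * ln (p%:R : R)).
Proof.
pose th k := - alpha k * ln (p%:R : R).
have ReE : Re (twist p) = \sum_k beta k * cos (th k).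
  rewrite Re_sum; apply: eq_bigr => k _.
  by rewrite mulrC ReMr /natpow /cexp ReMr ImMr mul0r expR0 mul1r mulrC.
have ImE : Im (twist p) = \sum_k beta k * sin (th k).
  have Im_sum (f : 'I_m -> R[i]) : Im (\sum_k f k) = \sum_k Im (f k).
    by elim/big_rec2 : _ => [//|i y1 y2 _ <-]; rewrite ImD.
  rewrite Im_sum; apply: eq_bigr => k _.
  rewrite [_%:C * _]mulrC ImMr mulrC; congr (_ * _).
  by rewrite /natpow /cexp ReMr ImMr /= mul0r expR0 mul1r.
rewrite cabs_sqr ReE ImE !expr2 !big_distrlr/= -big_split/=; apply: eq_bigr => j _.
rewrite -big_split/=; apply: eq_bigr => k _.
have -> : (alpha j - alpha k) * ln p%:R = th k - th j by rewrite /th; ring.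
by rewrite cosB; ring.
Qed.

Lemma Re_natpow_line p (a v : R) :
  Re (natpow p (- ((1 + a) +i* v))) = pw a p * cos (v * ln (p%:R : R)).
Proof. by rewrite /natpow /cexp ReMr ImMr ReN ImN /= [- v * _]mulNr cosN. Qed.

(** In the expansion of |b(p)|^2, the prime sum of each pair (j, k) is at least the logarithm of
    |zeta| at the matching point minus 2, because 2e <= e^2. For j = k that |zeta| is at least L,
    which produces the power of L. The exponents [2 * beta j * beta k] are nonnegative, so the
    inequalities multiply. *)
Lemma twist_sum_ge (L : R) y : 1 <= L -> exists2 Y, (y <= Y)%N &
  L `^ (\sum_(k < m) beta k ^+ 2) *
      \prod_(j < m) \prod_(k < m | (j < k)%N)
        cabs (zeta ((1 + L^-1) +i* (alpha j - alpha k))) `^ (2 * beta j * beta k) <=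
  expR (2 * B ^+ 2 + \sum_(1 <= p < Y.+1 | prime p) cabs (twist p) ^+ 2 * pw L^-1 p).
Proof.
move=> L1; have L0 : 0 < L := lt_le_trans ltr01 L1.
have a0 : 0 < L^-1 by rewrite invr_gt0.
pose X Y (j k : 'I_m) : R := \sum_(1 <= p < Y.+1 | prime p)
  pw L^-1 p * cos ((alpha j - alpha k) * ln (p%:R : R)).
have /choice[Y0 HY0] (jk : 'I_m * 'I_m) : exists Y0, forall Y, (Y0 <= Y)%N ->
    cabs (zeta ((1 + L^-1) +i* (alpha jk.1 - alpha jk.2))) <= expR (2 + X Y jk.1 jk.2).
  have [Y1 HY1] := zeta_prime_bound RH a0 (erefl : Re ((1 + L^-1) +i* (alpha jk.1 - alpha jk.2)) = _).
  exists Y1 => Y /HY1 /le_trans; apply; rewrite expRD.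
  rewrite (eq_bigr (fun p => pw L^-1 p * cos ((alpha jk.1 - alpha jk.2) * ln (p%:R : R)))); last first.
    by move=> p _; rewrite Re_natpow_line.
  rewrite ler_wpM2r ?expR_ge0// (_ : 2 = 1 + 1 :> R)// expRD ler_wpM2r ?expR_ge0//.
  exact: expR_ge1Dx.
pose Y := maxn y (\max_jk Y0 jk); exists Y; first exact: leq_maxl.
have HY j k : cabs (zeta ((1 + L^-1) +i* (alpha j - alpha k))) <= expR (2 + X Y j k).
  apply: (HY0 (j, k)); apply: leq_trans (leq_maxr _ _).
  exact: (leq_bigmax_cond (j, k)).
have HP (x h b : R) : 0 <= x -> 0 <= b -> x <= expR h -> x `^ b <= expR (b * h).
  move=> x0 b0 xh; rewrite mulrC expRM; apply: ge0_ler_powR => //.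
  by rewrite nnegrE expR_ge0.
have X_sym j k : X Y j k = X Y k j.
  apply: eq_bigr => p _; rewrite -cosN; congr (_ * cos _); ring.
have sumE : \sum_j \sum_k beta j * beta k * (2 + X Y j k) =
    2 * B ^+ 2 + \sum_(1 <= p < Y.+1 | prime p) cabs (twist p) ^+ 2 * pw L^-1 p.
  have -> : 2 * B ^+ 2 = \sum_j \sum_k 2 * (beta j * beta k).
    rewrite expr2 big_distrlr mulr_sumr/=; apply: eq_bigr => j _; exact: mulr_sumr.
  rewrite (eq_bigr (fun p => \sum_j \sum_k beta j * beta k *
      (pw L^-1 p * cos ((alpha j - alpha k) * ln (p%:R : R))))); last first.
    move=> p _; rewrite twist_sqr mulr_suml; apply: eq_bigr => j _.
    by rewrite mulr_suml; apply: eq_bigr => k _; ring.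
  rewrite [X in _ = _ + X]exchange_big/= -big_split/=; apply: eq_bigr => j _.
  rewrite [X in _ = _ + X]exchange_big/= -big_split/=; apply: eq_bigr => k _.
  by rewrite -mulr_sumr -/(X Y j k); ring.
rewrite -sumE (sum_sym (F := fun j k => beta j * beta k * (2 + X Y j k))); last first.
  by move=> j k; rewrite X_sym [beta j * _]mulrC.
rewrite expRD; apply: ler_pM; rewrite ?powR_ge0//.
- by apply: prodr_ge0 => j _; apply: prodr_ge0 => k _; exact: powR_ge0.
- rewrite /powR gt_eqF// ler_expR mulr_suml; apply: ler_sum => k _.
  rewrite expr2 ler_wpM2l ?mulr_ge0// -ler_expR lnK ?posrE//.
  apply: le_trans (HY k k); rewrite subrr -[leLHS]invrK; exact: (zeta_real_ge RH).
- rewrite expR_sum; apply: ler_prod => j _.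
  rewrite prodr_ge0 => [|k _]; last exact: powR_ge0.
  rewrite expR_sum; apply: ler_prod => k _; rewrite powR_ge0 /=.
  have -> : 2 * (beta j * beta k * (2 + X Y j k)) = 2 * beta j * beta k * (2 + X Y j k).
    by rewrite !mulrA.
  by apply: (HP _ _ _ (cabs_ge0 _) _ (HY j k)); rewrite !mulr_ge0.
Qed.

(** For p <= y the bound p^(-1-1/L) <= 1/p costs nothing; the primes above y cost B^2 times the
    bound of [prime_sum_tail], and the restriction to products up to N costs [rankin]. All losses
    depend on beta and k only. *)
Lemma diagonal_ge (k L : R) y N : 0 < k -> k <= 1 -> 1 <= k * L ->
  (forall p, (y < p)%N -> k * L <= ln p%:R) -> (0 < y)%N -> ln y%:R <= k * L ->
  (2 * expR 1 ^+ 2 * prime_cst * B ^+ 2 + 1) * (k * L) <= ln N%:R -> (0 < N)%N ->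
  L `^ (\sum_(k < m) beta k ^+ 2) *
      \prod_(j < m) \prod_(k < m | (j < k)%N)
        cabs (zeta ((1 + L^-1) +i* (alpha j - alpha k))) `^ (2 * beta j * beta k) *
    (expR (- (2 * B ^+ 2 + B ^+ 2 * (2 * prime_cst / k))) * (expR (- (B ^+ 2) ^+ 2) / 2)) <=
  \sum_(S : {set 'I_y.+1} | [forall p in S, prime p] && (setprod S <= N)%N)
    \prod_(p in S) (cabs (twist p) ^+ 2 / (p : nat)%:R).
Proof.
move=> k0 k1 kL yL y0 ly NL N0.
have L0 : 0 < L by rewrite -(pmulr_rgt0 _ k0) (lt_le_trans ltr01).
have L1 : 1 <= L by rewrite (le_trans kL)// ger_pMl.
have B2 p : cabs (twist p) ^+ 2 <= B ^+ 2.
  by rewrite lerXn2r ?nnegrE ?cabs_ge0 ?cabs_twist// sumr_ge0.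
pose w p : R := cabs (twist p) ^+ 2 / p%:R.
have w0 p : 0 <= w p by rewrite divr_ge0 ?sqr_ge0.
have wb p : prime p -> w p <= B ^+ 2 / p%:R.
  by move=> pp; rewrite ler_wpM2r ?invr_ge0.
apply: le_trans (rankin RH w0 wb (sqr_ge0 _) kL ly NL N0).
rewrite mulrA ler_wpM2r ?divr_ge0 ?expR_ge0//.
have [Y yY HY] := twist_sum_ge y L1.
apply: (le_trans (ler_wpM2r (expR_ge0 _) HY)); rewrite -expRD ler_expR.
have tail := prime_sum_tail RH Y L1 k0 k1 yL.
have yY1 : (y.+1 <= Y.+1)%N by [].
rewrite (@big_cat_nat _ _ _ y.+1 1 Y.+1)//=.
set s1 := \sum_(_ <= _ < y.+1 | _) _; set s2 := \sum_(y.+1 <= _ < _ | _) _.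
have h1 : s1 <= \sum_(1 <= p < y.+1 | prime p) w p.
  rewrite /s1; apply: ler_sum => p pp; rewrite /w ler_wpM2l ?sqr_ge0//.
  have p0 : 0 < (p%:R : R) by rewrite ltr0n prime_gt0.
  rewrite -[in leRHS](@lnK _ p%:R) ?posrE// -expRN ler_expR mulNr lerN2 mulrDl mul1r lerDl.
  by rewrite mulr_ge0 ?invr_ge0 ?(ltW L0)// ln_ge0// ler1n prime_gt0.
have h2 : s2 <= B ^+ 2 * (2 * prime_cst / k).
  apply: (le_trans _ (ler_wpM2l (sqr_ge0 _) tail)).
  rewrite mulr_sumr; apply: ler_sum => p pp; by rewrite ler_wpM2r ?expR_ge0.
move: h1 h2; set u := \sum_(_ <= _ < _ | _) _; set v := _ * (2 * _ / _); lra.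
Qed.

End DiagonalSum.

(** * Passage to the critical line *)

Section RealContinuity.
Context {R : realType}.
Implicit Types (u v : R[i] -> R) (z w : R[i]) (x t : R).

Definition rcont u z := forall e : R, 0 < e -> exists2 d : R, 0 < d &
  forall w, cabs (w - z) < d -> `|u w - u z| <= e.

Lemma rcontM u v z : rcont u z -> rcont v z -> rcont (fun w => u w * v w) z.
Proof.
move=> hu hv e e0; pose c := `|u z| + `|v z| + 1.
have c0 : 0 < c by rewrite ltr_wpDl// addr_ge0.
pose e' := Num.min 1 (e / c).
have e'0 : 0 < e' by rewrite lt_min ltr01 divr_gt0.
have e'1 : e' <= 1 by rewrite ge_min lexx.
have e'c : e' * c <= e by rewrite -ler_pdivlMr// ge_min lexx orbT.
have [d1 d10 H1] := hu _ e'0; have [d2 d20 H2] := hv _ e'0.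
exists (Num.min d1 d2); first by rewrite lt_min d10.
move=> w; rewrite lt_min => /andP[/H1 h1 /H2 h2].
have -> : u w * v w - u z * v z = (u w - u z) * (v w - v z) +
  (u z * (v w - v z) + v z * (u w - u z)) by ring.
apply: (le_trans (ler_normD _ _)); apply: le_trans e'c.
have h3 := ler_normD (u z * (v w - v z)) (v z * (u w - u z)).
move: h3 h1 h2; rewrite !normrM /c.
have := normr_ge0 (u z); have := normr_ge0 (v z).
have := normr_ge0 (u w - u z); have := normr_ge0 (v w - v z).
set a := `|u z|; set b := `|v z|; set p := `|u w - u z|; set q := `|v w - v z|; nra.
Qed.

Lemma rcont_prod (I : Type) (r : seq I) (u : I -> R[i] -> R) z :
  (forall i, rcont (u i) z) -> rcont (fun w => \prod_(i <- r) u i w) z.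
Proof.
move=> H; elim: r => [|i r IH].
  by move=> e e0; exists 1 => // w _; rewrite !big_nil subrr normr0 ltW.
move=> e e0; have [d d0 Hd] := rcontM (H i) IH e0.
by exists d => // w; rewrite !big_cons; exact: Hd.
Qed.

Lemma powR_epsdelta (b x e : R) : 0 <= b -> 0 <= x -> 0 < e -> exists2 d : R, 0 < d &
  forall y, 0 <= y -> `|y - x| < d -> `|y `^ b - x `^ b| <= e.
Proof.
move=> b0 x0 e0; have [->|bn0] := eqVneq b 0.
  by exists 1 => // y _ _; rewrite !powRr0 subrr normr0 ltW.
(* This case is unavoidable, as zeta may vanish on the critical line; there continuity cannot come
   from exp(b log y). *)
have [->|xn0] := eqVneq x 0.
  exists (e `^ b^-1) => [|y y0]; first exact: powR_gt0.
  rewrite powR0// !subr0 ger0_norm// => ye; rewrite ger0_norm ?powR_ge0//.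
  have -> : e = (e `^ b^-1) `^ b by rewrite -powRrM mulVf// powRr1// ltW.
  by apply: ge0_ler_powR => //; rewrite ?nnegrE ?powR_ge0// ltW.
have xp : 0 < x by rewrite lt_neqAle eq_sym xn0.
have : {for x, continuous (fun y => expR (b * ln y))}.
  apply: continuous_comp; last exact: continuous_expR.
  apply: cvgM; [exact: cvg_cst|exact: continuous_ln].
move/continuous_epsdelta => /(_ e e0)[d d0 Hd].
exists (Num.min d x); first by rewrite lt_min d0.
move=> y y0; rewrite lt_min => /andP[yd yx].
have yp : 0 < y by move: yx; rewrite ltr_norml; lra.
have := Hd (y - x) yd; rewrite [x + _]addrC subrK.
by rewrite /powR !gt_eqF.
Qed.

Lemma rcont_powR u b z : 0 <= b -> (forall w, 0 <= u w) -> rcont u z ->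
  rcont (fun w => u w `^ b) z.
Proof.
move=> b0 u0 hu e e0; have [d d0 Hd] := powR_epsdelta b0 (u0 z) e0.
have d2 : 0 < d / 2 by lra.
have [d1 d10 Hd1] := hu _ d2; exists d1 => // w /Hd1 h.
by apply: Hd => //; lra.
Qed.

Lemma rcont_cabs (f : R[i] -> R[i]) z : ccont f z -> rcont (fun w => cabs (f w)) z.
Proof.
move=> hf e e0; have [d d0 Hd] := hf e e0; exists d => // w /Hd; rewrite addrCA subrr addr0 => h.
apply: le_trans h; have h1 := cabsB_ge (f w) (f z); have h2 := cabsB_ge (f z) (f w).
by rewrite cabsBC in h2; rewrite ler_norml h1 andbT lerNl; apply: le_trans h2; rewrite opprB.
Qed.

Lemma cabs_ver_sub (x y t s : R) : cabs ((y +i* s) - (x +i* t)) <= `|y - x| + `|s - t|.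
Proof. exact: cabs_le_ReIm. Qed.

Lemma rcont_ver u x t : rcont u (x +i* t) -> {for t, continuous (fun s => u (x +i* s))}.
Proof.
move=> hu; apply/continuous_epsdelta => e e0; have [d d0 Hd] := hu e e0.
exists d => // h hd; apply: Hd; apply: le_lt_trans (cabs_ver_sub _ _ _ _) _.
by rewrite subrr normr0 add0r addrAC subrr add0r.
Qed.

Lemma rcont_uniform_ver u x0 y0 y1 (e : R) : y0 <= y1 -> 0 < e ->
  (forall t, y0 <= t <= y1 -> rcont u (x0 +i* t)) ->
  exists2 d : R, 0 < d & forall x t, y0 <= t <= y1 -> `|x - x0| < d ->
    `|u (x +i* t) - u (x0 +i* t)| <= e.
Proof.
move=> y01 e0 hu.
pose P (a b c d : R) := exists2 del : R, 0 < del & forall x t, c <= t <= d -> `|x - x0| < del ->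
  `|u (x +i* t) - u (x0 +i* t)| <= e.
apply: (@rect_bisection _ P x0 x0 y0 y1) => //.
  move=> a b c d _ _ _ _ _ _ [d1 d10 H1] _ [d2 d20 H2] _.
  exists (Num.min d1 d2); first by rewrite lt_min d10.
  move=> x t ht; rewrite lt_min => /andP[h1 h2].
  have [tm|tm] := leP t ((c + d) / 2); first by apply: H1 => //; rewrite tm andbT; lra.
  by apply: H2 => //; rewrite (ltW tm); lra.
move=> [z1 z2] [/= hz1 hz2]; have {hz1} -> : z1 = x0 by lra.
have e2 : 0 < e / 2 by lra.
have [d d0 Hd] := hu z2 hz2 _ e2; exists (d / 2); first lra.
move=> a b c d' _ _ _ _ _ _ [/= _ hzt] _ hcd.
exists (d / 2); first lra.
move=> x t ht hx.
have h3 : `|t - z2| < d / 2 by rewrite ltr_norml; lra.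
have h1 : `|u (x +i* t) - u (x0 +i* z2)| <= e / 2.
  by apply: Hd; apply: le_lt_trans (cabs_ver_sub _ _ _ _) _; lra.
have h2 : `|u (x0 +i* t) - u (x0 +i* z2)| <= e / 2.
  by apply: Hd; apply: le_lt_trans (cabs_ver_sub _ _ _ _) _; rewrite subrr normr0; lra.
by move: h1 h2; rewrite !ler_norml; lra.
Qed.

(* Integrals over vertical lines depend continuously on the line. *)
Lemma rint_ver_ge u x0 y0 y1 (c d : R) : y0 < y1 -> 0 < d ->
  (forall x t, `|x - x0| < d -> y0 <= t <= y1 -> rcont u (x +i* t)) ->
  (forall x, x0 < x -> x < x0 + d -> c <= rint y0 y1 (fun t => u (x +i* t))) ->
  c <= rint y0 y1 (fun t => u (x0 +i* t)).
Proof.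
move=> y01 d0 hu hc; have y01' := ltW y01.
have ux0 t : y0 <= t <= y1 -> rcont u (x0 +i* t) by apply: hu; rewrite subrr normr0.
apply/ler_addgt0Pr => e e0.
have e1 : 0 < e / (y1 - y0) by rewrite divr_gt0// subr_gt0.
have [d1 d10 Hd1] := rcont_uniform_ver y01' e1 ux0.
pose x := x0 + Num.min d d1 / 2.
have m0 : 0 < Num.min d d1 by rewrite lt_min d0.
have m1 : Num.min d d1 <= d by rewrite ge_min lexx.
have m2 : Num.min d d1 <= d1 by rewrite ge_min lexx orbT.
have hx : `|x - x0| < Num.min d d1 by rewrite /x addrAC subrr add0r gtr0_norm; lra.
have x1 : x0 < x by rewrite /x; lra.
have x2 : x < x0 + d by rewrite /x; lra.
apply: (le_trans (hc x x1 x2)).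
have cx : cont_on y0 y1 (fun t => u (x +i* t)).
  by move=> t ht; apply: rcont_ver; apply: hu => //; lra.
have cx0 : cont_on y0 y1 (fun t => u (x0 +i* t)).
  by move=> t ht; apply: rcont_ver; apply: ux0.
have ce : cont_on y0 y1 (fun=> e / (y1 - y0)) by move=> t _; exact: cvg_cst.
have -> : e = rint y0 y1 (fun=> e / (y1 - y0)).
  by rewrite rint_cst// divfK// subr_eq0 gt_eqF.
rewrite -rintD//; apply: rint_le => //.
  by move=> t ht; apply: cvgD; [exact: cx0|exact: ce].
move=> t ht; have := Hd1 x t ht (lt_le_trans hx m2); rewrite ler_norml; lra.
Qed.

End RealContinuity.

(** * Absorption of the error terms *)

Section Absorb.
Context {R : realType}.

Lemma sqr_sum_le (J : finType) (x : J -> R) :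
  (\sum_j x j) ^+ 2 <= #|J|%:R * \sum_j x j ^+ 2.
Proof.
have h : \sum_i \sum_j (x i * x j) <= \sum_i \sum_j (x i ^+ 2 / 2 + x j ^+ 2 / 2).
  apply: ler_sum => i _; apply: ler_sum => j _; have := sqr_ge0 (x i - x j); lra.
rewrite expr2 big_distrlr/=; apply: (le_trans h).
have -> : \sum_i \sum_j (x i ^+ 2 / 2 + x j ^+ 2 / 2) =
    \sum_i (x i ^+ 2 / 2 *+ #|J| + \sum_j x j ^+ 2 / 2).
  by apply: eq_bigr => i _; rewrite big_split/= sumr_const.
by rewrite big_split/= sumr_const sumrMnl -mulr_suml -mulrnDl -splitr mulr_natl.
Qed.

Lemma exprn_cancel (r : R) a n : 1 <= r -> (a <= n)%N -> r ^+ a * r^-1 ^+ n <= 1.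
Proof.
move=> r1 an; have r0 : 0 < r := lt_le_trans ltr01 r1.
by rewrite exprVn ler_pdivrMr ?exprn_gt0// mul1r ler_weXn2l.
Qed.

Let regroup (a c d x x' y z : R) :
  a * (y * d) * (c * (2 * z) * (x' * x)) = a * (2 * c * x') * d * (y * z * x).
Proof. by ring. Qed.

Let regroup1 (a b c d e : R) : a * b * (c * d) * e = a * (b * c * e) * d.
Proof. by ring. Qed.

Let exponents_le b : (2 * b + 4 <= 2 * (b + 5))%N.
Proof. by rewrite mulnDr leq_add2l. Qed.

Let lincomb_le (a x y z : R) : 0 <= a -> x <= z -> y <= z -> 2 * a * x + y <= (2 * a + 1) * z.
Proof. nra. Qed.

(* The powers of [r = sqrt T] lost in the error terms are regained from the
   exponent of the weight, [b + 5]. *)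
Lemma error_absorb b (r N D S1 W I A C : R) : let K := (b + 5)%N in
  1 <= r -> 1 <= N -> N <= r -> 1 <= D -> 0 <= S1 -> S1 ^+ 2 <= N ^+ 4 * D ->
  0 <= A -> 0 <= C -> (3 / 4) ^+ K * (r ^+ 2 / 2) <= W ->
  W * D <= I + 16 * ((63 * r ^+ 2) ^+ b * S1 * (8 / (r ^+ 2 / 2)) ^+ K) +
    16 * (8 / (r ^+ 2 / 2)) ^+ K * D +
    (2 * A * S1 + S1 ^+ 2) * (C * (2 * N) * (2 * N / (r ^+ 2 / 2)) ^+ K) ->
  16 ^+ K * 16 * (63 ^+ b + 1) + (2 * A + 1) * (2 * C * 4 ^+ K) <= (3 / 4) ^+ K / 4 * r ^+ 2 ->
  (3 / 4) ^+ K / 4 * r ^+ 2 * D <= I.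
Proof.
move=> K r1 N1 Nr D1 S10 S12 A0 C0 hW hI hE.
have r0 : 0 < r := lt_le_trans ltr01 r1.
have D0 : 0 <= D := le_trans ler01 D1.
have N0 : 0 <= N := le_trans ler01 N1.
have N4 : N ^+ 4 <= r ^+ 4 by rewrite lerXn2r ?nnegrE// ltW.
have N41 : 1 <= N ^+ 4 by rewrite exprn_ege1.
have S1D : S1 <= r ^+ 4 * D.
  have h1 : N ^+ 4 * D <= r ^+ 4 * D by rewrite ler_wpM2r.
  have h2 : 1 <= N ^+ 4 * D by rewrite mulr_ege1.
  have := sqr_ge0 (S1 - 1); move: S12 h1 h2; set a := N ^+ 4 * D; set c := r ^+ 4 * D; nra.
have S12D : S1 ^+ 2 <= r ^+ 4 * D by apply: (le_trans S12); rewrite ler_wpM2r.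
have E8 : 8 / (r ^+ 2 / 2) = 16 * r^-1 ^+ 2.
  by field; rewrite gt_eqF.
have q0 : 0 <= r^-1 by rewrite invr_ge0 ltW.
have h8 n : (n <= 2 * K)%N -> r ^+ n * (8 / (r ^+ 2 / 2)) ^+ K <= 16 ^+ K.
  move=> nK; rewrite E8 exprMn -exprM mulrCA ler_piMr ?exprn_ge0//.
  exact: exprn_cancel.
have e1 : 16 * ((63 * r ^+ 2) ^+ b * S1 * (8 / (r ^+ 2 / 2)) ^+ K) <= 16 * (63 ^+ b * 16 ^+ K * D).
  rewrite ler_wpM2l//.
  apply: (@le_trans _ _ ((63 * r ^+ 2) ^+ b * (r ^+ 4 * D) * (8 / (r ^+ 2 / 2)) ^+ K)).
    rewrite ler_wpM2r ?exprn_ge0 ?divr_ge0 ?sqr_ge0//.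
    by rewrite ler_wpM2l// exprn_ge0// mulr_ge0// sqr_ge0.
  have -> : (63 * r ^+ 2) ^+ b * (r ^+ 4 * D) * (8 / (r ^+ 2 / 2)) ^+ K =
      63 ^+ b * (r ^+ (2 * b + 4) * (8 / (r ^+ 2 / 2)) ^+ K) * D.
    rewrite exprMn -exprM exprD.
    exact: regroup1.
  by apply: ler_wpM2r => //; apply: ler_wpM2l; [exact: exprn_ge0|apply: h8; exact: exponents_le].
have e2 : 16 * (8 / (r ^+ 2 / 2)) ^+ K * D <= 16 * 16 ^+ K * D.
  rewrite ler_wpM2r// ler_wpM2l//; have := h8 0%N (leq0n _); by rewrite expr0 mul1r.
(* Here each factor of the weight gains only 1/r, since N / H is of order 1/r, while r^5 is lost:
   r^4 from the sums over n and r from N. This is what the 5 in K = b + 5 pays for. *)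
have e3 : (2 * A * S1 + S1 ^+ 2) * (C * (2 * N) * (2 * N / (r ^+ 2 / 2)) ^+ K) <=
    (2 * A + 1) * (2 * C * 4 ^+ K) * D.
  have h1 : 2 * A * S1 + S1 ^+ 2 <= (2 * A + 1) * (r ^+ 4 * D).
    exact: lincomb_le.
  have h2 : 2 * N / (r ^+ 2 / 2) <= 4 * r^-1.
    rewrite ler_pdivrMr ?divr_gt0 ?exprn_gt0//.
    have -> : 4 * r^-1 * (r ^+ 2 / 2) = 2 * r by field; rewrite gt_eqF.
    by rewrite ler_pM2l.
  have h20 : 0 <= 2 * N / (r ^+ 2 / 2) by apply: divr_ge0; [apply: mulr_ge0|apply: divr_ge0 => //; exact: sqr_ge0].
  have h3 : (2 * N / (r ^+ 2 / 2)) ^+ K <= (4 * r^-1) ^+ K.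
    by rewrite lerXn2r ?nnegrE// mulr_ge0.
  have h4 : C * (2 * N) * (2 * N / (r ^+ 2 / 2)) ^+ K <= C * (2 * r) * (4 * r^-1) ^+ K.
    apply: ler_pM => //; [by apply: mulr_ge0 => //; apply: mulr_ge0|exact: exprn_ge0|].
    by rewrite ler_wpM2l// ler_pM2l.
  apply: (@le_trans _ _ ((2 * A + 1) * (r ^+ 4 * D) * (C * (2 * r) * (4 * r^-1) ^+ K))).
    apply: ler_pM => //.
      by apply: addr_ge0; [apply: mulr_ge0 => //; apply: mulr_ge0|exact: sqr_ge0].
    apply: mulr_ge0; last exact: exprn_ge0.
    by apply: mulr_ge0 => //; apply: mulr_ge0.
  have -> : (2 * A + 1) * (r ^+ 4 * D) * (C * (2 * r) * (4 * r^-1) ^+ K) =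
     (2 * A + 1) * (2 * C * 4 ^+ K) * D * (r ^+ 5 * r^-1 ^+ K).
    by rewrite exprMn [r ^+ 5]exprSr regroup.
  rewrite ler_piMr//; last by apply: exprn_cancel => //; exact: leq_addl.
  apply: mulr_ge0 => //; apply: mulr_ge0; first by rewrite addr_ge0// mulr_ge0.
  by apply: mulr_ge0; [apply: mulr_ge0|exact: exprn_ge0].
have h5 : (3 / 4) ^+ K * (r ^+ 2 / 2) * D <= W * D by rewrite ler_wpM2r.
have h6 := ler_wpM2r D0 hE.
move: h5 h6 e1 e2 e3 hI.
set E1 := 16 * (_ * _ * _); set E2 := 16 * (_ / _) ^+ K * D; set E3 := (2 * A * _ + _) * _.
move: (16 ^+ K) (63 ^+ b) ((3 / 4) ^+ K) => x1 x2 x3.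
have -> : x3 * (r ^+ 2 / 2) * D = 2 * (x3 / 4 * r ^+ 2 * D) by field.
have -> : (x1 * 16 * (x2 + 1) + (2 * A + 1) * (2 * C * 4 ^+ K)) * D =
  16 * (x2 * x1 * D) + 16 * x1 * D + (2 * A + 1) * (2 * C * 4 ^+ K) * D by ring.
lra.
Qed.

End Absorb.

Lemma card_le_bound (J : finType) (n : J -> nat) N :
  (forall j, 0 < n j <= N)%N -> injective n -> (#|J| <= N)%N.
Proof.
move=> nN n_inj; have lt j : ((n j).-1 < N)%N by have /andP[] := nN j; case: (n j).
rewrite -[leqRHS]card_ord; apply: (leq_card (fun j => Ordinal (lt j))) => i j [] h.
apply: n_inj; rewrite -(prednK (proj1 (andP (nN i)))) -(prednK (proj1 (andP (nN j)))).
by rewrite h.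
Qed.

(** * The moment on lines to the right of the critical line *)

Section Moment.
Context {R : realType}.
Hypothesis RH : riemann_hypothesis R.
Variables (m : nat) (beta : 'I_m -> R).
Hypothesis beta0 : forall k, 0 <= beta k.

Local Notation B := (\sum_k beta k).

Definition zeta_prod (alpha : 'I_m -> R) (z : R[i]) : R :=
  \prod_k cabs (zeta (Re z +i* (Im z + alpha k))) `^ (2 * beta k).

Section Fixed.
Variables (alpha : 'I_m -> R) (T s0 : R).
Hypotheses (T6 : 6 <= T) (alphaT : forall k, `|alpha k| <= T / 2).

Let shiftE (z : R[i]) (a : R) : z + (0 +i* a) = Re z +i* (Im z + a).
Proof. by apply: complex_eq; rewrite ?ReD ?ImD //= addr0. Qed.

Let alpha_ge k : - (T / 2) <= alpha k.
Proof. by have := alphaT k; rewrite ler_norml => /andP[]. Qed.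

Let alpha_le k : alpha k <= T / 2.
Proof. by have := alphaT k; rewrite ler_norml => /andP[]. Qed.

Lemma cdiffable_zeta_shift k (z : R[i]) : T / 2 < Im z ->
  cdiffable (fun w => zeta (w + (0 +i* alpha k))) z.
Proof.
move=> hz; have n1 : z + (0 +i* alpha k) != 1.
  apply/eqP => /(congr1 (@complex.Im R)); rewrite ImD /= => h.
  by have := T6; have := alpha_ge k; lra.
have [l Hl] := zeta_cdiffable RH n1; exists l => e e0.
by have [d d0 Hd] := Hl e e0; exists d => // h /Hd; rewrite (addrAC z _ h).
Qed.

(** Since |alpha k| <= T/2, shifted points have height at least T/2 >= 3, clear of the pole and the
    real axis. The inequality s0 > 1/2 has to be strict, as zeros lie on the critical line. *)
Lemma zeta_shift_log : 2^-1 < s0 -> s0 <= 2 -> exists g : 'I_m -> R[i] -> R[i],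
  forall k z, in_rect s0 2 T (2 * T) z ->
  cexp (g k z) = zeta (Re z +i* (Im z + alpha k)) /\ cdiffable (g k) z.
Proof.
move=> s02 s01.
have H k : exists g : R[i] -> R[i], forall z, in_rect s0 2 T (2 * T) z ->
    cexp (g z) = zeta (Re z +i* (Im z + alpha k)) /\ cdiffable g z.
  have T2 : T <= 2 * T by have := T6; lra.
  have [|g Hg] := @holomorphic_log _ (fun z => zeta (z + (0 +i* alpha k))) s0 2 T (2 * T) s01 T2.
    move=> z [/andP[hx hx2] /andP[hy hy2]]; split.
      apply: (zeta_neq0_RH RH); rewrite shiftE /=; first lra.
      by rewrite gt_eqF//; have := T6; have := alpha_ge k; lra.
    exists 1 => // w hw; apply: cdiffable_zeta_shift.
    have := le_lt_trans (Im_le_cabs _) hw; rewrite ImD ImN ltr_norml; have := T6; lra.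
  by exists g => z hz; have := Hg z hz; rewrite shiftE.
have [g Hg] := choice H; by exists g.
Qed.

Variable g : 'I_m -> R[i] -> R[i].
Hypothesis s0_gt : 2^-1 <= s0.
Hypothesis gE : forall k z, in_rect s0 2 T (2 * T) z ->
  cexp (g k z) = zeta (Re z +i* (Im z + alpha k)) /\ cdiffable (g k) z.

Let F (z : R[i]) := cexp (\sum_k (beta k)%:C * g k z).

Lemma log_prod_cdiffable : chol_rect F s0 2 T (2 * T).
Proof.
move=> z hz; have /choice[l Hl] k : exists l, cdiff (g k) z l := (gE k hz).2.
have h : cdiff (fun w => \sum_k (beta k)%:C * g k w) z (\sum_k (beta k)%:C * l k).
  by apply: cdiff_sum => k; apply: cdiffZ.
by eexists; exact: cdiff_cexp_comp h.
Qed.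

Let cabsF z : cabs (F z) = expR (\sum_k beta k * Re (g k z)).
Proof.
rewrite /F cabs_cexp Re_sum; congr expR; apply: eq_bigr => k _.
by rewrite mulrC ReMr mulrC.
Qed.

Lemma log_prod_sqr z : in_rect s0 2 T (2 * T) z -> cabs (F z) ^+ 2 = zeta_prod alpha z.
Proof.
move=> hz; rewrite cabsF -expRM_natl mulr_sumr expR_sum; apply: eq_bigr => k _.
by rewrite -(gE k hz).1 cabs_cexp -expRM; congr expR; ring.
Qed.

(** The shifted points satisfy |w| <= 3 T, and [zeta_growth] gives |zeta(w)| <= 21 * 3 T. An integer
    exponent b lets this bound be cancelled against powers of the weight. *)
Lemma log_prod_le b z : B <= b%:R -> in_rect s0 2 T (2 * T) z -> cabs (F z) <= (63 * T) ^+ b.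
Proof.
move=> Bb hz; have T60 := T6; have s0_ge := s0_gt; have T63 : 1 <= 63 * T by lra.
have -> : (63 * T) ^+ b = expR (b%:R * ln (63 * T)).
  by rewrite expRM_natl lnK// posrE; lra.
rewrite cabsF ler_expR; apply: (@le_trans _ _ (B * ln (63 * T))); last first.
  by rewrite ler_wpM2r// ln_ge0.
rewrite mulr_suml; apply: ler_sum => k _; rewrite ler_wpM2l//.
rewrite -ler_expR lnK ?posrE; last lra.
rewrite -cabs_cexp (gE k hz).1.
case: hz => [/andP[hx1 hx2] /andP[hy1 hy2]].
have h1 := alpha_ge k; have h2 := alpha_le k.
set w := Re z +i* (Im z + alpha k).
have hw : cabs w <= 3 * T.
  apply: (le_trans (cabs_le_ReIm _)); rewrite [Re w]/= [Im w]/= !ger0_norm; lra.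
have := @zeta_growth _ RH w; rewrite [Re w]/= [Im w]/= => hg.
have {}hg : cabs (zeta w) <= 21 * cabs w by apply: hg; lra.
lra.
Qed.

End Fixed.

Let exponent_le (s l l' : R) : 2^-1 <= s -> 0 <= l -> l <= l' ->
  2 * ((2 - 2 * s) * l) <= 3 * l' + - (2 * s) * l.
Proof. nra. Qed.

Lemma moment_diag : exists2 c : R, 0 < c & exists T0 : R, forall T, T0 <= T ->
  forall alpha : 'I_m -> R, (forall k, `|alpha k| <= T / 2) ->
  forall y N, (0 < N)%N -> N%:R ^+ 2 <= T -> forall s0, 2^-1 < s0 -> s0 <= 1 ->
  c * T * (\sum_(S : {set 'I_y.+1} | [forall p in S, prime p] && (setprod S <= N)%N)
    cabs (\prod_(p in S) twist alpha beta p) ^+ 2 * expR (- (2 * s0) * ln (setprod S)%:R)) <=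
  rint T (2 * T) (fun t => zeta_prod alpha (s0 +i* t)).
Proof.
pose b := (Num.truncn B).+1.
have Bb : B <= b%:R by apply/ltW/truncnS_gt.
have [C C0 HC] := @osc_bound R (b + 5)%N.
pose A : R := expR (2 * B).
pose E : R := 16 ^+ (b + 5)%N * 16 * (63 ^+ b + 1) + (2 * A + 1) * (2 * C * 4 ^+ (b + 5)%N).
pose c : R := (3 / 4) ^+ (b + 5)%N / 4.
have c0 : 0 < c by rewrite divr_gt0// exprn_gt0.
exists c => //; exists (Num.max 16 (E / c)) => T; rewrite ge_max => /andP[T16 TE].
move=> alpha alphaT y N N0 NT s0 s02 s01.
have T6 : 6 <= T by lra.
have T2T : T <= 2 * T by lra.
have T0 : 0 < T by lra.
pose u := 3 * T / 2; pose H := T / 2.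
have uHm : u - H = T by rewrite /u /H; lra.
have uHp : u + H = 2 * T by rewrite /u /H; lra.
have H2 : 2 <= H by rewrite /H; lra.
have s0le2 : s0 <= 2 by lra.
have s0ge := ltW s02.
pose r := Num.sqrt T.
have rT : r ^+ 2 = T by rewrite sqr_sqrtr// ltW.
have r0 : 0 <= r by rewrite sqrtr_ge0.
have r4 : 4 <= r.
  by rewrite -(@ler_sqr _ 4 r) ?nnegrE// rT; lra.
have Nr : N%:R <= r by rewrite -(@ler_sqr _ N%:R r) ?nnegrE// rT.
have [g gE] := zeta_shift_log T6 alphaT s02 s0le2.
pose J := {S : {set 'I_y.+1} | [forall p in S, prime p] && (setprod S <= N)%N}.
have JP (j : J) p : p \in val j -> prime p by have /andP[/forall_inP h _] := valP j; exact: h.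
pose d (j : J) : R[i] := \prod_(p in val j) twist alpha beta p.
pose n (j : J) := setprod (val j).
have n_inj : injective n.
  move=> j1 j2 /(setprod_inj (JP j1) (JP j2)) h; exact: val_inj.
have nN j : (0 < n j <= N)%N.
  by rewrite setprod_gt0 ?JP//; [have /andP[] := valP j|exact: JP].
have NH : 2 * N%:R <= H.
  have h : r * 4 <= r ^+ 2 by rewrite expr2 ler_wpM2l.
  by rewrite /H -rT; lra.
have M0 : 0 <= (63 * T) ^+ b by rewrite exprn_ge0// mulr_ge0// ltW.
pose F (z : R[i]) := cexp (\sum_k (beta k)%:C * g k z).
have in_line x t : s0 <= x <= 2 -> T <= t <= 2 * T -> in_rect s0 2 T (2 * T) (x +i* t).
  by move=> hx ht; split.
have line2 t : T <= t <= 2 * T -> in_rect s0 2 T (2 * T) (2 +i* t).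
  by apply: in_line; rewrite s0le2 lexx.
have hF : chol_rect F s0 2 (u - H) (u + H).
  by rewrite uHm uHp; exact: (log_prod_cdiffable gE).
have HM x t : s0 <= x <= 2 -> t = u - H \/ t = u + H -> cabs (F (x +i* t)) <= (63 * T) ^+ b.
  rewrite uHm uHp => hx ht; apply: (log_prod_le T6 alphaT s0ge gE Bb); apply: in_line => //.
  by case: ht => ->; rewrite lexx T2T.
have approx e : 0 < e -> exists (I : finType) (a : I -> R[i]) (q : I -> nat) (c : R[i]),
   [/\ cabs c = 1, forall i, (0 < q i)%N,
       forall t, u - H <= t <= u + H ->
       cabs (c * F (2 +i* t) - \sum_i a i * natpow (q i) (- (2 +i* t))) <= e,
       \sum_i cabs (a i) * expR (-2 * ln (q i)%:R) <= A
     & forall j : J, \sum_i (if q i == n j then a i else 0) = d j].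
  move=> e0; rewrite uHm uHp.
  have hg k t : T <= t <= 2 * T -> cdiffable (g k) (2 +i* t) /\
      cexp (g k (2 +i* t)) = zeta (2 +i* (t + alpha k)).
    by move=> ht; have [h1 h2] := gE k _ (line2 t ht); split.
  have [I [a [q [c' [h1 h2 h3 h4 h5]]]]] := line_dirichlet_approx RH y beta0 T2T hg e0.
  by exists I, a, q, c'; split => // j; apply: h5; exact: JP.
have main := main_inequality HC s0ge s01 H2 N0 NH nN n_inj hF M0 HM approx.
rewrite uHm uHp in main.
have EI : rint T (2 * T) (fun t => cabs (F (s0 +i* t)) ^+ 2) =
    rint T (2 * T) (fun t => zeta_prod alpha (s0 +i* t)).
  apply: eq_rint => t ht; apply: (log_prod_sqr gE); apply: in_line => //.
  by rewrite lexx.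
rewrite EI in main; move: main.
have hW := rweight_int_ge (b + 5) s0 u H2; rewrite uHm uHp in hW.
have -> : \sum_(S : {set 'I_y.+1} | [forall p in S, prime p] && (setprod S <= N)%N)
    cabs (\prod_(p in S) twist alpha beta p) ^+ 2 * expR (- (2 * s0) * ln (setprod S)%:R) =
    \sum_(j : J) cabs (d j) ^+ 2 * expR (- (2 * s0) * ln (n j)%:R).
  exact: (big_sub (fun S : {set 'I_y.+1} => [forall p in S, prime p] && (setprod S <= N)%N)
    (fun S => cabs (\prod_(p in S) twist alpha beta p) ^+ 2 * expR (- (2 * s0) * ln (setprod S)%:R))).
have N1 : 1 <= (N%:R : R) by rewrite ler1n.
(* The empty set contributes 1; hence errors not proportional to the diagonal sum can be charged to
   it. *)
have D1 : 1 <= \sum_(j : J) cabs (d j) ^+ 2 * expR (- (2 * s0) * ln (n j)%:R).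
  have h0 : [forall p in (finset.set0 : {set 'I_y.+1}), prime p] && (setprod (finset.set0 : {set 'I_y.+1}) <= N)%N.
    rewrite /setprod big_set0 N0 andbT; apply/forall_inP => p; by rewrite finset.in_set0.
  pose j0 : J := Sub finset.set0 h0.
  rewrite (bigD1 j0)//= /d /n /setprod SubK !big_set0 cabs1 expr1n mul1r ln1 mulr0 expR0.
  by rewrite lerDl sumr_ge0// => j _; rewrite mulr_ge0 ?sqr_ge0 ?expR_ge0.
have S10 : 0 <= \sum_(j : J) cabs (d j) * expR ((2 - 2 * s0) * ln (n j)%:R).
  by apply: sumr_ge0 => j _; rewrite mulr_ge0 ?cabs_ge0 ?expR_ge0.
(* Cauchy-Schwarz over at most N indices gives one factor N; passing from n^(2 (2 - 2 s0)) to n^(-2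
   s0) costs n^(4 - 2 s0) <= N^3. *)
have S12 : (\sum_(j : J) cabs (d j) * expR ((2 - 2 * s0) * ln (n j)%:R)) ^+ 2 <=
    N%:R ^+ 4 * \sum_(j : J) cabs (d j) ^+ 2 * expR (- (2 * s0) * ln (n j)%:R).
  apply: (le_trans (sqr_sum_le _)); rewrite [_ ^+ 4]exprS -mulrA.
  apply: ler_pM; [exact: ler0n|by apply: sumr_ge0 => j _; exact: sqr_ge0| |].
    by rewrite ler_nat; exact: card_le_bound nN n_inj.
  rewrite mulr_sumr; apply: ler_sum => j _.
  rewrite exprMn [leRHS]mulrCA ler_wpM2l ?sqr_ge0//.
  have /andP[n0 nN'] := nN j.
  have -> : N%:R ^+ 3 = expR (3 * ln N%:R) :> R by rewrite expRM_natl lnK// posrE ltr0n.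
  rewrite -expRM_natl -expRD ler_expR.
  have l0 : 0 <= ln ((n j)%:R : R) by rewrite ln_ge0// ler1n.
  have l1 : ln ((n j)%:R : R) <= ln N%:R by rewrite ler_ln ?posrE ?ltr0n// ler_nat.
  exact: exponent_le.
move: D1 S10 S12; set D := \sum_(j : J) _ ^+ 2 * _; set S1 := \sum_(j : J) _ * expR ((2 - _) * _).
move=> D1 S10 S12 main.
have r1 : 1 <= r by apply: le_trans r4; rewrite ler1n.
have := @error_absorb _ b r N%:R D S1 (rint T (2 * T) (rweight (b + 5) u H))
  (rint T (2 * T) (fun t => zeta_prod alpha (s0 +i* t))) A C r1 N1 Nr D1 S10 S12 (expR_ge0 _) C0.
rewrite rT => /(_ hW main); apply.
have hE : E <= c * T by rewrite mulrC -ler_pdivrMr.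
exact: hE.
Qed.

End Moment.

Section CriticalLine.
Context {R : realType}.
Hypothesis RH : riemann_hypothesis R.
Variables (m : nat) (alpha beta : 'I_m -> R) (T : R).
Hypothesis beta0 : forall k, 0 <= beta k.
Hypotheses (T6 : 6 <= T) (alphaT : forall k, `|alpha k| <= T / 2).

Lemma rcont_zeta_prod z : T / 2 < Im z -> rcont (zeta_prod beta alpha) z.
Proof.
move=> hz; apply: rcont_prod => k; apply: rcont_powR.
- by rewrite mulr_ge0.
- by move=> w; exact: cabs_ge0.
apply: rcont_cabs; have [l Hl] := cdiffable_zeta_shift RH T6 alphaT k hz.
have h w : zeta (w + (0 +i* alpha k)) = zeta (Re w +i* (Im w + alpha k)).
  by congr zeta; apply: complex_eq; rewrite ?ReD ?ImD //= addr0.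
apply: cdiff_cont; exact: cdiff_exteq Hl h erefl.
Qed.

(* The factor [expR (- 1)] absorbs the change of the diagonal sum when [s0] is moved
   to [1 / 2]. *)
Lemma moment_ge_limit (c : R) y N : 0 <= c -> (0 < N)%N ->
  (forall s0, 2^-1 < s0 -> s0 <= 1 ->
    c * (\sum_(S : {set 'I_y.+1} | [forall p in S, prime p] && (setprod S <= N)%N)
      cabs (\prod_(p in S) twist alpha beta p) ^+ 2 * expR (- (2 * s0) * ln (setprod S)%:R)) <=
    rint T (2 * T) (fun t => zeta_prod beta alpha (s0 +i* t))) ->
  c * expR (- 1) * (\sum_(S : {set 'I_y.+1} | [forall p in S, prime p] && (setprod S <= N)%N)
      \prod_(p in S) (cabs (twist alpha beta p) ^+ 2 / (p : nat)%:R)) <=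
  rint T (2 * T) (fun t => zeta_prod beta alpha (2^-1 +i* t)).
Proof.
move=> c0 N0 H.
have lN : 0 <= ln (N%:R : R) by rewrite ln_ge0// ler1n.
(* For 1/2 < s0 < 1/2 + d and n <= N this gives (2 s0 - 1) log n <= 1, so the diagonal sum drops by
   at most a factor e. *)
pose d : R := (2 * (ln N%:R + 1))^-1.
have d0 : 0 < d by rewrite invr_gt0; lra.
have dN : 2 * d * (ln N%:R + 1) = 1 by rewrite /d; field; rewrite gt_eqF//; lra.
have d2 : d <= 2^-1 by rewrite lef_pV2 ?posrE; lra.
have T2 : T < 2 * T by have := T6; lra.
apply: (rint_ver_ge T2 d0).
  move=> x t _ /andP[ht _]; apply: rcont_zeta_prod; rewrite [Im _]/=; have := T6; lra.
move=> x x1 x2; apply: le_trans (H x x1 _); last lra.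
rewrite -mulrA ler_wpM2l// mulr_sumr; apply: ler_sum => S /andP[/forall_inP HS SN].
have S0 := setprod_gt0 HS.
have -> : \prod_(p in S) (cabs (twist alpha beta p) ^+ 2 / (p : nat)%:R) =
    cabs (\prod_(p in S) twist alpha beta p) ^+ 2 * expR (- ln (setprod S)%:R).
  rewrite big_split/= prodfV -natr_prod -/(setprod S) expRN lnK ?posrE ?ltr0n//.
  by rewrite cabs_prod prodrXl.
rewrite mulrCA ler_wpM2l ?sqr_ge0// -expRD ler_expR.
have l0 : 0 <= ln ((setprod S)%:R : R) by rewrite ln_ge0// ler1n.
have l1 : ln ((setprod S)%:R : R) <= ln N%:R by rewrite ler_ln ?posrE ?ltr0n// ler_nat.
have h1 : (x - 2^-1) * ln (setprod S)%:R <= d * (ln N%:R + 1).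
  by apply: ler_pM => //; lra.
move: h1 dN; set l := ln (setprod S)%:R; set e := ln N%:R + 1; lra.
Qed.

End CriticalLine.

Theorem theorem1p1 (R : realType) (RH : riemann_hypothesis R)
    (m : nat) (m_ge1 : (1 <= m)%N)
    (beta : 'I_m -> R) (beta_ge0 : forall k, 0 <= beta k) :
  exists2 c : R, 0 < c &
  exists T0 : R, forall T : R, T0 <= T ->
    forall alpha : 'I_m -> R, (forall k, `|alpha k| <= T / 2) ->
    c * T * ln T `^ (\sum_(k < m) beta k ^+ 2) *
      \prod_(j < m) \prod_(k < m | (j < k)%N)
        cabs (zeta ((1 + (ln T)^-1) +i* (alpha j - alpha k)))
          `^ (2 * beta j * beta k)
    <= shifted_moment alpha beta T.
Proof.
have [c1 c10 [T1 HT1]] := moment_diag RH beta_ge0.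
pose B := \sum_k beta k.
pose q : R := 2 * expR 1 ^+ 2 * prime_cst * B ^+ 2 + 1.
have q1 : 1 <= q.
  rewrite lerDr; apply: mulr_ge0; last exact: sqr_ge0.
  by rewrite mulr_ge0 ?prime_cst_ge0// mulr_ge0 ?sqr_ge0.
(* [k] is the exponent kappa. Rankin's trick requires q k L <= log N; with this choice the left side
   is L / 4, half of log sqrt T, which leaves room for rounding. The threshold L >= 4 q makes k L >=
   1. *)
pose k : R := (4 * q)^-1.
have q4 : 1 <= 4 * q by lra.
have k0 : 0 < k by rewrite invr_gt0; lra.
have k1 : k <= 1 by rewrite invf_le1; lra.
have kq : 4 * q * k = 1 by rewrite /k mulfV// gt_eqF//; lra.
pose c2 : R := expR (- (2 * B ^+ 2 + B ^+ 2 * (2 * prime_cst / k))) * (expR (- (B ^+ 2) ^+ 2) / 2).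
have c20 : 0 < c2 by rewrite mulr_gt0 ?divr_gt0 ?expR_gt0.
exists (c1 * expR (- 1) * c2); first by rewrite !mulr_gt0 ?expR_gt0.
exists (Num.max T1 (Num.max 6 (expR (4 * q)))) => T.
rewrite !ge_max => /and3P[TT1 T6 Tq] alpha alphaT.
have T0 : 0 < T by lra.
pose L := ln T.
have TL : expR L = T by rewrite lnK.
have Lq : 4 * q <= L by rewrite -ler_expR TL.
have kL : 1 <= k * L by rewrite -kq mulrC ler_pM2l.
pose y := Num.truncn (expR (k * L)).
pose N := Num.truncn (expR (L / 2)).
have y0 : (0 < y)%N by rewrite truncn_gt0 -[leLHS]expR0 ler_expR; lra.
have yL p : (y < p)%N -> k * L <= ln p%:R.
  move=> yp; have p0 : 0 < (p%:R : R) by rewrite ltr0n (leq_trans _ yp).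
  rewrite -ler_expR lnK ?posrE//; apply: (le_trans (ltW (truncnS_gt _))).
  by rewrite ler_nat.
have ly : ln y%:R <= k * L.
  by rewrite -ler_expR lnK ?posrE ?ltr0n// truncn_le expR_ge0.
(* Rounding sqrt T = s^2 down to N keeps N >= s = T^(1/4), because s^2 - 1 >= s for s >= 2. *)
pose s := expR (L / 4).
have s2 : 2 <= s by apply: le_trans (expR_ge1Dx _); lra.
have ss : expR (L / 2) = s ^+ 2 by rewrite /s -expRM_natl; congr expR; field.
have Ns : s <= N%:R.
  have := truncnS_gt (expR (L / 2)); rewrite -/N ss -natr1; nra.
have N0 : (0 < N)%N by rewrite -(ltr0n R); lra.
have LN : q * (k * L) <= ln N%:R.
  rewrite -ler_expR lnK ?posrE ?ltr0n//; apply: le_trans Ns.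
  have -> : q * (k * L) = 4 * q * k * L / 4 by field.
  by rewrite kq mul1r ler_expR.
have NT : N%:R ^+ 2 <= T.
  rewrite -TL -[L](@divfK _ 2)// mulrC expRM_natl lerXn2r ?nnegrE ?expR_ge0//.
  by rewrite truncn_le expR_ge0.
have c1T : 0 <= c1 * T by rewrite mulr_ge0// ltW.
have lim := moment_ge_limit RH beta_ge0 T6 alphaT c1T N0 (HT1 T TT1 alpha alphaT y N N0 NT).
have diag := diagonal_ge RH alpha beta_ge0 k0 k1 kL yL y0 ly LN N0.
have eqm : shifted_moment alpha beta T = rint T (2 * T) (fun t => zeta_prod beta alpha (2^-1 +i* t)).
  by [].
rewrite eqm; apply: le_trans lim.
have c3 : 0 <= c1 * T * expR (- 1) by rewrite mulr_ge0 ?expR_ge0.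
apply: le_trans (ler_wpM2l c3 diag).
have regroup (a c e f g t : R) : a * e * c * t * f * g = a * t * e * (f * g * c) by ring.
by rewrite regroup.
Qed.
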